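(* Let $N\ge1$, $p\in(1,\infty)$, $0<s<k<1$. For every bounded open set $\Omega\subset\mathbb{R}^N$, the first eigenfunctions satisfy $$\lim_{k\to s^+}[u_k-u_s]_{\widetilde W^{s,p}(\Omega)}=0 .$$
   Context: For $\sigma\in(0,1)$ put $[u]_{\widetilde W^{\sigma,p}(\Omega)}:=\left(\int_{\mathbb{R}^N}\int_{\mathbb{R}^N}\frac{|u(x)-u(y)|^p}{|x-y|^{N+\sigma p}}\,dx\,dy\right)^{1/p}$. The space $\widetilde W^{\sigma,p}_0(\Omega)$ is the completion of $C_0^\infty(\Omega)$ (functions extended by $0$ to $\mathbb{R}^N$) with respect to this norm. The first $(\sigma,p)$-eigenvalue is $$\lambda_\sigma:=\min\left\{[u]^p_{\widetilde W^{\sigma,p}(\Omega)}:\ u\in\widetilde W^{\sigma,p}_0(\Omega),\ \|u\|_{L^p(\Omega)}=1,\ u\ge 0\right\},$$ and $u_\sigma$ denotes the (unique) minimizer, i.e. the nonnegative first $(\sigma,p)$-eigenfunction normalized by $\|u_\sigma\|_{L^p(\Omega)}=1$. No regularity of $\partial\Omega$ is assumed. *)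

(* Defs.v *)
From HB Require Import structures.
From mathcomp Require Import all_boot all_order all_algebra.
From mathcomp Require Import all_classical all_reals all_analysis.

Set Implicit Arguments.
Unset Strict Implicit.
Unset Printing Implicit Defensive.
Import Order.TTheory GRing.Theory Num.Theory.
Import numFieldNormedType.Exports.
Local Open Scope classical_set_scope.
Local Open Scope ring_scope.

Definition rV_display : measure_display -> measure_display.
Proof. exact. Qed.

(* The product (Borel) sigma-algebra of R^n: the one generated by the
   coordinate maps. *)
Section measurable_rV.
Context {d} {T : measurableType d} (n : nat).

Let coord : 'I_n -> 'rV[T]_n -> T := fun i x => x ord0 i.

Let rV_set0 : g_sigma_preimage coord set0.
Proof. exact: sigma_algebra0. Qed.

Let rV_setC A : g_sigma_preimage coord A -> g_sigma_preimage coord (~` A).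
Proof. exact: sigma_algebraC. Qed.

Let rV_bigcup (F : _^nat) : (forall i, g_sigma_preimage coord (F i)) ->
  g_sigma_preimage coord (\bigcup_i (F i)).
Proof. exact: sigma_algebra_bigcup. Qed.

HB.instance Definition _ := @isMeasurable.Build (rV_display d)
  ('rV[T]_n) (g_sigma_preimage coord) rV_set0 rV_setC rV_bigcup.
End measurable_rV.


Lemma measurable_coord d (T : measurableType d) n (i : 'I_n) :
  measurable_fun [set: 'rV[T]_n] (fun x => x ord0 i).
Proof.
move=> _ Y mY; rewrite setTI; apply: sub_sigma_algebra => /=.
rewrite -bigcup_seq/=; exists i => /=; first by rewrite mem_index_enum.
by exists Y => //; rewrite setTI.
Qed.

Lemma measurable_fun_rVP d1 d2 (T1 : measurableType d1) (T2 : measurableType d2)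
    n (f : T1 -> 'rV[T2]_n) :
  (forall i, measurable_fun setT (fun x => f x ord0 i)) ->
  measurable_fun setT f.
Proof.
move=> mf; pose C : set (set 'rV[T2]_n) := fun A => measurable (f @^-1` A).
suff : measurable `<=` C by move=> MC _ A mA; rewrite setTI; exact: MC.
apply: smallest_sub.
  split; first by rewrite /C preimage_set0.
  - by move=> A CA; rewrite /C setTD preimage_setC; exact: measurableC.
  - move=> F CF; rewrite /C preimage_bigcup.
    by apply: bigcup_measurable => k _; exact: CF.
rewrite -bigcup_seq => A [i _] [B mB <-]; rewrite setTI.
by have := mf i measurableT B mB; rewrite setTI.
Qed.

Section lebesgue_rV.
Variable R : realType.

Definition rV_cons n (xy : measurableTypeR R * 'rV[R]_n) : 'rV[R]_n.+1 :=
  \row_i (if unlift ord0 i is Some j then xy.2 ord0 j else xy.1).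

Lemma measurable_rV_cons n : measurable_fun setT (@rV_cons n).
Proof.
apply: measurable_fun_rVP => i; rewrite /rV_cons.
under eq_fun do rewrite mxE.
case: unliftP => [j _|_]; last exact: measurable_fst.
exact: (measurableT_comp (measurable_coord j) measurable_snd).
Qed.

Section step.
Variables (n : nat) (mu : {sigma_finite_measure set 'rV[R]_n -> \bar R}).

Definition lebesgue_rV_step : set 'rV[R]_n.+1 -> \bar R :=
  pushforward (lebesgue_measure \x mu)%E (@rV_cons n).

Let step0 : lebesgue_rV_step set0 = 0%E.
Proof. by rewrite /lebesgue_rV_step /pushforward preimage_set0 measure0. Qed.

Let step_ge0 A : (0 <= lebesgue_rV_step A)%E.
Proof. by rewrite /lebesgue_rV_step /pushforward measure_ge0. Qed.

Let step_sigma_additive : semi_sigma_additive lebesgue_rV_step.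
Proof.
have mc A : measurable A -> measurable (@rV_cons n @^-1` A).
  by move=> mA; rewrite -[X in measurable X]setTI; exact: measurable_rV_cons.
move=> F mF tF mUF; rewrite /lebesgue_rV_step /pushforward preimage_bigcup.
apply: measure_semi_sigma_additive => [k| |]; first exact: mc.
- apply/trivIsetP => /= i j _ _ ij; rewrite -preimage_setI.
  by move/trivIsetP : tF => /(_ _ _ _ _ ij) ->//; rewrite preimage_set0.
- by rewrite -preimage_bigcup; exact: mc.
Qed.

HB.instance Definition _ := isMeasure.Build _ _ _ lebesgue_rV_step
  step0 step_ge0 step_sigma_additive.

Let rV_uncons (x : 'rV[R]_n.+1) : measurableTypeR R * 'rV[R]_n :=
  (x ord0 ord0, \row_j x ord0 (lift ord0 j)).

Let rV_consK : cancel (@rV_cons n) rV_uncons.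
Proof.
move=> [x y]; rewrite /rV_uncons /rV_cons !mxE unlift_none; congr pair.
by apply/rowP => j; rewrite !mxE liftK.
Qed.

Let rV_unconsK : cancel rV_uncons (@rV_cons n).
Proof.
move=> x; apply/rowP => i; rewrite !mxE.
by case: unliftP => [j ->|->//] /=; rewrite mxE.
Qed.

Let measurable_rV_uncons : measurable_fun setT rV_uncons.
Proof.
apply/measurable_fun_pairP; split => /=; first exact: measurable_coord.
apply: measurable_fun_rVP => i /=; under eq_fun do rewrite mxE.
exact: measurable_coord.
Qed.

Let step_sigma_finite : sigma_finite setT lebesgue_rV_step.
Proof.
have /sigma_finiteP[F [FT ndF Foo]] := sigma_finiteT (@lebesgue_measure R).
have /sigma_finiteP[G [GT ndG Goo]] := sigma_finiteT mu.
exists (fun k => rV_uncons @^-1` (F k `*` G k)) => [|k].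
  apply/seteqP; split => // x _.
  have : [set: measurableTypeR R] (rV_uncons x).1 by [].
  have : [set: 'rV[R]_n] (rV_uncons x).2 by [].
  rewrite FT GT => -[i _ Gi] [j _ Fj]; exists (maxn i j) => //; split.
    by move: Fj; exact/subsetPset/ndF/leq_maxr.
  by move: Gi; exact/subsetPset/ndG/leq_maxl.
have [mF Fk] := Foo k; have [mG Gk] := Goo k; split.
  rewrite -[X in measurable X]setTI; apply: measurable_rV_uncons => //.
  exact: measurableX.
rewrite /lebesgue_rV_step /pushforward -comp_preimage.
rewrite (_ : _ \o _ = id); last by apply/funext => x /=; rewrite rV_consK.
by rewrite product_measure1E// lte_mul_pinfty// ge0_fin_numE.
Qed.

HB.instance Definition _ := Measure_isSigmaFinite.Build _ _ _ lebesgue_rV_step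
  step_sigma_finite.

Lemma lebesgue_rV_step_box (A : 'I_n.+1 -> set R) :
  (forall i, measurable (A i)) ->
  lebesgue_rV_step [set x | forall i, A i (x ord0 i)] =
  (lebesgue_measure (A ord0) *
   mu [set x | forall j, A (lift ord0 j) (x ord0 j)])%E.
Proof.
move=> mA; rewrite /lebesgue_rV_step /pushforward.
pose B := [set x : 'rV[R]_n | forall j, A (lift ord0 j) (x ord0 j)].
have mB : measurable B.
  rewrite (_ : B = \bigcap_(j in [set: 'I_n])
      ((fun x : 'rV[R]_n => x ord0 j) @^-1` A (lift ord0 j))).
    apply: fin_bigcap_measurable => // j _.
    by rewrite -[X in measurable X]setTI; exact: measurable_coord.
  by apply/seteqP; split => [x Bx j _|x Bx j]; [exact: Bx|exact: (Bx j)].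
rewrite -/B -product_measure1E//; last exact: mA.
congr (product_measure1 _ _ _); apply/seteqP; split => [[x y]/= xyA|[x y]/= [Ax By] i].
  split => /=; first by have := xyA ord0; rewrite mxE unlift_none.
  by move=> j; have := xyA (lift ord0 j); rewrite mxE liftK.
by rewrite mxE; case: unliftP => [j ->|->//]; exact: By.
Qed.

End step.

(* Lebesgue measure on R^n, as the n-fold product of the one-dimensional one. *)
Fixpoint lebesgue_rV n : {sigma_finite_measure set 'rV[R]_n -> \bar R} :=
  match n with
  | 0 => \d_(0 : 'rV[R]_0)
  | n.+1 => lebesgue_rV_step (lebesgue_rV n)
  end.

Lemma lebesgue_rV_box n (A : 'I_n -> set R) : (forall i, measurable (A i)) ->
  lebesgue_rV n [set x | forall i, A i (x ord0 i)] =
  (\prod_(i < n) lebesgue_measure (A i))%E.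
Proof.
elim: n A => [|n IHn] A mA; last first.
  rewrite big_ord_recl /= lebesgue_rV_step_box//.
  by rewrite (IHn (fun j => A (lift ord0 j))).
by rewrite big_ord0 /= diracE mem_set// => -[].
Qed.

End lebesgue_rV.

Section fractional_sobolev.
Variables (R : realType) (N : nat).
Implicit Types (s p : R) (Omega : set 'rV[R]_N) (u : 'rV[R]_N -> R).

(* The library's norm `|x| on 'rV[R]_N is the sup norm. *)
Definition enorm (x : 'rV[R]_N) : R := Num.sqrt (\sum_i x ord0 i ^+ 2).

(* [u]_{s,p}, with values in [0, +oo]; on the diagonal x = y the integrand
   is 0 / 0 = 0. *)
Definition gagliardo s p u : \bar R :=
  ((\int[lebesgue_rV R N]_x \int[lebesgue_rV R N]_y
     ((`|u x - u y| `^ p) / (enorm (x - y) `^ (N%:R + s * p)))%:E) `^ p^-1)%E.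

Definition Lp_norm p Omega u : \bar R :=
  Lnorm (lebesgue_rV R N) p%:E (EFin \o (u \_ Omega)).

Fixpoint is_Ck k u : Prop :=
  match k with
  | 0 => continuous u
  | k.+1 => forall i : 'I_N, (forall x, derivable u x (delta_mx ord0 i)) /\
              is_Ck k (fun x => 'D_(delta_mx ord0 i) u x)
  end.

Definition test_function Omega u : Prop :=
  [/\ forall k, is_Ck k u,
      compact (closure [set x | u x != 0]) &
      closure [set x | u x != 0] `<=` Omega].

(* The completion of the test functions for [.]_{s,p}, realized as a space of
   functions on R^N: since Omega is bounded, a function vanishing a.e. outside
   Omega satisfies the Poincare inequality |u|_p <= C [u]_{s,p}, so Cauchy
   sequences of test functions converge to such a function, unique up to a.e.
   equality. Elements are represented by Borel functions. *)
Definition W0 s p Omega : set ('rV[R]_N -> R) :=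
  [set u : 'rV[R]_N -> R | [/\ measurable_fun setT u,
     {ae lebesgue_rV R N, forall x, ~ Omega x -> u x = 0} &
     exists2 phi : nat -> 'rV[R]_N -> R,
       forall n, test_function Omega (phi n) &
       gagliardo s p (phi n \- u) @[n --> \oo] --> 0%E]].

Definition admissible s p Omega : set ('rV[R]_N -> R) :=
  [set u : 'rV[R]_N -> R | [/\ W0 s p Omega u, Lp_norm p Omega u = 1%E &
     {ae lebesgue_rV R N, forall x, 0 <= u x}]].

Definition first_eigenvalue s p Omega : \bar R :=
  ereal_inf [set (gagliardo s p u `^ p)%E | u in admissible s p Omega].

(* Minimizers; unique up to a.e. equality. *)
Definition first_eigenfunction s p Omega u : Prop :=
  admissible s p Omega u /\
  (gagliardo s p u `^ p)%E = first_eigenvalue s p Omega.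

End fractional_sobolev.

(* Main.v *)
From HB Require Import structures.
Require Import Defs.
From mathcomp Require Import all_boot all_order all_algebra.
From mathcomp Require Import all_classical all_reals all_analysis.
From mathcomp Require Import measurable_realfun ring lra.
Import Order.TTheory GRing.Theory Num.Theory.
Import numFieldNormedType.Exports.
Local Open Scope classical_set_scope.
Local Open Scope ring_scope.
Set Implicit Arguments.
Unset Strict Implicit.
Unset Printing Implicit Defensive.

(** Write P(u) for the integral of |u|^p and G_k(u) for the p-th power of the
    seminorm of order k, so that the first eigenvalue lambda_k is the minimum
    of G_k over the nonnegative u in the completion with P(u) = 1.

    The u_k minimize asymptotically for the order s. For a fixed pair (x, y)
    the kernel |x - y|^-(N + kp) is convex in k, hence so is k |-> G_k(u)
    ([Gp_convex]); this is the only comparison between orders that is needed,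
    together with the bound of a lower order by a higher one
    ([Gp_embedding], with the Poincare inequality [poincare]). Testing
    lambda_k with a nonnegative test function w close to u_s, of finite energy
    at some order k1 > s, and interpolating G_k(w) between G_s(w) and G_k1(w)
    gives limsup lambda_k <= lambda_s as k decreases to s
    ([eigenvalue_limsup]). Interpolating G_s(u_k) between an order s' < s and
    the order k then gives G_s(u_k) <= lambda_k + o(1), so that limsup
    G_s(u_k) <= lambda_s ([eigenpair_minimizing]). Since boundary regularity
    is not available, everything rests on the density of test functions in the
    completion. Nonnegative test functions near u_s come from the smoothed
    power mean [spmean], which replaces the positive part and does not
    increase energy.

    A minimizing family for the order s converges to u_s in the seminorm
    ([minimizer_stability]). By contradiction, take a minimizing sequence that
    stays away from u_s and an ultrafilter on the indices. Bounded energy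
    makes the sequence close in L^p to step functions on a fine grid, with
    finitely many bounded coefficients, so that it is Cauchy in L^p along the
    ultrafilter ([rellich]). The midpoint of two nearby members has P close to
    1, hence energy at least about lambda_s; uniform convexity of L^p on the
    product space then makes the sequence Cauchy in the seminorm
    ([energy_close]). Its limit is again a minimizer of norm 1.

    Minimizers are unique ([eigenfunction_unique]) by hidden convexity: along
    the power mean w = ((u^p + v^p) / 2)^(1/p) one has P(w) = 1 and
    G_s(w) <= (G_s(u) + G_s(v)) / 2 pointwise under the integral, with
    equality only where u(x) v(y) = v(x) u(y). If u and v are both minimizers
    there is equality almost everywhere; integrating the p-th power of that
    identity in y gives u = v. Thus the limit above is u_s, a contradiction. *)

(** * Convexity of powers and power means *)

(** Taking this mean of two functions does not raise their average energy;
    this hidden convexity gives uniqueness of the minimizer. *)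
HB.lock Definition pmean (R : realType) (p a b : R) : R :=
  ((a `^ p + b `^ p) / 2) `^ p^-1.

Section power_inequalities.
Context {R : realType}.
Variable p : R.
Hypothesis p1 : 1 < p.
Implicit Types a b c d x y t : R.

Let p0 : 0 < p. Proof. exact: lt_trans ltr01 p1. Qed.
Let pN0 : p != 0. Proof. by rewrite gt_eqF. Qed.

(** The graph of x^p lies above its tangent at 1: with x = e^t and after
    division by x, the inequality is a positive combination of two instances
    of 1 + y < e^y. *)
Lemma powR_gt_tangent1 x : 0 <= x -> x != 1 -> p * x < x `^ p + (p - 1).
Proof.
rewrite le_eqVlt => /predU1P[<- _|x0 x1].
  by rewrite mulr0 powR0// add0r subr_gt0.
pose t := ln x.
have t0 : t != 0 by rewrite ln_eq0.
have -> : x = expR t by rewrite lnK.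
have -> : expR t `^ p = expR t * expR ((p - 1) * t).
  by rewrite -expRM -expRD; congr expR; lra.
have e1 : expR t * expR (- t) = 1 by rewrite -expRD subrr expR0.
suff : (p * expR t) * expR (- t) <
    (expR t * expR ((p - 1) * t) + (p - 1)) * expR (- t).
  by rewrite ltr_pM2r// expR_gt0.
have -> : p * expR t * expR (- t) = p by rewrite -mulrA e1 mulr1.
have -> : (expR t * expR ((p - 1) * t) + (p - 1)) * expR (- t) =
    expR ((p - 1) * t) + (p - 1) * expR (- t).
  by rewrite mulrDl mulrAC e1 mul1r.
have h1 : 1 + (p - 1) * t < expR ((p - 1) * t).
  by apply: expR_gt1Dx; rewrite mulf_neq0// subr_eq0 gt_eqF.
have h2 : 1 + - t < expR (- t) by apply: expR_gt1Dx; rewrite oppr_eq0.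
have h3 : (p - 1) * (1 + - t) <= (p - 1) * expR (- t).
  by rewrite ler_wpM2l ?(ltW h2)// subr_ge0 ltW.
nra.
Qed.

Lemma powR_ge_tangent1 x : 0 <= x -> p * x <= x `^ p + (p - 1).
Proof.
move=> x0; have [->|x1] := eqVneq x 1; first by rewrite powR1; lra.
exact/ltW/powR_gt_tangent1.
Qed.

(** By homogeneity the weighted mean may be taken to be 1, where the tangent
    inequality applies to both points. *)
Lemma powR_strictly_convex t x y : 0 < t < 1 -> 0 <= x -> 0 <= y -> x != y ->
  (t * x + (1 - t) * y) `^ p < t * x `^ p + (1 - t) * y `^ p.
Proof.
move=> /andP[t0 t1] x0 y0 xy; set m := t * x + (1 - t) * y.
have m0 : 0 < m.
  have [x00|x00] := eqVneq x 0.
    have y00 : 0 < y by rewrite lt_neqAle y0 andbT -x00.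
    by rewrite /m x00; nra.
  have {}x0 : 0 < x by rewrite lt_neqAle x0 eq_sym x00.
  by rewrite /m; nra.
have mN0 : m != 0 by rewrite gt_eqF.
have xm0 : 0 <= x / m by rewrite divr_ge0// ltW.
have ym0 : 0 <= y / m by rewrite divr_ge0// ltW.
have e z : 0 <= z / m -> z `^ p = (z / m) `^ p * m `^ p.
  by move=> z0; rewrite -powRM ?(ltW m0)// divfK.
rewrite (e _ xm0) (e _ ym0) mulrA [X in _ + X]mulrA -mulrDl.
rewrite -[ltLHS]mul1r ltr_pM2r ?powR_gt0//.
have xm1 : x / m != 1.
  apply: contra_neq xy => /(congr1 (fun z => z * m)); rewrite divfK// mul1r /m.
  by move=> h; have : (1 - t) * (x - y) = 0; [lra|
    move=> /eqP; rewrite mulf_eq0 !subr_eq0 (gt_eqF t1)/= => /eqP].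
have h1 := powR_gt_tangent1 xm0 xm1; have h2 := powR_ge_tangent1 ym0.
have e1 : t * (x / m) + (1 - t) * (y / m) = 1.
  by rewrite mulrA [X in _ + X]mulrA -mulrDl divff.
have h3 : t * (p * (x / m)) < t * ((x / m) `^ p + (p - 1)) by rewrite ltr_pM2l.
have h4 : (1 - t) * (p * (y / m)) <= (1 - t) * ((y / m) `^ p + (p - 1)).
  by rewrite ler_wpM2l// subr_ge0 ltW.
have h5 : p * (t * (x / m) + (1 - t) * (y / m)) = p by rewrite e1 mulr1.
lra.
Qed.

Lemma powR_convex t x y : 0 < t < 1 -> 0 <= x -> 0 <= y ->
  (t * x + (1 - t) * y) `^ p <= t * x `^ p + (1 - t) * y `^ p.
Proof.
move=> t01 x0 y0; have [->|xy] := eqVneq x y; last exact/ltW/powR_strictly_convex.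
by rewrite -!mulrDl subrKC !mul1r.
Qed.

Lemma le_powRp x y : 0 <= x -> x <= y -> x `^ p <= y `^ p.
Proof.
move=> x0 xy; apply: ge0_ler_powR => //; first exact: ltW.
by rewrite nnegrE (le_trans x0).
Qed.

Lemma lt_powRp x y : 0 <= x -> x < y -> x `^ p < y `^ p.
Proof.
move=> x0 xy; apply: gt0_ltr_powR => //.
by rewrite nnegrE (le_trans x0)// ltW.
Qed.

Lemma powRpK x : 0 <= x -> (x `^ p) `^ p^-1 = x.
Proof. by move=> x0; rewrite -powRrM divff// powRr1. Qed.

Lemma powRVpK x : 0 <= x -> (x `^ p^-1) `^ p = x.
Proof. by move=> x0; rewrite -powRrM mulVf// powRr1. Qed.

(** If |a - b| is small compared with |a|, the factor 1 + eta absorbs it;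
    otherwise |a| is at most a multiple of |a - b|. *)
Lemma normr_powR_le eta : 0 < eta -> exists2 C, 0 <= C & forall a b,
  `|b| `^ p <= (1 + eta) * `|a| `^ p + C * `|a - b| `^ p.
Proof.
(* th is chosen so that (1 + th)^p = 1 + eta. *)
move=> eta0; pose th := (1 + eta) `^ p^-1 - 1.
have th0 : 0 < th.
  have : 1 `^ p^-1 < (1 + eta) `^ p^-1.
    by apply: gt0_ltr_powR; rewrite ?invr_gt0 ?nnegrE//; lra.
  by rewrite powR1 subr_gt0.
exists ((1 + th^-1) `^ p) => [|a b]; first exact: powR_ge0.
have bab : `|b| <= `|a| + `|a - b|.
  by rewrite -{1}[b](subKr a) (le_trans (ler_normB _ _)).
have [h|h] := leP `|a - b| (th * `|a|).
  have : `|b| `^ p <= ((1 + eta) `^ p^-1 * `|a|) `^ p.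
    by apply: le_powRp => //; rewrite -[X in X * _](subrK 1) -/th; lra.
  rewrite powRM ?powR_ge0// powRVpK; last lra.
  by move=> /le_trans; apply; rewrite lerDl mulr_ge0 ?powR_ge0.
have : `|b| `^ p <= ((1 + th^-1) * `|a - b|) `^ p.
  apply: le_powRp => //; rewrite mulrDl mul1r addrC (le_trans bab)//.
  by rewrite lerD2r [leRHS]mulrC ler_pdivlMr// mulrC ltW.
rewrite powRM//; last by rewrite addr_ge0 ?invr_ge0 ?ltW.
move=> /le_trans; apply; rewrite lerDr mulr_ge0 ?powR_ge0//; lra.
Qed.

Lemma continuous_norm_powR : continuous (fun x : R => `|x| `^ p).
Proof.
move=> x; have [->|x0] := eqVneq x 0.
  apply/cvgrPdist_lt => e e0; rewrite normr0 powR0//; near=> y.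
  rewrite sub0r normrN ger0_norm ?powR_ge0// -(powRVpK (ltW e0)).
  apply: lt_powRp => //; rewrite -[y]subr0 distrC; near: y.
  by apply: cvgr_dist_lt => //; exact: powR_gt0.
apply: (@continuous_comp _ _ _ (fun x : R => `|x|) (fun x : R => x `^ p)).
  exact: norm_continuous.
apply: differentiable_continuous; apply/derivable1_diffP.
by apply: derivable_powR; rewrite in_itv/= andbT normr_gt0.
Unshelve. all: by end_near. Qed.

(** The defect in the midpoint convexity of the p-th power of the modulus. *)
Definition pgap a b := (`|a| `^ p + `|b| `^ p) / 2 - `|(a + b) / 2| `^ p.

Lemma pgap_ge0 a b : 0 <= pgap a b.
Proof.
rewrite /pgap subr_ge0.
have h := @powR_convex 2^-1 `|a| `|b| _ (normr_ge0 _) (normr_ge0 _).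
apply: (@le_trans _ _ ((2^-1 * `|a| + (1 - 2^-1) * `|b|) `^ p)).
  apply: le_powRp => //; rewrite normrM [X in _ * X]gtr0_norm ?invr_gt0//.
  have := ler_normD a b; lra.
apply: (le_trans (h _)); lra.
Qed.

Lemma pgap_homogeneous c a b : pgap (c * a) (c * b) = `|c| `^ p * pgap a b.
Proof.
by rewrite /pgap -mulrDr -mulrA !normrM !powRM// -?mulrDr; ring.
Qed.

Lemma pgapC a b : pgap a b = pgap b a.
Proof. by rewrite /pgap [X in X / 2 - _]addrC [a + b]addrC. Qed.

Lemma pgap1_gt0 t : -1 <= t -> t < 1 -> 0 < pgap 1 t.
Proof.
move=> t1 t2; rewrite /pgap subr_gt0 normr1.
have [t0|t0] := leP 0 t.
  have h := @powR_strictly_convex 2^-1 1 t _ ler01 t0 _.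
  have -> : `|(1 + t) / 2| = 2^-1 * 1 + (1 - 2^-1) * t.
    by rewrite ger0_norm; lra.
  rewrite (ger0_norm t0); apply: (lt_le_trans (h _ _)).
  - by lra.
  - by rewrite gt_eqF.
  - by lra.
have : `|(1 + t) / 2| `^ p <= 2^-1 `^ p.
  by apply: le_powRp => //; rewrite ger0_norm; lra.
have : (2^-1 : R) `^ p < 2^-1 * 1 `^ p + (1 - 2^-1) * 0 `^ p.
  have := @powR_strictly_convex 2^-1 1 0 _ ler01 (lexx _) _.
  rewrite mulr0 addr0 mulr1; apply; first lra.
  by rewrite oner_eq0.
rewrite powR0// powR1; have := powR_ge0 `|t| p; lra.
Qed.

(** By symmetry and homogeneity the case a = 1, b = t with -1 <= t <= 1
    suffices. For t near 1 the left side is below eta; elsewhere the gap is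
    continuous and positive, so it is bounded below. *)
Lemma uniform_convexity eta : 0 < eta -> exists2 C, 0 <= C & forall a b,
  `|a - b| `^ p <= eta * (`|a| `^ p + `|b| `^ p) + C * pgap a b.
Proof.
move=> eta0.
(* Reduction to a = 1 and |b| <= 1. *)
suff [C C0 HC] : exists2 C, 0 <= C & forall t, -1 <= t <= 1 ->
    `|1 - t| `^ p <= eta * (1 + `|t| `^ p) + C * pgap 1 t.
  exists C => //.
  have main a b : `|b| <= `|a| ->
      `|a - b| `^ p <= eta * (`|a| `^ p + `|b| `^ p) + C * pgap a b.
    have [->|a0] := eqVneq a 0.
      rewrite normr0 normr_le0 => /eqP ->; rewrite subr0 normr0 powR0//.
      by rewrite addr0 mulr0 add0r mulr_ge0// pgap_ge0.
    move=> ba; pose t := b / a.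
    have bE : b = a * t by rewrite mulrC divfK.
    have t1 : `|t| <= 1 by rewrite normrM normfV ler_pdivrMr ?normr_gt0// mul1r.
    rewrite bE; clearbody t.
    have e : a - a * t = a * (1 - t) by ring.
    rewrite e -{2 4}[a]mulr1 pgap_homogeneous mulr1 !normrM !powRM//.
    have ap : 0 <= `|a| `^ p by exact: powR_ge0.
    by move: t1; rewrite ler_norml => /HC /(ler_wpM2l ap); lra.
  move=> a b; have [ba|ab] := leP `|b| `|a|; first exact: main.
  by rewrite distrC pgapC [X in eta * X]addrC; apply/main/ltW.
(* For t > c one has |1 - t|^p <= eta. *)
pose c := 1 - eta `^ p^-1.
have etap : 0 < eta `^ p^-1 by exact: powR_gt0.
have ct t : c < t -> t <= 1 -> `|1 - t| `^ p <= eta.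
  move=> h1 h2; rewrite -[leRHS]powRVpK ?(ltW eta0)//.
  by apply: le_powRp => //; rewrite ger0_norm; move: h1; rewrite /c; lra.
have easy C t : 0 <= C -> c < t -> t <= 1 ->
    `|1 - t| `^ p <= eta * (1 + `|t| `^ p) + C * pgap 1 t.
  move=> C0 h1 h2; apply: (le_trans (ct _ h1 h2)).
  have := powR_ge0 `|t| p; have := mulr_ge0 C0 (pgap_ge0 1 t); nra.
have [c1|c1] := ltP c (-1).
  exists 0 => // t /andP[h1 h2]; apply: easy => //; exact: lt_le_trans h1.
have cont : {within `[-1, c], continuous (pgap 1)}.
  apply: continuous_subspaceT => t; rewrite /pgap.
  apply: cvgB.
    apply: cvgMl; apply: cvgD; first exact: cvg_cst.
    exact: continuous_norm_powR.
  apply: (@continuous_comp _ _ _ (fun t : R => (1 + t) / 2) (fun x => `|x| `^ p)).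
    by apply: cvgMl; apply: cvgD; [exact: cvg_cst|exact: cvg_id].
  exact: continuous_norm_powR.
have [t0 t0c Ht0] := EVT_min c1 cont.
have m0 : 0 < pgap 1 t0.
  move: t0c; rewrite in_itv/= => /andP[h1 h2]; apply: pgap1_gt0 => //.
  by apply: (le_lt_trans h2); rewrite /c; lra.
exists (2 `^ p / pgap 1 t0); first by rewrite divr_ge0 ?powR_ge0// ltW.
move=> t /andP[h1 h2]; have [h|h] := ltP c t.
  by apply: easy => //; rewrite divr_ge0 ?powR_ge0// ltW.
apply: (@le_trans _ _ (2 `^ p)).
  by apply: le_powRp => //; rewrite ger0_norm; lra.
have hm : pgap 1 t0 <= pgap 1 t by apply: Ht0; rewrite in_itv/= h1.
have : 2 `^ p <= 2 `^ p / pgap 1 t0 * pgap 1 t.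
  rewrite -[leLHS](divfK (lt0r_neq0 m0)) ler_wpM2l//.
  by rewrite divr_ge0 ?powR_ge0// ltW.
have := mulr_ge0 (ltW eta0) (addr_ge0 ler01 (powR_ge0 `|t| p)); lra.
Qed.

Local Notation pmean := (pmean p).

Lemma pmean_ge0 a b : 0 <= pmean a b.
Proof. by rewrite pmean.unlock powR_ge0. Qed.

Lemma pmeanX a b : pmean a b `^ p = (a `^ p + b `^ p) / 2.
Proof. by rewrite pmean.unlock powRVpK// divr_ge0// addr_ge0// powR_ge0. Qed.

Lemma pmeanxx a : 0 <= a -> pmean a a = a.
Proof.
move=> a0; rewrite pmean.unlock (_ : _ / 2 = a `^ p) ?powRpK//; lra.
Qed.

Lemma pmean_eq0 a b : 0 <= a -> 0 <= b -> pmean a b = 0 -> a = 0 /\ b = 0.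
Proof.
move=> a0 b0 /(congr1 (fun x => x `^ p)); rewrite pmeanX powR0// => h.
have ha := powR_ge0 a p; have hb := powR_ge0 b p.
have /powR_eq0_eq0 -> : a `^ p = 0 by lra.
by have /powR_eq0_eq0 -> : b `^ p = 0 by lra.
Qed.

Lemma le_pmean a b c d : 0 <= a -> 0 <= b -> a <= c -> b <= d ->
  pmean a b <= pmean c d.
Proof.
move=> a0 b0 ac bd; have := le_powRp a0 ac; have := le_powRp b0 bd => h1 h2.
rewrite pmean.unlock; apply: ge0_ler_powR; rewrite ?invr_ge0 ?(ltW p0)// ?nnegrE.
- by rewrite divr_ge0// addr_ge0// powR_ge0.
- by rewrite divr_ge0// addr_ge0// powR_ge0.
- lra.
Qed.

Lemma powRp_inj x y : 0 <= x -> 0 <= y -> x `^ p = y `^ p -> x = y.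
Proof. by move=> x0 y0 /(powR_injective p0); apply; rewrite nnegrE. Qed.

Lemma powRp_le x y : 0 <= x -> 0 <= y -> x `^ p <= y `^ p -> x <= y.
Proof.
by move=> x0 y0 xy; rewrite leNgt; apply/negP => /(lt_powRp y0); rewrite ltNge xy.
Qed.

Lemma pmean_normalized a b : 0 <= a -> 0 <= b -> 0 < pmean a b ->
  ((a / pmean a b) `^ p + (b / pmean a b) `^ p) / 2 = 1.
Proof.
move=> a0 b0 t0; rewrite !powRM ?invr_ge0 ?(ltW t0)// -mulrDl mulrAC -pmeanX.
rewrite -powRM ?invr_ge0 ?(ltW t0)// divff ?powR1//.
by rewrite gt_eqF.
Qed.

(** The power mean is a multiple of the l^p norm on R^2, and normalizing both
    vectors reduces the triangle inequality to convexity. The strict part is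
    what distinguishes two minimizers: equality forces the vectors to be
    parallel. *)
Lemma pmeanD a b c d : 0 <= a -> 0 <= b -> 0 <= c -> 0 <= d ->
  pmean (a + c) (b + d) <= pmean a b + pmean c d /\
  (a * d != b * c -> pmean (a + c) (b + d) < pmean a b + pmean c d).
Proof.
move=> a0 b0 c0 d0.
have [t0|t0] := eqVneq (pmean a b) 0.
  by have [-> ->] := pmean_eq0 a0 b0 t0; rewrite !mul0r eqxx !add0r lerDr pmean_ge0.
have [e0|e0] := eqVneq (pmean c d) 0.
  by have [-> ->] := pmean_eq0 c0 d0 e0; rewrite !mulr0 eqxx !addr0 lerDl pmean_ge0.
have {}t0 : 0 < pmean a b by rewrite lt_neqAle eq_sym t0 pmean_ge0.
have {}e0 : 0 < pmean c d by rewrite lt_neqAle eq_sym e0 pmean_ge0.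
have nab := pmean_normalized a0 b0 t0; have ncd := pmean_normalized c0 d0 e0.
move: (pmean a b) (pmean c d) t0 e0 nab ncd => t e t0 e0 nab ncd.
have k0 : 0 < t + e by exact: addr_gt0.
(* With t and e the two means, the sum is (t + e) times a convex combination
   of the normalized vectors, with weight th. *)
pose th := t / (t + e).
have th01 : 0 < th < 1.
  by rewrite divr_gt0//= ltr_pdivrMr// mul1r ltrDl.
have kth : (t + e) * th = t by rewrite mulrC divfK// gt_eqF.
have kth' : (t + e) * (1 - th) = e by rewrite mulrBr kth mulr1 addrC addKr.
have tN0 : t != 0 by rewrite gt_eqF.
have eN0 : e != 0 by rewrite gt_eqF.
have split x y : x + y = (t + e) * (th * (x / t) + (1 - th) * (y / e)).
  rewrite mulrDr (mulrA (t + e) th) (mulrA (t + e) (1 - th)) kth kth'.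
  by rewrite ![_ * (_ / _)]mulrC !divfK.
have kp : 0 < (t + e) `^ p by exact: powR_gt0.
have th0 : 0 <= th by case/andP : th01 => /ltW.
have th1 : 0 <= 1 - th by case/andP : th01 => _ /ltW; rewrite subr_ge0.
have splitX x y : 0 <= x -> 0 <= y -> (x + y) `^ p =
    (t + e) `^ p * (th * (x / t) + (1 - th) * (y / e)) `^ p.
  move=> x0 y0; rewrite {1}(split x y) powRM ?(ltW k0)//.
  by rewrite addr_ge0// mulr_ge0// divr_ge0// ltW.
have conv x y : 0 <= x -> 0 <= y -> (th * (x / t) + (1 - th) * (y / e)) `^ p <=
    th * (x / t) `^ p + (1 - th) * (y / e) `^ p.
  by move=> x0 y0; apply: powR_convex => //; rewrite divr_ge0// ltW.
have sconv x y : 0 <= x -> 0 <= y -> x / t != y / e ->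
    (th * (x / t) + (1 - th) * (y / e)) `^ p <
    th * (x / t) `^ p + (1 - th) * (y / e) `^ p.
  by move=> x0 y0 xy; apply: powR_strictly_convex => //; rewrite divr_ge0// ltW.
have sumE : (t + e) `^ p = (t + e) `^ p *
    ((th * (a / t) `^ p + (1 - th) * (c / e) `^ p +
     (th * (b / t) `^ p + (1 - th) * (d / e) `^ p)) / 2).
  rewrite -[LHS]mulr1; congr (_ * _); transitivity
    (th * (((a / t) `^ p + (b / t) `^ p) / 2) +
     (1 - th) * (((c / e) `^ p + (d / e) `^ p) / 2)); last by field.
  by rewrite nab ncd; ring.
split.
  apply: powRp_le; rewrite ?pmean_ge0 ?(ltW k0)//.
  rewrite pmeanX (splitX a c)// (splitX b d)// [leRHS]sumE -mulrDr -mulrA ler_pM2l// ler_pM2r ?invr_gt0//.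
  by rewrite lerD// conv.
move=> abcd; rewrite ltNge; apply/negP => /(le_powRp (ltW k0)).
apply/negP; rewrite -ltNge pmeanX (splitX a c)// (splitX b d)// [ltRHS]sumE.
rewrite -mulrDr -mulrA ltr_pM2l//.
rewrite ltr_pM2r ?invr_gt0//.
have [ac|ac] := eqVneq (a / t) (c / e); last by apply: ltr_leD; [exact: sconv|exact: conv].
have [bd|bd] := eqVneq (b / t) (d / e); last by apply: ler_ltD; [exact: conv|exact: sconv].
move: abcd => /negP; case; apply/eqP.
have -> : a = (a / t) * t by rewrite divfK.
have -> : d = (d / e) * e by rewrite divfK.
have -> : b = (b / t) * t by rewrite divfK.
have -> : c = (c / e) * e by rewrite divfK.
by rewrite ac bd; ring.
Qed.

(** Reverse triangle inequality, applied below with (a, b) the values of two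
    functions at x and (c, d) their values at y: taking power means does not
    increase the average of the two energy densities. *)
Lemma pmeanB a b c d : 0 <= a -> 0 <= b -> 0 <= c -> 0 <= d ->
  let D := (`|a - c| `^ p + `|b - d| `^ p) / 2 in
  `|pmean a b - pmean c d| `^ p <= D /\
  (`|pmean a b - pmean c d| `^ p = D -> a * d = b * c).
Proof.
move=> + + + + D; rewrite {}/D.
wlog le : a b c d / pmean c d <= pmean a b.
  move=> wl a0 b0 c0 d0; have [h|h] := leP (pmean c d) (pmean a b); first exact: wl.
  rewrite distrC (distrC a) (distrC b).
  have [h1 h2] := wl c d a b (ltW h) c0 d0 a0 b0; split => // /h2; lra.
move=> a0 b0 c0 d0; rewrite ger0_norm ?subr_ge0// -pmeanX.
have ac : a <= c + `|a - c| by rewrite -lerBlDl ler_norm.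
have bd : b <= d + `|b - d| by rewrite -lerBlDl ler_norm.
have [h1 h2] := pmeanD c0 d0 (normr_ge0 (a - c)) (normr_ge0 (b - d)).
have h3 := le_pmean a0 b0 ac bd.
split; first by apply: le_powRp; [rewrite subr_ge0|rewrite lerBlDl (le_trans h3)].
move=> eX.
have e : pmean a b - pmean c d = pmean `|a - c| `|b - d|.
  by apply: powRp_inj; [rewrite subr_ge0|exact: pmean_ge0|exact: eX].
have h4 : pmean (c + `|a - c|) (d + `|b - d|) <= pmean a b by lra.
have e1 : c * `|b - d| = d * `|a - c|.
  by apply/eqP/negPn/negP => /h2; lra.
have spm x y x' y' : 0 <= x -> 0 <= y -> x <= x' -> y <= y' ->
    pmean x' y' <= pmean x y -> x' = x /\ y' = y.
  move=> x0 y0 xx yy /(le_powRp (pmean_ge0 _ _)); rewrite !pmeanX => h.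
  have l1 := le_powRp x0 xx; have l2 := le_powRp y0 yy.
  split; apply: powRp_inj => //.
  - exact: le_trans xx.
  - lra.
  - exact: le_trans yy.
  - lra.
have [e2 e3] := spm _ _ _ _ a0 b0 ac bd h4.
by rewrite -e2 -e3; lra.
Qed.

(** A smooth substitute for the absolute value, written as a power so that
    smoothness follows from that of powers of positive functions. *)
Definition sabs e a := (a ^+ 2 + e ^+ 2) `^ 2^-1.

Lemma sabs_ge0 e a : 0 <= sabs e a.
Proof. exact: powR_ge0. Qed.

Lemma sabsX e a : sabs e a ^+ 2 = a ^+ 2 + e ^+ 2.
Proof.
by rewrite /sabs powR12_sqrt ?addr_ge0 ?sqr_ge0// sqr_sqrtr// addr_ge0 ?sqr_ge0.
Qed.

Lemma sabs0 e : 0 <= e -> sabs e 0 = e.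
Proof.
move=> e0; rewrite /sabs expr0n/= add0r powR12_sqrt ?sqr_ge0// sqrtr_sqr.
by rewrite ger0_norm.
Qed.

Lemma ge_sabs_norm e a : `|a| <= sabs e a.
Proof.
rewrite -(@ler_pXn2r _ 2)// ?nnegrE ?sabs_ge0// sabsX real_normK ?num_real//.
by rewrite lerDl sqr_ge0.
Qed.

Lemma sabs_gee e a : 0 <= e -> e <= sabs e a.
Proof.
move=> e0; rewrite -(@ler_pXn2r _ 2)// ?nnegrE ?sabs_ge0// sabsX.
by rewrite lerDr sqr_ge0.
Qed.

Lemma le_sabs_norm e a : 0 <= e -> sabs e a <= `|a| + e.
Proof.
move=> e0; rewrite -(@ler_pXn2r _ 2)// ?nnegrE ?sabs_ge0 ?addr_ge0// sabsX.
rewrite sqrrD real_normK ?num_real//; have := mulr_ge0 (normr_ge0 a) e0; lra.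
Qed.

Lemma sabs_lip e a b : 0 < e -> `|sabs e a - sabs e b| <= `|a - b|.
Proof.
move=> e0; have ha := ge_sabs_norm e a; have hb := ge_sabs_norm e b.
have k0 : 0 < sabs e a + sabs e b.
  by apply: (lt_le_trans e0); rewrite (le_trans (sabs_gee a (ltW e0)))// lerDl sabs_ge0.
rewrite -(ler_pM2r k0) -{1}(gtr0_norm k0) -normrM -subr_sqr !sabsX.
have -> : a ^+ 2 + e ^+ 2 - (b ^+ 2 + e ^+ 2) = (a - b) * (a + b) by ring.
by rewrite normrM ler_wpM2l// (le_trans (ler_normD _ _))// lerD.
Qed.

(** Subtracting e makes the value at (0, 0) vanish, so that combining two test
    functions keeps the support inside the domain. *)
Definition spmean e a b := pmean (sabs e a) (sabs e b) - e.

Lemma spmean_ge0 e a b : 0 <= e -> 0 <= spmean e a b.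
Proof.
move=> e0; rewrite subr_ge0 -[leLHS]pmeanxx//.
by apply: le_pmean => //; exact: sabs_gee.
Qed.

Lemma spmean0 e : 0 <= e -> spmean e 0 0 = 0.
Proof. by move=> e0; rewrite /spmean sabs0// pmeanxx// subrr. Qed.

(** Smoothing the modulus is 1-Lipschitz, so the power mean of smoothed moduli
    still satisfies the reverse triangle inequality. *)
Lemma spmean_lip e a b c d : 0 < e ->
  `|spmean e a b - spmean e c d| `^ p <= (`|a - c| `^ p + `|b - d| `^ p) / 2.
Proof.
move=> e0; rewrite /spmean opprB addrA subrK.
have [h _] := pmeanB (sabs_ge0 e a) (sabs_ge0 e b) (sabs_ge0 e c) (sabs_ge0 e d).
apply: (le_trans h); rewrite ler_pM2r ?invr_gt0// lerD//.
  by apply: le_powRp => //; exact: sabs_lip.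
by apply: le_powRp => //; exact: sabs_lip.
Qed.

Lemma spmean_approx e a b : 0 <= e ->
  `|spmean e a b - pmean `|a| `|b| | <= e.
Proof.
move=> e0; have h1 : pmean `|a| `|b| <= pmean (sabs e a) (sabs e b).
  by apply: le_pmean => //; exact: ge_sabs_norm.
have h2 : pmean (sabs e a) (sabs e b) <= pmean `|a| `|b| + e.
  rewrite -[X in _ <= _ + X]pmeanxx//.
  have [+ _] := pmeanD (normr_ge0 a) (normr_ge0 b) e0 e0.
  by apply: le_trans; apply: le_pmean; rewrite ?sabs_ge0 ?le_sabs_norm.
rewrite /spmean ler_norml; lra.
Qed.

End power_inequalities.

(** * The p-th power of the L^p norm *)

Lemma nneseries_geometric (R : realType) (c q : R) : 0 <= c -> 0 <= q -> q < 1 ->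
  (\sum_(j <oo) (c * q ^+ j)%:E = (c / (1 - q))%:E)%E.
Proof.
move=> c0 q0 q1.
have /cvg_lim : (\sum_(0 <= n < k) (c * q ^+ n)%:E)%E @[k --> \oo] --> (c / (1 - q))%:E.
  under eq_fun do rewrite sumEFin.
  apply: cvg_EFin; first exact: nearW.
  by apply: (@cvg_geometric_series R c q); rewrite ger0_norm.
by move=> ->.
Qed.

(** The p-th power of the L^p norm. With powers instead of norms, the triangle
    inequality holds up to a constant, which is all that the argument uses. *)
HB.lock Definition pint d (T : measurableType d) (R : realType)
    (nu : {measure set T -> \bar R}) (p : R) (f : T -> R) : \bar R :=
  (\int[nu]_x ((`|f x| `^ p)%R)%:E)%E.

Section pint.
Context d (T : measurableType d) (R : realType).
Variable nu : {measure set T -> \bar R}.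
Local Open Scope ereal_scope.

Lemma measurable_limn_einf (h : nat -> T -> \bar R) :
  (forall n, measurable_fun setT (h n)) ->
  measurable_fun setT (fun x => limn_einf (h ^~ x)).
Proof.
move=> mh; apply: (@measurableT_comp _ _ _ _ _ _ (fun x : \bar R => - x)).
  exact: oppe_measurable.
apply: measurable_fun_limn_esup => n.
by apply: (@measurableT_comp _ _ _ _ _ _ (fun x : \bar R => - x)) => //;
  exact: oppe_measurable.
Qed.

Lemma fatou_le (h : nat -> T -> \bar R) (g : T -> \bar R) (a : \bar R) n0 :
  (forall n, measurable_fun setT (h n)) -> measurable_fun setT g ->
  (forall n x, 0 <= h n x) -> (forall x, 0 <= g x) ->
  {ae nu, forall x, h n x @[n --> \oo] --> g x} ->
  (forall n, (n0 <= n)%N -> \int[nu]_x h n x <= a) ->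
  \int[nu]_x g x <= a.
Proof.
move=> mh mg h0 g0 hg ha.
rewrite (@ge0_ae_eq_integral _ _ _ nu setT g (fun x => limn_einf (h ^~ x)))//.
- apply: (le_trans (fatou nu measurableT mh (fun n x _ => h0 n x))).
  rewrite limn_einf_lim; apply: lime_le; first exact: is_cvg_einfs.
  near=> n; apply: (@le_trans _ _ (\int[nu]_x h n x)).
    by apply: ereal_inf_lbound; exists n => //=.
  by apply: ha; near: n; exact: nbhs_infty_ge.
- exact: measurable_limn_einf.
- move=> x _; rewrite limn_einf_lim; apply: lime_ge; first exact: is_cvg_einfs.
  by apply: nearW => n; apply: le_ereal_inf_tmp => _ [m _ <-].
- by apply: filterS hg => x hgx _; have [-> _] := cvg_limn_einf_sup hgx.
Unshelve. all: by end_near. Qed.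

Variable p : R.
Hypothesis p1 : (1 < p)%R.
Let p0 : (0 < p)%R. Proof. exact: lt_trans ltr01 p1. Qed.
Implicit Types f g : T -> R.
Local Notation pint := (pint nu p).

Lemma measurable_norm_powR f : measurable_fun setT f ->
  measurable_fun setT (fun x => `|f x| `^ p)%R.
Proof.
move=> mf; apply: (@measurableT_comp _ _ _ _ _ _ (fun x : R => x `^ p)%R).
  exact: measurable_powR.
exact: measurableT_comp.
Qed.

Lemma measurable_pint f : measurable_fun setT f ->
  measurable_fun setT (fun x => (`|f x| `^ p)%R%:E).
Proof. by move=> mf; apply/measurable_EFinP; exact: measurable_norm_powR. Qed.

Lemma pint_ge0 f : 0 <= pint f.
Proof. by rewrite pint.unlock; apply: integral_ge0 => x _; rewrite lee_fin powR_ge0. Qed.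

Lemma pint_ae_eq f g : measurable_fun setT f -> measurable_fun setT g ->
  {ae nu, forall x, f x = g x} -> pint f = pint g.
Proof.
move=> mf mg fg; rewrite pint.unlock.
apply: ge0_ae_eq_integral => //; try exact: measurable_pint.
by apply: (filterS _ fg) => x /= fgx _; rewrite fgx.
Qed.

Lemma pintZ c f : measurable_fun setT f ->
  pint (fun x => c * f x)%R = (`|c| `^ p)%:E * pint f.
Proof.
move=> mf; rewrite pint.unlock -ge0_integralZl_EFin ?powR_ge0//.
- by apply: eq_integral => x _; rewrite normrM powRM.
- exact: measurable_pint.
Qed.

Lemma pintBC f g : pint (fun x => f x - g x)%R = pint (fun x => g x - f x)%R.
Proof. by rewrite pint.unlock; apply: eq_integral => x _; rewrite distrC. Qed.

Lemma pint_lincomb a b f g : (0 <= a)%R -> (0 <= b)%R ->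
  measurable_fun setT f -> measurable_fun setT g ->
  \int[nu]_x ((a * `|f x| `^ p + b * `|g x| `^ p)%R)%:E =
  a%:E * pint f + b%:E * pint g.
Proof.
move=> a0 b0 mf mg; rewrite pint.unlock.
rewrite -!ge0_integralZl_EFin//; try exact: measurable_pint;
  try by move=> x _; rewrite lee_fin powR_ge0.
rewrite -ge0_integralD//.
- by move=> x _; rewrite mule_ge0 ?lee_fin ?powR_ge0.
- by apply: measurable_funeM; exact: measurable_pint.
- by move=> x _; rewrite mule_ge0 ?lee_fin ?powR_ge0.
- by apply: measurable_funeM; exact: measurable_pint.
Qed.

(** Integrated form of the pointwise inequality; it plays the role of the
    Minkowski inequality without taking roots. *)
Lemma pint_close eta : (0 < eta)%R -> exists2 C : R, (0 <= C)%R & forall f g,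
  measurable_fun setT f -> measurable_fun setT g ->
  pint g <= (1 + eta)%:E * pint f + C%:E * pint (fun x => f x - g x)%R.
Proof.
move=> eta0; have [C C0 HC] := normr_powR_le p1 eta0.
exists C => // f g mf mg.
have mfg : measurable_fun setT (fun x => f x - g x)%R by exact: measurable_funB.
rewrite -pint_lincomb//; last by rewrite addr_ge0// ltW.
rewrite pint.unlock; apply: ge0_le_integral => //.
- exact: measurable_pint.
- apply/measurable_EFinP; apply: measurable_funD; apply: measurable_funM => //;
    exact: measurable_norm_powR.
- by move=> x _; rewrite lee_fin.
Qed.

Lemma pint_continuous f (L eta : R) : measurable_fun setT f -> pint f = L%:E ->
  (0 < eta)%R -> exists2 d : R, (0 < d)%R & forall g, measurable_fun setT g ->
  pint (fun x => g x - f x)%R <= d%:E ->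
  (L - eta)%:E <= pint g /\ pint g <= (L + eta)%:E.
Proof.
move=> mf fL eta0.
have L0 : (0 <= L)%R by rewrite -lee_fin -fL pint_ge0.
have e10 : (0 < eta / 2 / (L + 1))%R by rewrite !divr_gt0// ltr_wpDl.
have e1L : (eta / 2 / (L + 1) * L <= eta / 2)%R.
  by rewrite mulrAC ler_pdivrMr ?ltr_wpDl//; apply: ler_wpM2l; [lra|rewrite lerDl].
have [C C0 HC] := pint_close e10.
have C1 : (0 < C + 1)%R by rewrite ltr_wpDl.
pose dl := (eta / 2 / (C + 1))%R.
have dl0 : (0 < dl)%R by rewrite !divr_gt0.
have Cd : (C * dl <= eta / 2)%R.
  by rewrite /dl mulrC mulrAC ler_pdivrMr//; apply: ler_wpM2l; [lra|rewrite lerDl].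
(* The upper bound compares g with f; the lower one exchanges their roles. *)
exists dl => // g mg gd; split; last first.
  have gd' : pint (fun x => f x - g x)%R <= dl%:E by rewrite pintBC.
  apply: (le_trans (HC f g mf mg)); rewrite fL.
  apply: (@le_trans _ _ ((1 + eta / 2 / (L + 1))%:E * L%:E + C%:E * dl%:E)).
    by rewrite leeD2l//; apply: lee_wpmul2l.
  by rewrite -!EFinM -EFinD lee_fin; lra.
have := HC g f mg mf; rewrite fL => h.
have {}h : L%:E <= (1 + eta / 2 / (L + 1))%:E * pint g + (eta / 2)%:E.
  apply: (le_trans h); rewrite leeD2l//.
  apply: (@le_trans _ _ (C%:E * dl%:E)); first by apply: lee_wpmul2l.
  by rewrite -EFinM lee_fin.
move: h; have := pint_ge0 g; case: (pint g) => [m|_ _|//]; last by rewrite leey.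
rewrite -EFinM -EFinD !lee_fin => m0 h.
have [mL|mL] := leP L m; first lra.
have : (eta / 2 / (L + 1) * m <= eta / 2 / (L + 1) * L)%R.
  by apply: ler_wpM2l; exact: ltW.
lra.
Qed.

Lemma pint_triangle : exists2 C : R, (0 < C)%R & forall f g,
  measurable_fun setT f -> measurable_fun setT g ->
  pint (fun x => f x - g x)%R <= C%:E * (pint f + pint g).
Proof.
have [C C0 HC] := pint_close ltr01.
exists (1 + 1 + C)%R; first by rewrite ltr_wpDr.
move=> f g mf mg; have mfg := measurable_funB mf mg.
apply: (le_trans (HC _ _ mf mfg)).
have -> : pint (fun x => f x - (f \- g) x)%R = pint g.
  by rewrite pint.unlock; apply: eq_integral => x _ /=; rewrite subKr.
rewrite ge0_muleDr ?pint_ge0//; apply: leeD.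
  by rewrite lee_wpmul2r ?pint_ge0// lee_fin lerDl.
by rewrite lee_wpmul2r ?pint_ge0// lee_fin lerDr.
Qed.

Lemma pint_fatou (h : nat -> T -> R) f (a : \bar R) n0 :
  (forall n, measurable_fun setT (h n)) -> measurable_fun setT f ->
  {ae nu, forall x, h n x @[n --> \oo] --> f x} ->
  (forall n, (n0 <= n)%N -> pint (h n) <= a) -> pint f <= a.
Proof.
rewrite pint.unlock => mh mf hf ha.
apply: (@fatou_le (fun n x => (`|h n x| `^ p)%R%:E) _ _ n0) => //.
- by move=> n; exact: measurable_pint.
- exact: measurable_pint.
apply: filterS hf => x hfx.
have hp : (`|h n x| `^ p)%R @[n --> \oo] --> (`|f x| `^ p)%R.
  exact: (@cvg_comp _ _ _ _ (fun y : R => `|y| `^ p)%R _ _ _ hfx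
    (@continuous_norm_powR _ _ p1 (f x))).
by apply/fine_cvgP; split; [exact: nearW|exact: hp].
Qed.

Lemma measurable_pgap f g : measurable_fun setT f -> measurable_fun setT g ->
  measurable_fun setT (fun x => pgap p (f x) (g x)).
Proof.
move=> mf mg; apply: measurable_funB.
  by apply: measurable_funM => //; apply: measurable_funD; exact: measurable_norm_powR.
apply: measurable_norm_powR; apply: measurable_funM => //; exact: measurable_funD.
Qed.

(** The integrated gap is exactly what the midpoint gains over the average;
    this is how smallness of the gap is obtained for nearly minimizing
    pairs. *)
Lemma pint_midpoint f g : measurable_fun setT f -> measurable_fun setT g ->
  \int[nu]_x (pgap p (f x) (g x))%:E + pint (fun x => (f x + g x) / 2)%R =
  2^-1%:E * (pint f + pint g).
Proof.
move=> mf mg; have mfg := measurable_funD mf mg.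
have mfg2 : measurable_fun setT (fun x => (f x + g x) / 2)%R.
  by apply: measurable_funM => //; exact: mfg.
rewrite ge0_muleDr ?pint_ge0// -pint_lincomb// pint.unlock -ge0_integralD//.
- by apply: eq_integral => x _; rewrite -EFinD; congr EFin; rewrite /pgap; lra.
- by move=> x _; rewrite lee_fin pgap_ge0.
- by apply/measurable_EFinP; exact: measurable_pgap.
- exact: measurable_pint.
Qed.

Lemma pint_uniform_convexity eta : (0 < eta)%R -> exists2 C : R, (0 <= C)%R &
  forall f g, measurable_fun setT f -> measurable_fun setT g ->
  pint (fun x => f x - g x)%R <= eta%:E * (pint f + pint g) +
    C%:E * \int[nu]_x (pgap p (f x) (g x))%:E.
Proof.
move=> eta0; have [C C0 HC] := uniform_convexity p1 eta0.
exists C => // f g mf mg.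
have mfg : measurable_fun setT (fun x => f x - g x)%R by exact: measurable_funB.
have mgap := measurable_pgap mf mg.
rewrite ge0_muleDr ?pint_ge0// -pint_lincomb ?(ltW eta0)//.
rewrite -[X in _ + X]ge0_integralZl_EFin//; first last.
- exact/measurable_EFinP.
- by move=> x _; rewrite lee_fin pgap_ge0.
have ml : measurable_fun setT (fun x => eta * `|f x| `^ p + eta * `|g x| `^ p)%R.
  apply: measurable_funD; apply: measurable_funM => //;
    exact: measurable_norm_powR.
rewrite -ge0_integralD//; last first.
- by apply: measurable_funeM; exact/measurable_EFinP.
- by move=> x _; rewrite mule_ge0 ?lee_fin// pgap_ge0.
- exact/measurable_EFinP.
- by move=> x _; rewrite lee_fin addr_ge0// mulr_ge0 ?powR_ge0// ltW.
rewrite pint.unlock; apply: ge0_le_integral => //.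
- exact: measurable_pint.
- by apply: emeasurable_funD; [exact/measurable_EFinP|
    apply: measurable_funeM; exact/measurable_EFinP].
- by move=> x _; rewrite -EFinM -EFinD lee_fin -mulrDr.
Qed.

(** The sum over n of the p-th powers has finite integral, hence is finite
    almost everywhere. *)
Lemma pint_bounded_ae (h : nat -> T -> R) :
  (forall n, measurable_fun setT (h n)) ->
  (forall n, pint (h n) <= (2^-1 ^+ n)%:E) ->
  {ae nu, forall x, exists M, forall n, (`|h n x| <= M)%R}.
Proof.
rewrite pint.unlock => mh hle.
pose S x := \sum_(n <oo) (`|h n x| `^ p)%R%:E.
have S0 x : 0 <= S x by apply: nneseries_ge0 => n _ _; rewrite lee_fin powR_ge0.
have mS : measurable_fun setT S.
  apply: ge0_emeasurable_sum; first by move=> n x _ _; rewrite lee_fin powR_ge0.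
  by move=> n _; exact: measurable_pint.
have iS : nu.-integrable setT S.
  apply/integrableP; split => //.
  under eq_integral do rewrite gee0_abs//.
  rewrite integral_nneseries//; last by move=> n; exact: measurable_pint.
  apply: (@le_lt_trans _ _ (\sum_(n <oo) ((2^-1 : R) ^+ n)%:E)).
    apply: lee_nneseries => n _ //.
    by move=> _; apply: integral_ge0 => x _; rewrite lee_fin powR_ge0.
  under eq_eseriesr do rewrite -[X in X%:E]mul1r.
  by rewrite nneseries_geometric ?invr_ge0 ?invf_lt1 ?ltr1n// ltry.
have := integrable_ae measurableT iS.
apply: filterS => x /(_ I) Sx; exists (fine (S x) `^ p^-1)%R => n.
rewrite -[leLHS](powRpK p1)//; apply: ge0_ler_powR.
- by rewrite invr_ge0 ltW.
- by rewrite nnegrE powR_ge0.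
- by rewrite nnegrE fine_ge0.
rewrite -lee_fin fineK//.
have := @nneseries_lim_ge R (fun n => (`|h n x| `^ p)%R%:E) xpredT 0%N n.+1.
move=> H; apply: le_trans (H _); last first.
  by move=> ? ? ?; rewrite lee_fin powR_ge0.
rewrite big_nat_recr//= leeDr// sume_ge0// => i _; by rewrite lee_fin powR_ge0.
Qed.

(** A rate of decay in L^p that forces almost everywhere convergence like
    2^-n: after multiplication by 2^n the integrals still have a finite
    sum. *)
Definition fast n : R := ((2^-1 ^+ n) `^ p * 2^-1 ^+ n)%R.

Lemma fast_gt0 n : (0 < fast n)%R.
Proof. by rewrite mulr_gt0 ?powR_gt0// exprn_gt0 ?invr_gt0. Qed.

Lemma pint_fast_bounded (h : nat -> T -> R) :
  (forall n, measurable_fun setT (h n)) ->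
  (forall n, pint (h n) <= (fast n)%:E) ->
  {ae nu, forall x, exists2 M, (0 <= M)%R & forall n, (`|h n x| <= M * 2^-1 ^+ n)%R}.
Proof.
move=> mh hle.
have h2 n : (0 < 2 ^+ n :> R)%R by exact: exprn_gt0.
have := @pint_bounded_ae (fun n x => 2 ^+ n * h n x)%R.
have mh' n : measurable_fun setT (fun x => 2 ^+ n * h n x)%R.
  by apply: measurable_funM => //; exact: mh.
move=> /(_ mh') H; have : forall n, pint (fun x => 2 ^+ n * h n x)%R <= (2^-1 ^+ n)%:E.
  move=> n; rewrite pintZ//.
  apply: (@le_trans _ _ ((`|2 ^+ n| `^ p)%:E * (fast n)%:E)).
    by apply: lee_wpmul2l; [rewrite lee_fin powR_ge0|exact: hle].
  rewrite -EFinM lee_fin /fast mulrA -powRM// ?exprn_ge0 ?invr_ge0//.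
  by rewrite ger0_norm ?(ltW (h2 n))// -exprMn divff ?expr1n ?powR1 ?mul1r// pnatr_eq0.
move=> /H; apply: filterS => x [M HM]; exists M => [|n].
  by apply: le_trans (HM 0%N).
have := HM n; rewrite normrM ger0_norm ?(ltW (h2 n))//.
by rewrite exprVn ler_pdivlMr// mulrC.
Qed.

Lemma cvg_fast (M : R) : (M * 2^-1 ^+ n)%R @[n --> \oo] --> 0%R.
Proof. by apply: cvg_geometric; rewrite ger0_norm ?invr_ge0// invf_lt1// ltr1n. Qed.

Lemma pint_fast_cvg (h : nat -> T -> R) f :
  (forall n, measurable_fun setT (h n)) -> measurable_fun setT f ->
  (forall n, pint (fun x => h n x - f x)%R <= (fast n)%:E) ->
  {ae nu, forall x, h n x @[n --> \oo] --> f x}.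
Proof.
move=> mh mf hle.
have := @pint_fast_bounded (fun n x => h n x - f x)%R.
move=> /(_ (fun n => measurable_funB (mh n) mf) hle).
apply: filterS => x [M M0 HM]; apply/subr_cvg0.
apply: norm_cvg0; apply: (@squeeze_cvgr _ _ _ _ (cst 0%R) (fun n => M * 2^-1 ^+ n)%R).
- by apply: nearW => n; rewrite normr_ge0 /= HM.
- exact: cvg_cst.
- exact: cvg_fast.
Qed.

(** The increments are bounded by a geometric series almost everywhere.
    Multiplying by the indicator of the good set makes the limit exist
    everywhere and hence measurable. *)
Lemma pint_fast_limit (h : nat -> T -> R) :
  (forall n, measurable_fun setT (h n)) ->
  (forall n, pint (fun x => h n.+1 x - h n x)%R <= (fast n)%:E) ->
  exists2 f : T -> R, measurable_fun setT f & {ae nu, forall x, h n x @[n --> \oo] --> f x}.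
Proof.
move=> mh hle.
have := @pint_fast_bounded (fun n x => h n.+1 x - h n x)%R.
move=> /(_ (fun n => measurable_funB (mh n.+1) (mh n)) hle).
move=> hb; have [A [mA A0 hA]] : {ae nu, forall x, cvgn (fun n => h n x : R^o)}.
  apply: filterS hb => x [M M0 HM].
  have -> : h ^~ x = (fun n => h 0%N x + series (telescope (h ^~ x)) n)%R.
    by apply/funext => n; rewrite -eq_sum_telescope.
  apply: is_cvgD; first exact: is_cvg_cst.
  apply: normed_cvg; apply: (@series_le_cvg _ _ (geometric M 2^-1)%R).
  - by move=> n; exact: normr_ge0.
  - by move=> n; rewrite /= mulr_ge0// exprn_ge0// invr_ge0.
  - by move=> n; exact: HM.
  - by apply: is_cvg_geometric_series; rewrite ger0_norm ?invr_ge0// invf_lt1// ltr1n.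
(* A is a measurable set containing the points of divergence. *)
pose h' n x := (h n x * \1_(~` A) x)%R.
have mh' n : measurable_fun setT (h' n).
  by apply: measurable_funM => //; apply: measurable_indic; exact: measurableC.
have ch' x : cvgn (h' ^~ x).
  have [xA|xA] := boolP (x \in ~` A).
    rewrite /h'; under eq_fun do rewrite indicE xA mulr1.
    by apply: contrapT => hx; move: xA; rewrite inE => /(_ (hA _ hx)).
  rewrite /h'; under eq_fun do rewrite indicE (negbTE xA) mulr0.
  exact: is_cvg_cst.
exists (fun x => limn (h' ^~ x)).
  by apply: (measurable_fun_cvg mh') => x _; exact: ch'.
exists A; split => // x /= hx; apply: contrapT => xA; apply: hx.
have := ch' x; rewrite /h'.
have xA' : x \in ~` A by rewrite inE.
by under eq_fun do rewrite indicE xA' mulr1.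
Qed.

End pint.

(** * Smooth functions *)

Section directional.
Context {R : realType} {N : nat}.
Implicit Types (f g : 'rV[R]_N -> R) (x v : 'rV[R]_N).

Lemma slice_quotient f x v t0 (g : R -> R) : g = (fun t => f (t *: v + x)) ->
  (fun h : R => h^-1 *: ((g \o shift t0) (h *: (1 : R)) - g t0)) =
  (fun h : R => h^-1 *: ((f \o shift (t0 *: v + x)) (h *: v) - f (t0 *: v + x))).
Proof.
move=> ->; apply/funext => h /=; rewrite [h *: 1]mulr1.
by rewrite scalerDl addrA.
Qed.

(** A directional derivative is the derivative of the restriction to a line;
    this brings the mean value theorem and the chain rule in one variable to
    bear. *)
Lemma is_derive_sliceP f x v t0 (d : R) :
  is_derive t0 (1 : R) (fun t => f (t *: v + x)) d <-> is_derive (t0 *: v + x) v f d.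
Proof.
set g := (fun t : R => f (t *: v + x)).
have E := @slice_quotient f x v t0 g erefl; clearbody g.
split=> -[]; rewrite /derivable /derive ?E => h1 h2;
  by split; rewrite /derivable /derive ?E.
Qed.

Lemma is_derive_slice0P f x v (d : R) :
  is_derive (0 : R) (1 : R) (fun t => f (t *: v + x)) d <-> is_derive x v f d.
Proof. by have := is_derive_sliceP f x v 0 d; rewrite scale0r add0r. Qed.

Lemma is_derive_powR f x v a : 0 < f x -> derivable f x v ->
  is_derive x v (fun y => f y `^ a) (a * f x `^ (a - 1) * 'D_v f x).
Proof.
move=> fx0 /derivableP/is_derive_slice0P df; apply/is_derive_slice0P.
have e : f (0 *: v + x) = f x by rewrite scale0r add0r.
have fx0' : f x \in `]0, +oo[ by rewrite in_itv/= fx0.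
have dp : is_derive (f (0 *: v + x)) (1 : R) (fun y : R => y `^ a)
    (a * f x `^ (a - 1)).
  rewrite e; split; first exact: derivable_powR.
  by rewrite -derive1E powR_derive1.
exact: (@is_derive1_comp _ _ _ _ _ _ dp df).
Qed.

Lemma is_CkS k f : is_Ck k.+1 f <-> forall i : 'I_N,
  (forall x, derivable f x (delta_mx ord0 i)) /\
  is_Ck k (fun x => 'D_(delta_mx ord0 i) f x).
Proof. by []. Qed.

Definition smooth f := forall k, is_Ck k f.

Lemma smoothP f : smooth f <-> continuous f /\
  forall i : 'I_N, (forall x, derivable f x (delta_mx ord0 i)) /\
    smooth (fun x => 'D_(delta_mx ord0 i) f x).
Proof.
split=> [sf|[cf df] [|k] i]; last first.
- by have [d sd] := df i; split; [exact: d|exact: sd].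
- exact: cf.
- split; first exact: (sf 0%N).
  by move=> i; split => [|k]; [have [] := sf 1%N i|have [] := sf k.+1 i].
Qed.

Lemma is_Ck_cst k (c : R) : is_Ck k (fun _ : 'rV[R]_N => c).
Proof.
elim: k c => [|k IH] c; first by move=> x; exact: cst_continuous.
apply/is_CkS => i; split=> [x|]; first exact: derivable_cst.
rewrite [X in is_Ck _ X](_ : _ = fun=> 0); first exact: IH.
by apply/funext => x; exact: derive_cst.
Qed.

Lemma is_CkD k f g : is_Ck k f -> is_Ck k g -> is_Ck k (fun x => f x + g x).
Proof.
elim: k f g => [|k IH] f g; first by move=> /= cf cg x; exact: (continuousD (cf x) (cg x)).
move=> hf hg; apply/is_CkS => i.
have [df cf] := hf i; have [dg cg] := hg i.
split=> [x|]; first exact: derivableD.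
rewrite [X in is_Ck _ X](_ : _ =
    fun x => 'D_(delta_mx ord0 i) f x + 'D_(delta_mx ord0 i) g x).
  exact: IH.
by apply/funext => x; rewrite -deriveD.
Qed.

Lemma smoothD f g : smooth f -> smooth g -> smooth (fun x => f x + g x).
Proof. by move=> sf sg k; exact: is_CkD. Qed.

(** The predicate for order k does not contain those of lower orders, whereas
    the product rule needs them; so induction is done on all orders up to k at
    once. *)
Definition smooth_upto k f := forall j, (j <= k)%N -> is_Ck j f.

Lemma smooth_uptoS k f : smooth_upto k.+1 f <-> continuous f /\
  forall i : 'I_N, (forall x, derivable f x (delta_mx ord0 i)) /\
    smooth_upto k (fun x => 'D_(delta_mx ord0 i) f x).
Proof.
split=> [sf|[cf df] [|j] jk]; last first.
- by move=> i; have [d sd] := df i; split => //; exact: sd.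
- exact: cf.
- split; first exact: (sf 0%N).
  by move=> i; split => [|j jk]; [have [] := sf 1%N isT i|have [] := sf j.+1 jk i].
Qed.

Lemma smooth_uptoW k f : smooth_upto k.+1 f -> smooth_upto k f.
Proof. by move=> sf j jk; apply: sf; rewrite (leq_trans jk). Qed.

Lemma smooth_uptoM k f g : smooth_upto k f -> smooth_upto k g ->
  smooth_upto k (fun x => f x * g x).
Proof.
have cM f' g' : continuous f' -> continuous g' ->
    continuous (fun x : 'rV[R]_N => f' x * g' x : R).
  by move=> cf cg x; exact: (continuousM (cf x) (cg x)).
elim: k f g => [|k IH] f g sf sg.
  by move=> [|//] _; apply: cM; [exact: (sf 0%N)|exact: (sg 0%N)].
have [cf hf] := (smooth_uptoS k f).1 sf; have [cg hg] := (smooth_uptoS k g).1 sg.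
apply/smooth_uptoS; split=> [|i]; first exact: cM.
have [df sdf] := hf i; have [dg sdg] := hg i.
split=> [x|]; first exact: derivableM.
rewrite [X in smooth_upto _ X](_ : _ = fun x => f x * 'D_(delta_mx ord0 i) g x +
    g x * 'D_(delta_mx ord0 i) f x).
  move=> j jk; apply: is_CkD; apply: IH => //; exact: smooth_uptoW.
by apply/funext => x; rewrite -[RHS]deriveM.
Qed.

Lemma smoothM f g : smooth f -> smooth g -> smooth (fun x => f x * g x).
Proof. by move=> sf sg k; apply: (@smooth_uptoM k) => //. Qed.

Lemma smooth_uptoT k f : smooth f -> smooth_upto k f.
Proof. by move=> sf j _; exact: sf. Qed.

(** The gradient of f^a is a f^(a-1) times that of f, again a power times a
    smooth function: induction on the order, for all exponents at once. *)
Lemma smooth_powR f a : smooth f -> (forall x, 0 < f x) ->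
  smooth (fun x => f x `^ a).
Proof.
move=> sf f0 k; suff : smooth_upto k (fun x => f x `^ a) by apply.
elim: k a => [|k IH] a.
  move=> [|//] _ x; apply: (@continuous_comp _ _ _ f (fun y : R => y `^ a)).
    exact: (sf 0%N).
  apply: differentiable_continuous; apply/derivable1_diffP.
  by apply: derivable_powR; rewrite in_itv/= andbT.
have [cf hf] := (smoothP f).1 sf.
apply/smooth_uptoS; split=> [x|i].
  apply: (@continuous_comp _ _ _ f (fun y : R => y `^ a)); first exact: cf.
  apply: differentiable_continuous; apply/derivable1_diffP.
  by apply: derivable_powR; rewrite in_itv/= andbT.
have [df sdf] := hf i.
have dp x := is_derive_powR a (f0 x) (df x).
split=> [x|]; first by have [] := dp x.
rewrite [X in smooth_upto _ X](_ : _ =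
    fun x => (a * f x `^ (a - 1)) * 'D_(delta_mx ord0 i) f x).
  apply: smooth_uptoM; last exact: smooth_uptoT.
  by apply: smooth_uptoM; [move=> j _; exact: is_Ck_cst|exact: IH].
by apply/funext => x; have [] := dp x.
Qed.

End directional.

(** * The sup norm and Borel sets of R^N *)

Section sup_norm.
Context {R : realType} {N : nat}.
Implicit Types x y : 'rV[R]_N.

Lemma normr_coord x (i : 'I_N) : `|x ord0 i| <= `|x|.
Proof.
rewrite [leRHS]/Num.norm/= mx_normrE.
by apply: (le_trans _ (le_bigmax _ _ (ord0, i))).
Qed.

Lemma normr_le x r : 0 <= r -> (forall i, `|x ord0 i| <= r) -> `|x| <= r.
Proof.
move=> r0 h; rewrite /Num.norm/= mx_normrE; apply/bigmax_leP; split => // -[a b] _ /=.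
by rewrite (ord1 a).
Qed.

Lemma normr_lt x r : 0 < r -> (forall i, `|x ord0 i| < r) -> `|x| < r.
Proof.
move=> r0 h; rewrite /Num.norm/= mx_normrE; apply/bigmax_ltP; split => // -[a b] _ /=.
by rewrite (ord1 a).
Qed.

Lemma ballE x e : ball x e = [set y | `|x - y| < e].
Proof. by rewrite mx_norm_ball. Qed.

Lemma measurable_coord_set (P : 'I_N -> R -> Prop) :
  (forall i, measurable (P i : set R)) ->
  measurable [set x : 'rV[R]_N | forall i, P i (x ord0 i)].
Proof.
move=> mP.
rewrite [X in measurable X](_ : _ = \bigcap_(j in [set: 'I_N])
    ((fun x : 'rV[R]_N => x ord0 j) @^-1` P j)).
  apply: fin_bigcap_measurable => // j _.
  by rewrite -[X in measurable X]setTI; exact: measurable_coord.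
by apply/seteqP; split => [x Bx j _|x Bx j]; [exact: Bx|exact: (Bx j)].
Qed.

(** An open set is the union of the countably many rational boxes that it
    contains. This is not immediate because the sigma-algebra is the one
    generated by the coordinates. *)
Lemma open_measurable_rV (A : set 'rV[R]_N) : open A -> measurable A.
Proof.
move=> oA.
pose q2R (q : 'rV[rat]_N) : 'rV[R]_N := map_mx ratr q.
pose B (q : 'rV[rat]_N) (n : nat) := [set y : 'rV[R]_N | forall i, ball (q2R q ord0 i) n.+1%:R^-1 (y ord0 i)].
have mB q n : measurable (B q n).
  apply: (@measurable_coord_set (fun i => ball (q2R q ord0 i) n.+1%:R^-1)) => i.
  exact: measurable_ball.
have -> : A = \bigcup_(qn in [set qn : 'rV[rat]_N * nat | B qn.1 qn.2 `<=` A]) B qn.1 qn.2.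
  apply/seteqP; split => [x Ax|x [qn /= h /h]//].
  have /nbhs_ballP[e /= e0 he] : nbhs x A by exact: open_nbhs_nbhs.
  (* A box of half-side below e / 2 that contains x lies in the ball of radius
     e around x. *)
  have [n hn] : exists n, n.+1%:R^-1 < e / 2.
    by have [n] := ltr_add_invr (divr_gt0 e0 (ltr0Sn R 1)); rewrite add0r; exists n.
  have q i : {q : rat | ball (ratr q : R) n.+1%:R^-1 (x ord0 i)}.
    apply: cid.
    have /rat_in_itvoo[q] : x ord0 i < x ord0 i + n.+1%:R^-1 by rewrite ltrDl.
    rewrite in_itv/= => /andP[h1 h2]; exists q.
    by rewrite /ball/= ger0_norm ?subr_ge0 ?(ltW h1)// ltrBlDl.
  pose Q := \row_i (sval (q i)).
  have qE i : q2R Q ord0 i = ratr (sval (q i)) by rewrite !mxE.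
  exists (Q, n) => [y By|i]; last by rewrite qE; exact: (svalP (q i)).
  apply: he; rewrite ballE /=; apply: normr_lt => // i.
  have := svalP (q i); have := By i; rewrite qE !mxE /ball/= => h1 h2.
  have := ler_distD (ratr (sval (q i))) (x ord0 i) (y ord0 i).
  rewrite [`|x ord0 i - ratr _|]distrC; move: h1 h2; move: (ratr _) => z h1 h2 h3.
  move: hn h1 h2; move: (n.+1%:R^-1 : R) => dn; lra.
rewrite bigcup_mkcond.
have -> : \bigcup_qn (if qn \in [set qn | B qn.1 qn.2 `<=` A] then B qn.1 qn.2 else set0)
  = \bigcup_k (if (unpickle k : option ('rV[rat]_N * nat)) is Some qn then
       if qn \in [set qn | B qn.1 qn.2 `<=` A] then B qn.1 qn.2 else set0
     else set0).
  apply/seteqP; split => [x [qn _ h]|x [k _]].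
    by exists (pickle qn) => //; rewrite pickleK.
  by case: (unpickle k) => [qn|//] h; exists qn.
apply: bigcupT_measurable => k; case: (unpickle k) => [qn|]; last exact: measurable0.
by case: ifP => _; [exact: mB|exact: measurable0].
Qed.

Lemma continuous_measurable_rV (f : 'rV[R]_N -> R) :
  continuous f -> measurable_fun setT f.
Proof.
move=> /continuousP cf.
apply: (measurability _ (RGenOpens.measurableE R)).
move=> _ [_ [a [b ->] <-]]; rewrite setTI; apply: open_measurable_rV.
exact/cf/interval_open.
Qed.

End sup_norm.

(** * Test functions *)

Section test_functions.
Context {R : realType} {N : nat}.
Implicit Types (f u v : 'rV[R]_N -> R) (x y : 'rV[R]_N).
Implicit Types Omega : set 'rV[R]_N.

Lemma compact_support_bounded f (K : set 'rV[R]_N) : continuous f -> compact K ->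
  (forall x, ~ K x -> f x = 0) -> exists2 M, 0 <= M & forall x, `|f x| <= M.
Proof.
move=> cf cK fK.
have /compact_bounded [M [_ HM]] : compact (f @` K).
  by apply: continuous_compact => //; exact: continuous_subspaceT.
exists (`|M| + 1) => [|x]; first by rewrite addr_ge0.
have [Kx|nKx] := pselect (K x); last by rewrite fK// normr0 addr_ge0.
apply: (HM (`|M| + 1)); last by exists x.
by rewrite (le_lt_trans (ler_norm M))// ltrDl.
Qed.

Lemma slice_lip f (v x : 'rV[R]_N) M : 0 <= M -> (forall x, derivable f x v) ->
  (forall x, `|'D_v f x| <= M) ->
  forall h : R, `|f (h *: v + x) - f x| <= M * `|h|.
Proof.
move=> M0 df dM.
have dg (t : R) : is_derive t 1 (fun t => f (t *: v + x)) ('D_v f (t *: v + x)).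
  by apply/is_derive_sliceP; exact: derivableP.
have cg (a b : R) : {within `[a, b], continuous (fun t : R => f (t *: v + x))}.
  by apply: derivable_within_continuous => t _; have [] := dg t.
move=> h; have [h0|h0|->] := ltgtP h 0; last first.
- by rewrite scale0r add0r subrr normr0 mulr0.
- have [c _ ] := MVT h0 (fun t _ => dg t) (cg _ _).
  by rewrite scale0r add0r subr0 => ->; rewrite normrM ler_wpM2r.
- have [c _ ] := MVT h0 (fun t _ => dg t) (cg _ _).
  rewrite scale0r add0r sub0r distrC => ->; rewrite normrM normrN.
  by rewrite ler_wpM2r.
Qed.

Lemma test_function_support Omega u x : test_function Omega u -> ~ Omega x -> u x = 0.
Proof.
move=> [_ _ su] nx; apply: contrapT => /eqP ux; apply: nx; apply: su.
exact: subset_closure.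
Qed.

Lemma test_function_continuous Omega u : test_function Omega u -> continuous u.
Proof. by move=> [su _ _]; exact: (su 0%N). Qed.

Lemma test_function_bounded Omega u : test_function Omega u ->
  exists2 M, 0 <= M & forall x, `|u x| <= M.
Proof.
move=> tu; have [su cu _] := tu.
apply: (compact_support_bounded (test_function_continuous tu) cu) => x nx.
apply: contrapT => /eqP ux; apply: nx; exact: subset_closure.
Qed.

Lemma test_function_derive_bounded Omega u (i : 'I_N) : test_function Omega u ->
  exists2 M, 0 <= M & forall x, `|'D_(delta_mx ord0 i) u x| <= M.
Proof.
move=> tu; have [su cu _] := tu; have [_ hu] := (smoothP u).1 su.
have [_ sdu] := hu i.
apply: (@compact_support_bounded ('D_(delta_mx ord0 i) u)  (closure [set x | u x != 0])) => //.
  exact: (sdu 0%N).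
move=> x nx; rewrite (@near_eq_derive _ _ _ u (cst 0)) ?derive_cst//.
have : nbhs x (~` closure [set x | u x != 0]).
  by apply: open_nbhs_nbhs; split => //; apply: closed_openC; exact: closed_closure.
apply: filterS => z nz; apply: contrapT => /eqP uz; apply: nz.
exact: subset_closure.
Qed.

(** The coordinates are changed one at a time, each step being controlled by a
    bounded partial derivative through the mean value theorem. *)
Lemma test_function_lip Omega u : test_function Omega u ->
  exists2 L, 0 <= L & forall x y, `|u x - u y| <= L * `|x - y|.
Proof.
move=> tu; have [su _ _] := tu; have [_ hu] := (smoothP u).1 su.
have /choice[M HM] : forall i : 'I_N, exists M : R, 0 <= M /\
    forall x, `|'D_(delta_mx ord0 i) u x| <= M.
  by move=> i; have [M M0 HM] := test_function_derive_bounded i tu; exists M.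
exists (\sum_i M i) => [|x y].
  by apply: sumr_ge0 => i _; have [] := HM i.
(* z k has the first k coordinates of x and the others of y. *)
pose z k : 'rV[R]_N := \row_i (if (i < k)%N then x ord0 i else y ord0 i).
have z0 : z 0%N = y by apply/rowP => i; rewrite mxE ltn0.
have zN : z N = x by apply/rowP => i; rewrite mxE ltn_ord.
rewrite -{1}zN -{1}z0.
have -> : u (z N) - u (z 0%N) = \sum_(i < N) (u (z i.+1) - u (z i)).
  by rewrite -(big_mkord xpredT (fun i => u (z i.+1) - u (z i))) telescope_sumr.
apply: (le_trans (ler_norm_sum _ _ _)); rewrite mulr_suml.
apply: ler_sum => i _; have [M0 HMi] := HM i.
have -> : z i.+1 = (x ord0 i - y ord0 i) *: delta_mx ord0 i + z i.
  apply/rowP => j; rewrite !mxE eqxx/= ltnS; have [->|ji] := eqVneq j i.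
    by rewrite leqnn ltnn mulr1 subrK.
  by rewrite mulr0 add0r leq_eqVlt (negbTE (contra_neq _ ji))//; exact: val_inj.
have [hd _] := hu i.
apply: (le_trans (slice_lip _ M0 hd HMi _)); rewrite ler_wpM2l//.
by have := normr_coord (x - y) i; rewrite !mxE.
Qed.

Lemma test_function_measurable Omega u : test_function Omega u ->
  measurable_fun setT u.
Proof.
by move=> tu; apply: continuous_measurable_rV; exact: test_function_continuous tu.
Qed.

(** Where both given functions vanish so does the third one; hence its support
    lies in the union of two compact sets inside the domain. *)
Lemma test_function_combine Omega u v w : smooth w ->
  test_function Omega u -> test_function Omega v ->
  (forall x, u x = 0 -> v x = 0 -> w x = 0) -> test_function Omega w.
Proof.
move=> sw [su cu uO] [sv cv vO] h.
have sub : closure [set x | w x != 0] `<=`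
    closure [set x | u x != 0] `|` closure [set x | v x != 0].
  rewrite -closureU; apply: closure_subset => x /= wx.
  have [ux|ux] := eqVneq (u x) 0; last by left.
  by right; apply: contra_neq wx => vx; exact: h.
split=> //; last by move=> x /sub[/uO|/vO].
by apply: (subclosed_compact _ _ sub); [exact: closed_closure|exact: compactU].
Qed.

Lemma test_function_lincomb Omega u v a b :
  test_function Omega u -> test_function Omega v ->
  test_function Omega (fun x => a * u x + b * v x).
Proof.
move=> tu tv; have [su _ _] := tu; have [sv _ _] := tv.
apply: (test_function_combine _ tu tv) => [|x -> ->]; last by rewrite !mulr0 addr0.
by apply: smoothD; apply: smoothM => // k; exact: is_Ck_cst.
Qed.

Lemma test_function_spmean Omega u v (p e : R) : 0 < e -> 1 < p ->
  test_function Omega u -> test_function Omega v ->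
  test_function Omega (fun x => spmean p e (u x) (v x)).
Proof.
move=> e0 p1 tu tv; have [su _ _] := tu; have [sv _ _] := tv.
have sc (c : R) : smooth (fun _ : 'rV[R]_N => c) by move=> k; exact: is_Ck_cst.
have ss (w : 'rV[R]_N -> R) : smooth w -> smooth (fun x => sabs e (w x) `^ p).
  move=> sw; apply: smooth_powR; last first.
    by move=> x; apply: powR_gt0; rewrite ltr_wpDl ?sqr_ge0// exprn_gt0.
  apply: smooth_powR; last first.
    by move=> x; rewrite ltr_wpDl ?sqr_ge0// exprn_gt0.
  by apply: smoothD => //; apply: smoothM.
have pos a : 0 < sabs e a `^ p.
  by apply: powR_gt0; rewrite (lt_le_trans e0)// sabs_gee// ltW.
apply: (test_function_combine _ tu tv) => [|x -> ->]; last by rewrite spmean0// ltW.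
rewrite /spmean pmean.unlock; apply: smoothD => //; apply: smooth_powR.
  by apply: smoothM => //; apply: smoothD; exact: ss.
by move=> x; rewrite divr_gt0// addr_gt0.
Qed.

End test_functions.

(** * The Euclidean norm and the singular kernel *)

Section enorm.
Context {R : realType} {N : nat}.
Implicit Types x y : 'rV[R]_N.

Lemma enorm_ge0 x : 0 <= enorm x.
Proof. exact: sqrtr_ge0. Qed.

Lemma enorm_sqr x : enorm x ^+ 2 = \sum_i x ord0 i ^+ 2.
Proof. by rewrite sqr_sqrtr// sumr_ge0// => i _; rewrite sqr_ge0. Qed.

Lemma normr_le_enorm x : `|x| <= enorm x.
Proof.
apply: normr_le => [|i]; first exact: enorm_ge0.
rewrite -(@ler_pXn2r _ 2)// ?nnegrE ?enorm_ge0// enorm_sqr.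
rewrite real_normK ?num_real// (bigD1 i)//= lerDl.
by rewrite sumr_ge0// => j _; rewrite sqr_ge0.
Qed.

Lemma enorm_le x : enorm x <= N%:R * `|x|.
Proof.
rewrite -(@ler_pXn2r _ 2)// ?nnegrE ?enorm_ge0 ?mulr_ge0// enorm_sqr.
apply: (@le_trans _ _ (\sum_(i < N) `|x| ^+ 2)).
  apply: ler_sum => i _; rewrite -[leLHS]real_normK ?num_real//.
  by rewrite ler_pXn2r ?nnegrE//; exact: normr_coord.
rewrite sumr_const card_ord -[leLHS]mulr_natl [leRHS]exprMn; apply: ler_wpM2r; first exact: sqr_ge0.
by rewrite -natrX ler_nat expnS expn1; case: (N) => // n; exact: leq_pmulr.
Qed.

Lemma enorm0 : enorm (0 : 'rV[R]_N) = 0.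
Proof.
by apply/eqP; rewrite eq_le enorm_ge0 andbT (le_trans (enorm_le _))// normr0 mulr0.
Qed.

Lemma enormN x : enorm (- x) = enorm x.
Proof. by congr Num.sqrt; apply: eq_bigr => i _; rewrite mxE sqrrN. Qed.

Lemma enormBC x y : enorm (x - y) = enorm (y - x).
Proof. by rewrite -enormN opprB. Qed.

Lemma measurable_enorm : measurable_fun setT (@enorm R N).
Proof.
apply: (@measurableT_comp _ _ _ _ _ _ (@Num.sqrt R)).
  by apply: continuous_measurable_fun; exact: sqrt_continuous.
rewrite [X in measurable_fun _ X](_ : _ =
    fun x => \sum_(i <- enum 'I_N) (x ord0 i) ^+ 2); last first.
  by apply/funext => x; rewrite big_enum.
apply: (@measurable_sum _ _ _ _ _ _ (fun i (x : 'rV[R]_N) => x ord0 i ^+ 2)) => i.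
by apply: measurable_funX; exact: measurable_coord.
Qed.

Lemma measurable_rVB : measurable_fun setT (fun z : 'rV[R]_N * 'rV[R]_N => z.1 - z.2).
Proof.
apply: measurable_fun_rVP => i; under eq_fun do rewrite !mxE.
apply: measurable_funB.
  exact: (measurableT_comp (measurable_coord i) measurable_fst).
exact: (measurableT_comp (measurable_coord i) measurable_snd).
Qed.

(** Balls for the sup norm are boxes, so their measure is a product. *)
Lemma lebesgue_rV_ball x (t : R) : 0 < t ->
  lebesgue_rV R N [set y | `|x - y| < t] = ((2 * t) ^+ N)%:E.
Proof.
move=> t0.
have -> : [set y : 'rV[R]_N | `|x - y| < t] =
    [set y | forall i, ball (x ord0 i) t (y ord0 i)].
  apply/seteqP; split => y /= h.
    move=> i; rewrite /ball/=; apply: le_lt_trans h.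
    by have := normr_coord (x - y) i; rewrite !mxE.
  by apply: normr_lt => // i; have := h i; rewrite !mxE.
rewrite (@lebesgue_rV_box R N (fun i => ball (x ord0 i) t)); last first.
  by move=> i; exact: measurable_ball.
rewrite (eq_bigr (fun=> (2 * t)%:E)) => [|i _].
  by rewrite prodEFin prodr_const card_ord.
by rewrite lebesgue_measure_ball ?ltW// mulr_natl.
Qed.

End enorm.

(** For a > 0 the value on the diagonal is 0, the inverse of zero. *)
HB.lock Definition rker (R : realType) (N : nat) (a : R) (z : 'rV[R]_N * 'rV[R]_N) : R :=
  (enorm (z.1 - z.2) `^ a)^-1.

Section kernel.
Context {R : realType} {N : nat}.
Implicit Types (x y : 'rV[R]_N) (z : 'rV[R]_N * 'rV[R]_N).

Lemma rker_ge0 a z : 0 <= rker a z.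
Proof. by rewrite rker.unlock invr_ge0 powR_ge0. Qed.

Lemma rkerE a z : rker a z = enorm (z.1 - z.2) `^ (- a).
Proof. by rewrite rker.unlock powRN. Qed.

Lemma rkerC a x y : rker a (x, y) = rker a (y, x).
Proof. by rewrite !rkerE/= enormBC. Qed.

Lemma measurable_rker a : measurable_fun setT (@rker R N a).
Proof.
rewrite (_ : @rker R N a = fun z => enorm (z.1 - z.2) `^ (- a)); last first.
  by apply/funext => z; rewrite rkerE.
apply: (@measurableT_comp _ _ _ _ _ _ (fun x : R => x `^ (- a))).
  exact: measurable_powR.
exact: (measurableT_comp measurable_enorm measurable_rVB).
Qed.

End kernel.

(** * The integral of the truncated kernel *)

Lemma powR_inv_base (R : realType) (x a : R) : 0 <= x -> x^-1 `^ a = x `^ (- a).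
Proof. by move=> x0; rewrite -powR_inv1// -powRrM mulN1r. Qed.

Lemma dyadic_ge1 (R : realType) (r : R) : 1 <= r -> exists j, 2 ^+ j <= r < 2 ^+ j.+1.
Proof.
move=> r1.
have ex : exists n, r < 2 ^+ n.
  exists (Num.bound r); apply: (lt_trans (archi_boundP (le_trans ler01 r1))).
  by rewrite -natrX ltr_nat ltn_expl.
case: (ex_minnP ex) => -[|n]; first by rewrite expr0 ltNge r1.
move=> rn hmin; exists n; rewrite rn andbT leNgt; apply/negP => /hmin.
by rewrite ltnn.
Qed.

Lemma dyadic (R : realType) (r : R) : 0 < r -> exists j, let t := 2 ^+ j in
  t <= r < 2 * t \/ (2 * t)^-1 <= r <= t^-1.
Proof.
move=> r0; have [r1|r1] := leP 1 r.
  by have [j] := dyadic_ge1 r1; exists j; left; rewrite -exprS.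
have : 1 <= r^-1 by rewrite invr_ge1 ?ltW// unitfE gt_eqF.
move=> /dyadic_ge1[j /andP[h1 h2]]; exists j; right; rewrite -exprS.
apply/andP; split; first by rewrite invf_ple ?posrE ?exprn_gt0// ltW.
by rewrite invf_pge ?posrE ?exprn_gt0.
Qed.

Section kernel_bound.
Context {R : realType} {N : nat}.
Implicit Types (x y : 'rV[R]_N) (z : 'rV[R]_N * 'rV[R]_N).
Local Notation mu := (lebesgue_rV R N).
Variable p : R.
Hypothesis p1 : 1 < p.
Let p0 : 0 < p. Proof. exact: lt_trans ltr01 p1. Qed.

(** Equal to |x - y|^(p - N - kp) near the diagonal and to the kernel itself
    away from it. It dominates the energy density of bounded Lipschitz
    functions, and also compares kernels of different orders. *)
Definition lker k z := Num.min 1 (enorm (z.1 - z.2) `^ p) * rker (N%:R + k * p) z.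

Lemma lker_ge0 k z : 0 <= lker k z.
Proof. by rewrite mulr_ge0 ?rker_ge0// le_min ler01 powR_ge0. Qed.

Lemma lkerC k x y : lker k (x, y) = lker k (y, x).
Proof. by rewrite /lker/= enormBC rkerC. Qed.

Lemma measurable_lker k : measurable_fun setT (lker k).
Proof.
apply: measurable_funM; last exact: measurable_rker.
apply: measurable_minr => //.
apply: (@measurableT_comp _ _ _ _ _ _ (fun x : R => x `^ p)).
  exact: measurable_powR.
exact: (measurableT_comp measurable_enorm measurable_rVB).
Qed.

Lemma measurable_subball x (t : R) : measurable [set y : 'rV[R]_N | `|x - y| < t].
Proof.
apply: open_measurable_rV.
have -> : [set y | `|x - y| < t] = ball x t by rewrite ballE.
exact: ball_open.
Qed.

(** On the dyadic shells of radius about 2^-j and 2^j around x, constants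
    above the truncated kernel. *)
Let cA k j : R := N%:R `^ p * (2 ^+ j) `^ (- p) * (2 * 2 ^+ j) `^ (N%:R + k * p).
Let cB k j : R := (2 ^+ j) `^ (- (N%:R + k * p)).

(** The distance between two distinct points lies in a dyadic shell, of radius
    either at least or at most 1, and on the shell every factor of the kernel
    is comparable to a power of 2^j. *)
Lemma lker_dyadic k x y : 0 < k -> exists j,
  lker k (x, y) <= cA k j * \1_[set y | `|x - y| < 2 * (2 ^+ j)^-1] y +
                   cB k j * \1_[set y | `|x - y| < 2 * 2 ^+ j] y.
Proof.
move=> k0.
have a0 : 0 <= N%:R + k * p by rewrite addr_ge0// mulr_ge0// ltW.
have aN : - (N%:R + k * p) <= 0 by rewrite oppr_le0.
have cA0 j : 0 <= cA k j by rewrite /cA !mulr_ge0 ?powR_ge0.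
have cB0 j : 0 <= cB k j by rewrite powR_ge0.
have ind0 (A : set 'rV[R]_N) : 0 <= \1_A y :> R by rewrite indicE ler0n.
have [xy|xy] := eqVneq x y.
  exists 0%N; rewrite /lker xy/= subrr enorm0 powR0 ?gt_eqF//.
  by rewrite /Num.min ltNge ler01/= mul0r addr_ge0// mulr_ge0.
have r0 : 0 < `|x - y| by rewrite normr_gt0 subr_eq0.
have re := normr_le_enorm (x - y).
have e0 : 0 < enorm (x - y) by exact: lt_le_trans re.
have er := enorm_le (x - y).
have mono (s t : R) : 0 < s -> s <= t -> t `^ (- (N%:R + k * p)) <= s `^ (- (N%:R + k * p)).
  move=> s0 st; rewrite !powRN lef_pV2 ?posrE ?powR_gt0//; last exact: lt_le_trans st.
  by apply: ge0_ler_powR; rewrite ?nnegrE ?(ltW s0)// ltW// (lt_le_trans s0).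
have [j [/andP[h1 h2]|/andP[h1 h2]]] := dyadic r0; exists j.
  have t0 : 0 < (2 : R) ^+ j by rewrite exprn_gt0.
  rewrite [X in _ <= _ + _ * X]indicE mem_set// mulr1.
  apply: (@le_trans _ _ (cB k j)); last by rewrite lerDr mulr_ge0.
  rewrite /lker /cB -[leRHS]mul1r; apply: ler_pM; rewrite ?rker_ge0//.
  - by rewrite le_min ler01 powR_ge0.
  - by rewrite rkerE/=; apply: mono => //; exact: le_trans re.
have t0 : 0 < (2 : R) ^+ j by rewrite exprn_gt0.
rewrite [X in _ <= _ * X + _]indicE mem_set/= ?mulr1; last first.
  by apply: (le_lt_trans h2); rewrite ltr_pMl ?invr_gt0// ltr1n.
apply: (@le_trans _ _ (cA k j)); last by rewrite lerDl mulr_ge0.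
rewrite /lker /cA; apply: ler_pM; rewrite ?rker_ge0//.
- by rewrite le_min ler01 powR_ge0.
- rewrite ge_min; apply/orP; right.
  rewrite -powR_inv_base ?(ltW t0)// -powRM ?invr_ge0 ?(ltW t0)//.
  apply: le_powRp => //; first exact: ltW.
  by apply: (le_trans er); rewrite ler_wpM2l.
- rewrite rkerE/=; apply: (le_trans (mono _ _ _ (le_trans h1 re))).
    by rewrite invr_gt0 mulr_gt0.
  by rewrite powR_inv_base ?opprK// mulr_ge0 ?(ltW t0).
Qed.

Lemma powR_exprn (a : R) j : (2 ^+ j : R) `^ a = (2 `^ a) ^+ j.
Proof. by rewrite -powR_mulrn// -powRrM mulrC powRrM powR_mulrn// powR_ge0. Qed.

Lemma integral_indicZ (c : R) (A : set 'rV[R]_N) : 0 <= c -> measurable A ->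
  (\int[mu]_y (c * \1_A y)%:E = c%:E * mu A)%E.
Proof.
move=> c0 mA; under eq_integral do rewrite EFinM.
rewrite ge0_integralZl_EFin//; first by rewrite integral_indic// setIT.
by apply/measurable_EFinP; exact: measurable_indic.
Qed.

(** The shells of radius 2^-j contribute a geometric series of ratio 2^(kp-p),
    which converges because k < 1; those of radius 2^j one of ratio 2^-(kp),
    which converges because k > 0. Only the position of the pair matters, so
    the bound is uniform in x. *)
Lemma lker_int_bound k : 0 < k < 1 -> exists2 C : R, 0 <= C &
  forall x, (\int[mu]_y (lker k (x, y))%:E <= C%:E)%E.
Proof.
move=> /andP[k0 k1].
pose KA : R := N%:R `^ p * 2 `^ (N%:R + k * p) * 4 ^+ N.
pose KB : R := 4 ^+ N.
pose qA : R := 2 `^ (- (p - k * p)); pose qB : R := 2 `^ (- (k * p)).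
have kp0 : 0 < k * p by rewrite mulr_gt0.
have qlt (a : R) : 0 < a -> 2 `^ (- a) < (1 : R).
  move=> a0; rewrite powRN invf_lt1 ?powR_gt0//.
  have := @gt0_ltr_powR R a a0 1 2; rewrite powR1; apply; rewrite ?nnegrE//; lra.
have qA1 : qA < 1 by apply: qlt; rewrite subr_gt0 gtr_pMl.
have qB1 : qB < 1 by exact: qlt.
have KA0 : 0 <= KA by rewrite !mulr_ge0 ?powR_ge0.
have KB0 : 0 <= KB by rewrite exprn_ge0.
have qA0 : 0 <= qA by exact: powR_ge0.
have qB0 : 0 <= qB by exact: powR_ge0.
exists (KA / (1 - qA) + KB / (1 - qB)).
  by rewrite addr_ge0// divr_ge0// subr_ge0 ltW.
move=> x.
pose UA j := [set y : 'rV[R]_N | `|x - y| < 2 * (2 ^+ j)^-1].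
pose UB j := [set y : 'rV[R]_N | `|x - y| < 2 * 2 ^+ j].
pose A j y := cA k j * \1_(UA j) y + cB k j * \1_(UB j) y.
have mUA j : measurable (UA j) by exact: measurable_subball.
have mUB j : measurable (UB j) by exact: measurable_subball.
have cA0 j : 0 <= cA k j by rewrite /cA !mulr_ge0 ?powR_ge0.
have cB0 j : 0 <= cB k j by rewrite powR_ge0.
have A0 j y : 0 <= A j y by rewrite addr_ge0// mulr_ge0// indicE ler0n.
have mA j : measurable_fun setT (A j).
  by apply: measurable_funD; apply: measurable_funM => //; exact: measurable_indic.
have intA j : (\int[mu]_y (A j y)%:E = (KA * qA ^+ j)%:E + (KB * qB ^+ j)%:E)%E.
  have t0 : 0 < (2 : R) ^+ j by rewrite exprn_gt0.
  have tD (a b : R) : (2 ^+ j) `^ (a + b) = (2 ^+ j) `^ a * (2 ^+ j) `^ b.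
    by rewrite powRD// (gt_eqF t0) implybT.
  under eq_integral do rewrite EFinD.
  rewrite ge0_integralD//; last 4 first.
  - by move=> y _; rewrite lee_fin mulr_ge0// indicE ler0n.
  - by apply/measurable_EFinP; apply: measurable_funM => //; exact: measurable_indic.
  - by move=> y _; rewrite lee_fin mulr_ge0// indicE ler0n.
  - by apply/measurable_EFinP; apply: measurable_funM => //; exact: measurable_indic.
  rewrite !integral_indicZ// !lebesgue_rV_ball ?mulr_gt0 ?invr_gt0//.
  rewrite -!EFinM; congr (_%:E + _%:E)%E.
    rewrite /cA /KA /qA -powR_exprn powRM ?(ltW t0)//.
    have -> : 2 * (2 * (2 ^+ j)^-1) = 4 * (2 ^+ j)^-1 :> R by rewrite mulrA; congr (_ / _); ring.
    rewrite exprMn -[in (2 ^+ j)^-1 ^+ N]powR_mulrn ?invr_ge0 ?(ltW t0)//.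
    rewrite powR_inv_base ?(ltW t0)//.
    have -> : - (p - k * p) = - p + (N%:R + k * p) + - N%:R by ring.
    by rewrite !tD; ring.
  rewrite /cB /KB /qB -powR_exprn.
  have -> : 2 * (2 * 2 ^+ j) = 4 * 2 ^+ j :> R by ring.
  rewrite exprMn -[in (2 ^+ j) ^+ N]powR_mulrn ?(ltW t0)//.
  have -> : - (k * p) = - (N%:R + k * p) + N%:R by ring.
  by rewrite tD; ring.
have mlk : measurable_fun setT (fun y => lker k (x, y)).
  apply: (measurableT_comp (measurable_lker k)).
  exact: measurable_pair1.
apply: (@le_trans _ _ (\int[mu]_y \sum_(j <oo) (A j y)%:E)%E).
  apply: ge0_le_integral => //.
  - by move=> y _; rewrite lee_fin lker_ge0.
  - exact/measurable_EFinP.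
  - apply: ge0_emeasurable_sum => [j y _ _|j _]; first by rewrite lee_fin.
    exact/measurable_EFinP.
  move=> y _; have [j hj] := lker_dyadic x y k0.
  apply: (@le_trans _ _ (A j y)%:E); first by rewrite lee_fin.
  have := @nneseries_lim_ge R (fun n => (A n y)%:E) xpredT 0%N j.+1.
  move=> H; apply: le_trans (H _); last by move=> ? ? ?; rewrite lee_fin.
  by rewrite big_nat_recr//= leeDr// sume_ge0// => i _; rewrite lee_fin.
rewrite integral_nneseries//; last 2 first.
- by move=> j; exact/measurable_EFinP.
- by move=> j y _; rewrite lee_fin.
under eq_eseriesr do rewrite intA.
rewrite nneseriesD//; last 2 first.
- by move=> j _ _; rewrite lee_fin mulr_ge0// exprn_ge0.
- by move=> j _ _; rewrite lee_fin mulr_ge0// exprn_ge0.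
by rewrite !nneseries_geometric.
Qed.

End kernel_bound.

(** * The energy and its dependence on the order *)

Section product_ae.
Context d1 d2 (T1 : measurableType d1) (T2 : measurableType d2) (R : realType).
Variable m1 : {sigma_finite_measure set T1 -> \bar R}.
Variable m2 : {sigma_finite_measure set T2 -> \bar R}.

Lemma ae_product1 (P : T1 -> Prop) :
  {ae m1, forall x, P x} -> {ae (m1 \x m2)%E, forall z, P z.1}.
Proof.
move=> [A [mA A0 PA]]; exists (A `*` setT); split.
- exact: measurableX.
- have -> : (m1 \x m2)%E (A `*` setT) = (m1 A * m2 setT)%E by exact: product_measure1E.
  by rewrite A0 mul0e.
- by move=> z /= /PA Az; split.
Qed.

Lemma ae_product2 (P : T2 -> Prop) :
  {ae m2, forall x, P x} -> {ae (m1 \x m2)%E, forall z, P z.2}.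
Proof.
move=> [A [mA A0 PA]]; exists (setT `*` A); split.
- exact: measurableX.
- have -> : (m1 \x m2)%E (setT `*` A) = (m1 setT * m2 A)%E by exact: product_measure1E.
  by rewrite A0 mule0.
- by move=> z /= /PA Az; split.
Qed.

End product_ae.

Section kernel_inequalities.
Context {R : realType} {N : nat}.
Variable p : R.
Hypothesis p1 : 1 < p.
Let p0 : 0 < p. Proof. exact: lt_trans ltr01 p1. Qed.
Implicit Types (x y : 'rV[R]_N) (z : 'rV[R]_N * 'rV[R]_N) (k : R).

Lemma rker_expnt_gt0 k : 0 < k -> 0 < N%:R + k * p.
Proof. by move=> k0; rewrite ltr_wpDl// mulr_gt0. Qed.

(** At distance at most 1 the kernel increases with the order; at larger
    distance the truncation is inactive. *)
Lemma rker_le_lker k k' z : 0 < k' -> k' <= k ->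
  rker (N%:R + k' * p) z <= rker (N%:R + k * p) z + lker p k' z.
Proof.
move=> k'0 kk; have a0 := rker_expnt_gt0 k'0.
have b0 := rker_expnt_gt0 (lt_le_trans k'0 kk).
have [e0|e0] := eqVneq (enorm (z.1 - z.2)) 0.
  rewrite rkerE e0 powR0 ?oppr_eq0 ?gt_eqF//.
  by rewrite addr_ge0// ?rker_ge0 ?lker_ge0.
have {}e0 : 0 < enorm (z.1 - z.2) by rewrite lt_neqAle eq_sym e0 enorm_ge0.
have [e1|e1] := leP (enorm (z.1 - z.2)) 1.
  apply: (@le_trans _ _ (rker (N%:R + k * p) z)); last by rewrite lerDl lker_ge0.
  rewrite !rkerE; apply: ger_powR; first by rewrite e0.
  by rewrite lerN2 lerD2l ler_wpM2r// ltW.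
apply: (@le_trans _ _ (lker p k' z)); last by rewrite lerDr rker_ge0.
rewrite /lker -[leLHS]mul1r ler_wpM2r ?rker_ge0// le_min lexx/=.
have := @ge0_ler_powR R p (ltW p0) 1 (enorm (z.1 - z.2)).
by rewrite powR1; apply; rewrite ?nnegrE ?enorm_ge0// ltW.
Qed.

(** For a fixed distance r the kernel r^-a = e^(-a ln r) is convex in the
    exponent; both values are compared with the tangent of the exponential at
    the intermediate point. *)
Lemma rker_convex (t a b : R) z : 0 < t < 1 -> 0 < a -> 0 < b ->
  rker ((1 - t) * a + t * b) z <= (1 - t) * rker a z + t * rker b z.
Proof.
move=> /andP[t0 t1] a0 b0.
have t1' : 0 < 1 - t by rewrite subr_gt0.
have c0 : 0 < (1 - t) * a + t * b by rewrite addr_gt0// mulr_gt0.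
have [e0|e0] := eqVneq (enorm (z.1 - z.2)) 0.
  by rewrite !rkerE e0 !powR0 ?oppr_eq0 ?gt_eqF// !mulr0 addr0.
rewrite !rkerE /powR (negbTE e0); move: (ln _) => l.
(* m is the exponent of the kernel at the intermediate order. *)
set m := (- ((1 - t) * a + t * b) * l).
have h (x : R) : expR m * (1 + (x - m)) <= expR x.
  have := expR_ge1Dx (x - m); rewrite -(ler_pM2l (expR_gt0 m)) -expRD.
  by rewrite [m + (x - m)]addrC subrK.
have h1 := h (- a * l); have h2 := h (- b * l).
have h3 : (1 - t) * (expR m * (1 + (- a * l - m))) <= (1 - t) * expR (- a * l).
  by rewrite ler_pM2l.
have h4 : t * (expR m * (1 + (- b * l - m))) <= t * expR (- b * l).
  by rewrite ler_pM2l.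
apply: le_trans (lerD h3 h4).
by rewrite le_eqVlt; apply/orP; left; apply/eqP; rewrite /m; ring.
Qed.

Lemma powR_normB_le (a b : R) : `|a - b| `^ p <= 2 `^ p * (`|a| `^ p + `|b| `^ p).
Proof.
wlog ab : a b / `|b| <= `|a|.
  move=> wl; have [h|h] := leP `|b| `|a|; first exact: wl.
  by rewrite distrC [X in _ * X]addrC; apply: wl; exact: ltW.
apply: (@le_trans _ _ ((2 * `|a|) `^ p)).
  apply: le_powRp => //; have := ler_normB a b; lra.
by rewrite powRM// ler_wpM2l ?powR_ge0// lerDl powR_ge0.
Qed.

End kernel_inequalities.

Section gagliardo_functional.
Context {R : realType} {N : nat}.
Implicit Types (x y : 'rV[R]_N) (z : 'rV[R]_N * 'rV[R]_N) (k s : R).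
Implicit Types (u v : 'rV[R]_N -> R).
Local Notation mu := (lebesgue_rV R N).
Local Notation mu2 := (mu \x mu)%E.
Variable p : R.
Hypothesis p1 : 1 < p.
Let p0 : 0 < p. Proof. exact: lt_trans ltr01 p1. Qed.
Let pN0 : p != 0. Proof. by rewrite gt_eqF. Qed.

(** The energy of u is the p-th power of the L^p norm of this function on the
    product space. As it is linear in u, facts about L^p such as Fatou's
    lemma, uniform convexity and continuity transfer to the energy. *)
Definition dq s u z : R := (u z.1 - u z.2) * rker (N%:R + s * p) z `^ p^-1.

(** The p-th power of the Gagliardo seminorm. *)
Definition Gp s u : \bar R := pint mu2 p (dq s u).

Definition gint s u z : R := `|u z.1 - u z.2| `^ p * rker (N%:R + s * p) z.

Lemma gint_ge0 s u z : 0 <= gint s u z.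
Proof. by rewrite mulr_ge0 ?powR_ge0 ?rker_ge0. Qed.

Lemma norm_dqX s u z : `|dq s u z| `^ p = gint s u z.
Proof.
rewrite /dq normrM powRM// [X in _ * X `^ _]ger0_norm ?powR_ge0//.
by rewrite powRVpK// rker_ge0.
Qed.

Lemma measurable_diff u : measurable_fun setT u ->
  measurable_fun setT (fun z : 'rV[R]_N * 'rV[R]_N => u z.1 - u z.2).
Proof.
move=> mu_; apply: measurable_funB.
  exact: (measurableT_comp mu_ measurable_fst).
exact: (measurableT_comp mu_ measurable_snd).
Qed.

Lemma measurable_dq s u : measurable_fun setT u -> measurable_fun setT (dq s u).
Proof.
move=> mu_; apply: measurable_funM; first exact: measurable_diff.
apply: (@measurableT_comp _ _ _ _ _ _ (fun x : R => x `^ p^-1)).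
  exact: measurable_powR.
exact: measurable_rker.
Qed.

Lemma measurable_gint s u : measurable_fun setT u -> measurable_fun setT (gint s u).
Proof.
move=> mu_; rewrite (_ : gint s u = fun z => `|dq s u z| `^ p).
  by apply: measurable_norm_powR; exact: measurable_dq.
by apply/funext => z; rewrite norm_dqX.
Qed.

Lemma GpE s u : Gp s u = (\int[mu2]_z (gint s u z)%:E)%E.
Proof.
by rewrite /Gp pint.unlock; apply: eq_integral => z _; rewrite norm_dqX.
Qed.

Lemma gagliardoE s u : measurable_fun setT u -> gagliardo s p u = (Gp s u `^ p^-1)%E.
Proof.
move=> mu_; rewrite GpE (fubini_tonelli1 (m1 := mu) (m2 := mu) (fun z => (gint s u z)%:E));
  [|by apply/measurable_EFinP; exact: measurable_gint|
    by move=> z; rewrite lee_fin gint_ge0].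
rewrite /gagliardo; congr (_ `^ _)%E.
by apply: eq_integral => x _; apply: eq_integral => y _; rewrite /gint rker.unlock.
Qed.

Lemma Gp_ge0 s u : (0 <= Gp s u)%E.
Proof. exact: pint_ge0. Qed.

Lemma gagliardoX s u : measurable_fun setT u -> (gagliardo s p u `^ p)%E = Gp s u.
Proof.
by move=> mu_; rewrite gagliardoE// -poweRrM mulVf// poweRe1// Gp_ge0.
Qed.

Lemma Gp_ae_eq s u v : measurable_fun setT u -> measurable_fun setT v ->
  {ae mu, forall x, u x = v x} -> Gp s u = Gp s v.
Proof.
move=> mu_ mv uv; apply: pint_ae_eq => //; try exact: measurable_dq.
have := ae_product1 mu uv; apply: filterS2 (ae_product2 mu uv) => z h1 h2.
by rewrite /dq h1 h2.
Qed.

(** Tonelli's theorem in either order, together with the symmetry of the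
    truncated kernel. *)
Lemma lker_weight_bound k : 0 < k < 1 -> exists2 C : R, 0 <= C &
  forall g : 'rV[R]_N -> R, measurable_fun setT g -> (forall x, 0 <= g x) ->
  (\int[mu2]_z ((g z.1 + g z.2) * lker p k z)%:E <= C%:E * \int[mu]_x (g x)%:E)%E.
Proof.
move=> k01; have [C C0 HC] := lker_int_bound (N := N) p1 k01.
exists (C + C); first exact: addr_ge0.
move=> g mg g0.
have mg1 : measurable_fun setT (fun z : 'rV[R]_N * 'rV[R]_N => g z.1 * lker p k z).
  apply: measurable_funM; last exact: measurable_lker.
  exact: (measurableT_comp mg measurable_fst).
have mg2 : measurable_fun setT (fun z : 'rV[R]_N * 'rV[R]_N => g z.2 * lker p k z).
  apply: measurable_funM; last exact: measurable_lker.
  exact: (measurableT_comp mg measurable_snd).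
have h1 z : 0 <= g z.1 * lker p k z by rewrite mulr_ge0// lker_ge0.
have h2 z : 0 <= g z.2 * lker p k z by rewrite mulr_ge0// lker_ge0.
under eq_integral do rewrite mulrDl EFinD.
rewrite ge0_integralD//; last 4 first.
- by move=> z _; rewrite lee_fin.
- exact/measurable_EFinP.
- by move=> z _; rewrite lee_fin.
- exact/measurable_EFinP.
have mlk x : measurable_fun setT (fun y => lker p k (x, y)).
  apply: (measurableT_comp (measurable_lker p k)); exact: measurable_pair1.
have bound : (\int[mu]_x \int[mu]_y (g x * lker p k (x, y))%:E <=
    C%:E * \int[mu]_x (g x)%:E)%E.
  rewrite -ge0_integralZl_EFin//; last 2 first.
  - by move=> x _; rewrite lee_fin.
  - exact/measurable_EFinP.
  apply: ge0_le_integral => //.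
  - by move=> x _; apply: integral_ge0 => y _; rewrite lee_fin; exact: (h1 (x, y)).
  - apply: (measurable_fun_fubini_tonelli_F (m2 := mu)
      (fun z => (g z.1 * lker p k z)%:E)) => //.
    exact/measurable_EFinP.
  - by apply: measurable_funeM; exact/measurable_EFinP.
  - move=> x _; under eq_integral do rewrite EFinM.
    rewrite ge0_integralZl_EFin//.
    + by rewrite muleC; apply: lee_wpmul2r; rewrite ?lee_fin//.
    + by move=> y _; rewrite lee_fin lker_ge0.
    + exact/measurable_EFinP.
rewrite EFinD ge0_muleDl ?lee_fin//; apply: leeD.
  by rewrite fubini_tonelli1//; exact/measurable_EFinP.
rewrite (fubini_tonelli2 (m1 := mu) (m2 := mu) (fun z => (g z.2 * lker p k z)%:E));
  [|exact/measurable_EFinP|by move=> z; rewrite lee_fin].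
apply: le_trans bound; rewrite le_eqVlt; apply/orP; left; apply/eqP.
by apply: eq_integral => y _; apply: eq_integral => x _ /=; rewrite lkerC.
Qed.

(** Near the diagonal the kernel of lower order is the smaller one; away from
    it the difference of the two values of u is split, and each part costs a
    multiple of the L^p norm. *)
Lemma Gp_embedding k' : 0 < k' < 1 -> exists2 C : R, 0 <= C & forall k u,
  k' <= k -> measurable_fun setT u -> (Gp k' u <= Gp k u + C%:E * pint mu p u)%E.
Proof.
move=> k01; have [C C0 HC] := lker_weight_bound k01.
exists (2 `^ p * C); first by rewrite mulr_ge0// powR_ge0.
move=> k u kk mu_; have mup := measurable_norm_powR p mu_.
have := HC _ mup (fun x => powR_ge0 _ _).
rewrite pint.unlock !GpE EFinM -muleA => /(lee_wpmul2l (x := (2 `^ p)%:E)).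
rewrite lee_fin powR_ge0 => /(_ isT) h; apply: le_trans (leeD2l _ h).
have mw : measurable_fun setT
    (fun z => (`|u z.1| `^ p + `|u z.2| `^ p) * lker p k' z).
  apply: measurable_funM; last exact: measurable_lker.
  apply: measurable_funD.
    exact: (measurableT_comp mup measurable_fst).
  exact: (measurableT_comp mup measurable_snd).
have w0 z : 0 <= (`|u z.1| `^ p + `|u z.2| `^ p) * lker p k' z.
  by rewrite mulr_ge0 ?lker_ge0// addr_ge0// powR_ge0.
rewrite -ge0_integralZl_EFin ?powR_ge0//; last 2 first.
- by move=> z _; rewrite lee_fin.
- exact/measurable_EFinP.
rewrite -ge0_integralD//; last 4 first.
- by move=> z _; rewrite lee_fin gint_ge0.
- by apply/measurable_EFinP; exact: measurable_gint.
- by move=> z _; rewrite mule_ge0 ?lee_fin ?powR_ge0.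
- by apply: measurable_funeM; exact/measurable_EFinP.
apply: ge0_le_integral => //.
- by move=> z _; rewrite lee_fin gint_ge0.
- by apply/measurable_EFinP; exact: measurable_gint.
- apply: emeasurable_funD; first by apply/measurable_EFinP; exact: measurable_gint.
  by apply: measurable_funeM; exact/measurable_EFinP.
move=> z _; rewrite -EFinM -EFinD lee_fin /gint.
have /andP[k'0 _] := k01.
apply: (@le_trans _ _ (`|u z.1 - u z.2| `^ p *
    (rker (N%:R + k * p) z + lker p k' z))).
  by rewrite ler_wpM2l ?powR_ge0//; exact: rker_le_lker.
rewrite mulrDr lerD2l (mulrA (2 `^ p)).
by apply: ler_wpM2r; [exact: lker_ge0|exact: powR_normB_le].
Qed.

Lemma Gp_convex (t s k : R) u : 0 < t < 1 -> 0 < s -> 0 < k ->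
  measurable_fun setT u ->
  (Gp ((1 - t) * s + t * k) u <= (1 - t)%:E * Gp s u + t%:E * Gp k u)%E.
Proof.
move=> t01 s0 k0 mu_; have /andP[t0 t1] := t01.
have t1' : 0 <= 1 - t by rewrite subr_ge0 ltW.
rewrite !GpE -!ge0_integralZl_EFin ?(ltW t0)//;
  try (by move=> z _; rewrite lee_fin gint_ge0);
  try (by apply/measurable_EFinP; exact: measurable_gint).
rewrite -ge0_integralD//;
  try (by move=> z _; rewrite mule_ge0 ?lee_fin ?gint_ge0 ?(ltW t0));
  try (by apply: measurable_funeM; apply/measurable_EFinP; exact: measurable_gint).
apply: ge0_le_integral => //.
- by move=> z _; rewrite lee_fin gint_ge0.
- by apply/measurable_EFinP; exact: measurable_gint.
- by apply: emeasurable_funD; apply: measurable_funeM; apply/measurable_EFinP;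
    exact: measurable_gint.
move=> z _; rewrite -!EFinM -EFinD lee_fin /gint.
have := rker_convex z t01 (rker_expnt_gt0 (N := N) p1 s0) (rker_expnt_gt0 (N := N) p1 k0).
have -> : (1 - t) * (N%:R + s * p) + t * (N%:R + k * p) =
    N%:R + ((1 - t) * s + t * k) * p by ring.
move=> /(ler_wpM2l (powR_ge0 `|u z.1 - u z.2| p)) /le_trans; apply.
by rewrite le_eqVlt; apply/orP; left; apply/eqP; ring.
Qed.

End gagliardo_functional.

(** * The Poincare inequality and the energy of test functions *)

Lemma cvge0P (R : realType) (T : Type) (F : set_system T) (FF : Filter F)
    (f : T -> \bar R) : (forall x, (0 <= f x)%E) ->
  f x @[x --> F] --> 0%E <->
  (forall e : R, 0 < e -> \forall x \near F, (f x <= e%:E)%E).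
Proof.
move=> f0; split=> [/fine_cvgP[ff cf] e e0|h].
  have /cvgrPdist_le/(_ e e0) he := cf.
  near=> x.
  have fx : f x \is a fin_num by near: x; exact: ff.
  have : `|0 - (fine \o f) x| <= e by near: x; exact: he.
  by rewrite /= sub0r normrN ger0_norm ?fine_ge0// -lee_fin fineK.
have fin (e : R) : 0 < e -> \forall x \near F, f x \is a fin_num.
  move=> e0; near=> x; rewrite ge0_fin_numE//.
  apply: (@le_lt_trans _ _ e%:E); last by rewrite ltry.
  by near: x; exact: h.
apply/fine_cvgP; split; first exact: (fin 1).
apply/(@cvgrPdist_le _ R^o) => e e0 /=.
near=> x.
have fx : f x \is a fin_num by near: x; exact: (fin e).
rewrite sub0r normrN ger0_norm ?fine_ge0// -lee_fin fineK//.
by near: x; exact: h.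
Unshelve. all: by end_near. Qed.

Lemma cvge0_poweR (R : realType) (T : Type) (F : set_system T) (FF : Filter F)
    (f : T -> \bar R) (a : R) : 0 < a -> (forall x, (0 <= f x)%E) ->
  (f x `^ a)%E @[x --> F] --> 0%E <-> f x @[x --> F] --> 0%E.
Proof.
move=> a0 f0.
have key (b : R) (g : T -> \bar R) : 0 < b -> (forall x, (0 <= g x)%E) ->
    g x @[x --> F] --> 0%E -> (g x `^ b)%E @[x --> F] --> 0%E.
  move=> b0 g0 /(cvge0P FF g0) h; apply/cvge0P => [x|e e0]; first exact: poweR_ge0.
  have eb : 0 < e `^ b^-1 by exact: powR_gt0.
  have hg := h _ eb; near=> x.
  have gx : (g x <= (e `^ b^-1)%:E)%E by near: x.
  have -> : e%:E = ((e `^ b^-1)%:E `^ b)%E.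
    by rewrite poweR_EFin -powRrM mulVf ?gt_eqF// powRr1// ltW.
  by apply: gt0_ler_poweR => //; rewrite ?(ltW b0)// in_itv/= leey andbT ?g0// lee_fin ltW.
split; last exact: key.
have ai : 0 < a^-1 by rewrite invr_gt0.
move=> /(key _ _ ai (fun x => poweR_ge0 _ _)); apply: cvg_trans.
by apply: near_eq_cvg; apply: nearW => x; rewrite -poweRrM mulfV ?gt_eqF// poweRe1.
Unshelve. all: by end_near. Qed.

Section domain.
Context {R : realType} {N : nat}.
Implicit Types (x y : 'rV[R]_N) (z : 'rV[R]_N * 'rV[R]_N) (k s : R).
Implicit Types (u v : 'rV[R]_N -> R).
Local Notation mu := (lebesgue_rV R N).
Local Notation mu2 := (mu \x mu)%E.
Variable p : R.
Hypothesis p1 : 1 < p.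
Let p0 : 0 < p. Proof. exact: lt_trans ltr01 p1. Qed.
Let pN0 : p != 0. Proof. by rewrite gt_eqF. Qed.
Variable Omega : set 'rV[R]_N.
Hypothesis hopen : open Omega.
Hypothesis hbnd : bounded_set Omega.

Let mOmega : measurable Omega. Proof. exact: open_measurable_rV. Qed.

Lemma bounded_radius : exists2 M, 0 < M & forall x, Omega x -> `|x| < M.
Proof.
have [M [_ HM]] := hbnd; exists (`|M| + 2) => [|x Ox]; first by rewrite ltr_wpDl.
apply: (@le_lt_trans _ _ (`|M| + 1)); last by rewrite ltrD2l ltr1n.
apply: HM => //; by rewrite (le_lt_trans (ler_norm M))// ltrDl.
Qed.

Lemma bounded_measure_lty : (mu Omega < +oo)%E.
Proof.
have [M M0 HM] := bounded_radius.
apply: (@le_lt_trans _ _ (mu [set y | `|0 - y| < M])).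
  apply: le_measure; rewrite ?inE//; first exact: measurable_subball.
  by move=> x /HM /=; rewrite sub0r normrN.
by rewrite lebesgue_rV_ball// ltry.
Qed.

(** The difference of two values of a bounded Lipschitz function is at most a
    constant times min(1, |x - y|), and it vanishes unless x or y lies in the
    domain; hence the density is dominated by the truncated kernel weighted by
    the indicator of a set of finite measure. *)
Lemma test_function_Gp_lty k u : 0 < k < 1 -> test_function Omega u ->
  (Gp p k u < +oo)%E.
Proof.
move=> k01 tu; have [C C0 HC] := lker_weight_bound (N := N) p1 k01.
have [M M0 HM] := test_function_bounded tu.
have [L L0 HL] := test_function_lip tu.
pose D := Num.max (2 * M) L.
have D0 : 0 <= D by rewrite le_max L0 orbT.
have mI : measurable_fun setT (\1_Omega : 'rV[R]_N -> R) by exact: measurable_indic.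
have I0 x : 0 <= \1_Omega x :> R by rewrite indicE ler0n.
have mlI : measurable_fun setT (fun z => (\1_Omega z.1 + \1_Omega z.2) * lker p k z).
  apply: measurable_funM; last exact: measurable_lker.
  apply: measurable_funD.
    exact: (measurableT_comp mI measurable_fst).
  exact: (measurableT_comp mI measurable_snd).
have lI0 z : 0 <= (\1_Omega z.1 + \1_Omega z.2) * lker p k z.
  by rewrite mulr_ge0 ?lker_ge0// addr_ge0.
have mu_ := test_function_measurable tu.
have hd z : `|u z.1 - u z.2| <= D * Num.min 1 (enorm (z.1 - z.2)).
  rewrite /Num.min; case: ifPn => _.
    rewrite mulr1 le_max; apply/orP; left.
    apply: (le_trans (ler_normB _ _)); have := HM z.1; have := HM z.2; lra.
  apply: (le_trans (HL _ _)); apply: (@le_trans _ _ (L * enorm (z.1 - z.2))).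
    by apply: ler_wpM2l => //; exact: normr_le_enorm.
  by apply: ler_wpM2r; [exact: enorm_ge0|rewrite le_max lexx orbT].
have m0 z : 0 <= Num.min 1 (enorm (z.1 - z.2)) by rewrite le_min ler01 enorm_ge0.
have pw1 z : gint p k u z <= D `^ p * lker p k z.
  rewrite /gint /lker mulrA; apply: ler_wpM2r; first exact: rker_ge0.
  apply: (le_trans (le_powRp p1 (normr_ge0 _) (hd z))).
  rewrite powRM//; apply: ler_wpM2l; first exact: powR_ge0.
  rewrite le_min; apply/andP; split; last first.
    by apply: le_powRp => //; rewrite ge_min lexx orbT.
  have := le_powRp p1 (m0 z) (_ : _ <= 1); rewrite powR1; apply.
  by rewrite ge_min lexx.
have pw z : gint p k u z <= D `^ p * ((\1_Omega z.1 + \1_Omega z.2) * lker p k z).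
  have [z12|z12] := pselect (Omega z.1 \/ Omega z.2).
    apply: (le_trans (pw1 z)); apply: ler_wpM2l; first exact: powR_ge0.
    rewrite ler_peMl ?lker_ge0//; case: z12 => zO.
      by rewrite [X in X + _]indicE mem_set// lerDl.
    by rewrite [X in _ + X]indicE mem_set// lerDr.
  rewrite /gint !(test_function_support tu); first last.
  - by move=> zO; apply: z12; left.
  - by move=> zO; apply: z12; right.
  by rewrite subrr normr0 powR0// mul0r mulr_ge0 ?powR_ge0.
apply: (@le_lt_trans _ _ ((D `^ p)%:E * (C%:E * \int[mu]_x (\1_Omega x)%:E))%E).
  apply: le_trans (lee_wpmul2l _ (HC _ mI I0)); last by rewrite lee_fin powR_ge0.
  rewrite GpE// -ge0_integralZl_EFin ?powR_ge0//; last 2 first.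
  - by move=> z _; rewrite lee_fin.
  - exact/measurable_EFinP.
  apply: ge0_le_integral => //.
  - by move=> z _; rewrite lee_fin gint_ge0.
  - by apply/measurable_EFinP; exact: measurable_gint.
  - by apply: measurable_funeM; exact/measurable_EFinP.
  by move=> z _; rewrite -EFinM lee_fin; exact: pw.
rewrite integral_indic// setIT muleA -EFinM.
by rewrite lte_mul_pinfty ?lee_fin ?mulr_ge0 ?powR_ge0//; exact: bounded_measure_lty.
Qed.

(** Pairs (x, y) with x in the domain and y in a unit box B disjoint from it
    already suffice: there u(y) = 0, and the distance from x to y is bounded,
    so that the kernel is bounded below. *)
Lemma poincare s : (1 <= N)%N -> 0 < s -> exists2 c : R, 0 < c &
  forall u, measurable_fun setT u -> {ae mu, forall x, ~ Omega x -> u x = 0} ->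
  (c%:E * pint mu p u <= Gp p s u)%E.
Proof.
move=> N1 s0; have [M M0 HM] := bounded_radius.
(* The domain lies in the sup ball of radius M and B in that of radius M + 2,
   and the Euclidean norm is at most N times the sup norm, so D bounds the
   distance between their points. *)
pose D : R := N%:R * (2 * M + 2).
have NR : (1 : R) <= N%:R by rewrite ler1n.
have D0 : 0 < D by rewrite mulr_gt0 ?(lt_le_trans ltr01)//; lra.
have a0 := rker_expnt_gt0 (N := N) p1 s0.
pose c := (D `^ (N%:R + s * p))^-1.
have c0 : 0 < c by rewrite invr_gt0 powR_gt0.
pose B := [set y : 'rV[R]_N | forall i, `[M + 1, M + 2]%classic (y ord0 i)].
have mB : measurable B.
  by apply: (@measurable_coord_set _ _ (fun _ => `[M + 1, M + 2]%classic)) => i.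
have B1 : mu B = 1%E.
  rewrite (@lebesgue_rV_box R N (fun=> `[M + 1, M + 2]%classic))//.
  rewrite big1// => i _; rewrite lebesgue_measure_itv/= lte_fin ltrD2l ltr1n.
  by rewrite -EFinD; congr EFin; lra.
have Bnorm y : B y -> M + 1 <= `|y| <= M + 2.
  move=> By; apply/andP; split.
    have := By (Ordinal N1); rewrite /= in_itv/= => /andP[h _].
    apply: (le_trans h); apply: (le_trans (ler_norm _)); exact: normr_coord.
  apply: normr_le => [|i]; first by lra.
  have := By i; rewrite /= in_itv/= => /andP[h1 h2].
  by rewrite ger0_norm//; lra.
have BO y : B y -> ~ Omega y.
  by move=> /Bnorm/andP[h _] /HM; rewrite ltNge; apply/negP/negPn; lra.
exists c => // u mu_ u0.
pose v x := u x * \1_Omega x.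
have mI : measurable_fun setT (\1_Omega : 'rV[R]_N -> R) by exact: measurable_indic.
have mv : measurable_fun setT v by exact: measurable_funM.
have uv : {ae mu, forall x, u x = v x}.
  apply: filterS u0 => x ux; rewrite /v indicE.
  have [xO|xO] := pselect (Omega x); first by rewrite mem_set// mulr1.
  by rewrite memNset// mulr0 ux.
have v0 x : ~ Omega x -> v x = 0.
  by move=> xO; rewrite /v indicE memNset// mulr0.
rewrite (pint_ae_eq p mu_ mv uv) (Gp_ae_eq p s mu_ mv uv).
have mvp := measurable_norm_powR p mv.
have -> : (c%:E * pint mu p v = \int[mu2]_z ((`|v z.1| `^ p * c) * \1_B z.2)%:E)%E.
  rewrite fubini_tonelli1/=; last 2 first.
  - apply/measurable_EFinP; apply: measurable_funM.
      apply: measurable_funM => //; exact: (measurableT_comp mvp measurable_fst).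
    by apply: (measurableT_comp _ measurable_snd); exact: measurable_indic.
  - by move=> z; rewrite lee_fin mulr_ge0 ?indicE ?ler0n// mulr_ge0 ?powR_ge0// ltW.
  rewrite pint.unlock -ge0_integralZl_EFin ?(ltW c0)//; last exact/measurable_EFinP.
  apply: eq_integral => x _; rewrite /fubini_F /= integral_indicZ//.
    by rewrite -[mu B]/((mu : set _ -> \bar R) B) B1 mule1 -EFinM mulrC.
  by rewrite mulr_ge0 ?powR_ge0// ltW.
rewrite GpE//; apply: ge0_le_integral => //.
- by move=> z _; rewrite lee_fin mulr_ge0 ?indicE ?ler0n// mulr_ge0 ?powR_ge0// ltW.
- apply/measurable_EFinP; apply: measurable_funM.
    apply: measurable_funM => //; exact: (measurableT_comp mvp measurable_fst).
  by apply: (measurableT_comp _ measurable_snd); exact: measurable_indic.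
- by apply/measurable_EFinP; exact: measurable_gint.
move=> [x y] _; rewrite lee_fin /gint/= indicE.
have [yB|yB] := boolP (y \in B); last first.
  by rewrite mulr0 mulr_ge0 ?powR_ge0 ?rker_ge0.
rewrite mulr1; rewrite inE in yB.
have [xO|xO] := pselect (Omega x); last first.
  by rewrite (v0 x)// normr0 powR0// mul0r mulr_ge0 ?powR_ge0 ?rker_ge0.
rewrite (v0 y) ?subr0; last exact: BO.
apply: ler_wpM2l; first exact: powR_ge0.
have /andP[y1 y2] := Bnorm _ yB; have xM := HM _ xO.
have xy0 : 0 < `|x - y|.
  by have := lerB_dist y x; rewrite distrC; lra.
have e0 : 0 < enorm (x - y) by apply: lt_le_trans (normr_le_enorm _).
rewrite rker.unlock /c /= lef_pV2 ?posrE ?powR_gt0//.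
apply: ge0_ler_powR; rewrite ?nnegrE ?(ltW e0) ?(ltW D0) ?(ltW a0)//.
apply: (le_trans (enorm_le _)); rewrite /D ler_wpM2l//.
by have := ler_normB x y; lra.
Qed.

Lemma W0P s u : 0 < s -> W0 s p Omega u <->
  [/\ measurable_fun setT u, {ae mu, forall x, ~ Omega x -> u x = 0} &
    forall e : R, 0 < e -> exists2 phi, test_function Omega phi &
      (Gp p s (phi \- u)%R <= e%:E)%E].
Proof.
move=> s0; split=> [[mu_ u0 [phi tphi]]|[mu_ u0 happ]]; last first.
  split => //.
  have hn n : 0 < n.+1%:R^-1 :> R by rewrite invr_gt0.
  have /choice[phi Hphi] : forall n : nat, exists phi, test_function Omega phi /\
      (Gp p s (phi \- u)%R <= (n.+1%:R^-1)%:E)%E.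
    by move=> n; have [phi h1 h2] := happ _ (hn n); exists phi.
  exists phi; first by move=> n; have [] := Hphi n.
  have mp n : measurable_fun setT (phi n \- u).
    by apply: measurable_funB => //; have [/test_function_measurable] := Hphi n.
  under eq_fun do rewrite gagliardoE//.
  apply/cvge0_poweR => [|n|]; [by rewrite invr_gt0|exact: Gp_ge0|].
  apply/cvge0P => [n|e e0]; first exact: Gp_ge0.
  near=> n; have [_ h] := Hphi n; apply: (le_trans h); rewrite lee_fin.
  by apply: ltW; near: n; exact: (near_infty_natSinv_lt (PosNum e0)).
have mp n : measurable_fun setT (phi n \- u).
  by apply: measurable_funB => //; exact: test_function_measurable (tphi n).
under eq_fun do rewrite gagliardoE//.
move=> /cvge0_poweR h; split => // e e0.
have := h _ (fun n => Gp_ge0 _ _ _); rewrite invr_gt0 => /(_ p0).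
move=> /cvge0P H.
have [n _ hn] := H (fun n => Gp_ge0 _ _ _) e e0.
by exists (phi n) => //; apply: hn => /=.
Unshelve. all: by end_near. Qed.

End domain.

(** * The space of finite energy and first eigenpairs *)

Section eigenvalue.
Context {R : realType} {N : nat}.
Hypothesis N1 : (1 <= N)%N.
Implicit Types (x y : 'rV[R]_N) (k s : R).
Implicit Types (u v w f g : 'rV[R]_N -> R).
Local Notation mu := (lebesgue_rV R N).
Local Notation mu2 := (mu \x mu)%E.
Variable p : R.
Hypothesis p1 : 1 < p.
Let p0 : 0 < p. Proof. exact: lt_trans ltr01 p1. Qed.
Let pN0 : p != 0. Proof. by rewrite gt_eqF. Qed.
Variable Omega : set 'rV[R]_N.
Hypothesis hopen : open Omega.
Hypothesis hbnd : bounded_set Omega.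
Let mOmega : measurable Omega. Proof. exact: open_measurable_rV. Qed.
Local Notation W0 s := (W0 s p Omega).
Local Notation P u := (pint mu p u).
Local Notation G s u := (Gp p s u).

Lemma dqB s f g : dq p s (f \- g) = (fun z => dq p s f z - dq p s g z).
Proof. by apply/funext => z; rewrite /dq/=; ring. Qed.

Lemma dq_half s f g :
  dq p s (fun x => (f x + g x) / 2) = (fun z => (dq p s f z + dq p s g z) / 2).
Proof. by apply/funext => z; rewrite /dq/=; field. Qed.

Lemma GpZ s c f : measurable_fun setT f ->
  (G s (fun x => c * f x)%R = (`|c| `^ p)%:E * G s f)%E.
Proof.
move=> mf; rewrite /Gp -pintZ//; last exact: measurable_dq.
by congr (pint _ _ _); apply/funext => z; rewrite /dq; ring.
Qed.

Lemma GpBC s f g : G s (f \- g) = G s (g \- f).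
Proof. by rewrite /Gp !dqB pintBC. Qed.

Lemma Gp_triangle : exists2 C : R, 0 < C & forall s f g,
  measurable_fun setT f -> measurable_fun setT g ->
  (G s (f \- g)%R <= C%:E * (G s f + G s g))%E.
Proof.
have [C C0 HC] := pint_triangle mu2 p1.
exists C => // s f g mf mg; rewrite /Gp dqB.
by apply: HC; exact: measurable_dq.
Qed.

Lemma Gp_triangle2 : exists2 C : R, 0 < C & forall s f g h,
  measurable_fun setT f -> measurable_fun setT g -> measurable_fun setT h ->
  (G s (f \- h)%R <= C%:E * (G s (f \- g)%R + G s (g \- h)%R))%E.
Proof.
have [C C0 HC] := Gp_triangle; exists C => // s f g h mf mg mh.
have -> : f \- h = (f \- g) \- (h \- g) by apply/funext => x /=; ring.
by rewrite (GpBC s g h); apply: HC; exact: measurable_funB.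
Qed.

Lemma Gp_continuous s f (L eta : R) : measurable_fun setT f -> G s f = L%:E ->
  0 < eta -> exists2 d : R, 0 < d & forall g, measurable_fun setT g ->
  (G s (g \- f)%R <= d%:E)%E -> ((L - eta)%:E <= G s g)%E /\ (G s g <= (L + eta)%:E)%E.
Proof.
move=> mf fL eta0; have mqf := measurable_dq p s mf.
have [d d0 Hd] := pint_continuous p1 mqf fL eta0; exists d => // g mg.
by rewrite /Gp dqB; apply: Hd; exact: measurable_dq.
Qed.

Lemma Gp0 s : G s (fun _ : 'rV[R]_N => 0) = 0%E.
Proof.
rewrite GpE//; apply: integral0_eq => z _; rewrite /gint subrr normr0 powR0//.
by rewrite mul0r.
Qed.

Lemma test_function_ae0 phi : test_function Omega phi ->
  {ae mu, forall x, ~ Omega x -> phi x = 0}.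
Proof. by move=> tphi; apply: aeW => x; exact: test_function_support. Qed.

Lemma W0_test s phi : 0 < s -> test_function Omega phi -> W0 s phi.
Proof.
move=> s0 tphi; apply/W0P => //; split.
- exact: test_function_measurable tphi.
- exact: test_function_ae0.
- move=> e e0; exists phi => //.
  by rewrite (_ : phi \- phi = fun=> 0) ?Gp0 ?lee_fin ?ltW//; apply/funext => x /=; rewrite subrr.
Qed.

Lemma W0_measurable s u : W0 s u -> measurable_fun setT u.
Proof. by case. Qed.

Lemma W0_ae0 s u : W0 s u -> {ae mu, forall x, ~ Omega x -> u x = 0}.
Proof. by case. Qed.

(** Test functions close to elements that are close to v are close to v. *)
Lemma W0_closed s v : 0 < s -> measurable_fun setT v ->
  {ae mu, forall x, ~ Omega x -> v x = 0} ->
  (forall e : R, 0 < e -> exists2 u, W0 s u & (G s (u \- v)%R <= e%:E)%E) ->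
  W0 s v.
Proof.
move=> s0 mv v0 happ; apply/W0P => //; split => // e e0.
have [C C0 HC] := Gp_triangle2.
have eC : 0 < e / (2 * C) by rewrite divr_gt0// mulr_gt0.
have [u wu hu] := happ _ eC.
have /W0P-/(_ p1 s0)[mu_ u0 /(_ _ eC)[phi tphi hphi]] := wu.
exists phi => //; apply: (le_trans (HC s phi u v _ _ _)) => //.
  exact: test_function_measurable tphi.
apply: (@le_trans _ _ (C%:E * ((e / (2 * C))%:E + (e / (2 * C))%:E))%E).
  by apply: lee_wpmul2l; [rewrite lee_fin ltW|exact: leeD].
rewrite -EFinD -EFinM lee_fin le_eqVlt; apply/orP; left; apply/eqP.
by field; rewrite gt_eqF.
Qed.

Lemma W0_Gp_lty s u : 0 < s < 1 -> W0 s u -> (G s u < +oo)%E.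
Proof.
move=> s01 wu; have /andP[s0 _] := s01.
have /W0P-/(_ p1 s0)[mu_ u0 /(_ _ ltr01)[phi tphi hphi]] := wu.
have [C C0 HC] := Gp_triangle.
have mphi := test_function_measurable tphi.
have -> : u = phi \- (phi \- u) by apply/funext => x /=; ring.
apply: le_lt_trans (HC s _ _ _ _) _ => //; first exact: measurable_funB.
rewrite lte_mul_pinfty ?lee_fin ?(ltW C0)// lte_add_pinfty//.
  exact: (test_function_Gp_lty p1 hopen hbnd s01 tphi).
by apply: le_lt_trans hphi _; rewrite ltry.
Qed.

Lemma W0_lincomb s a b u v : 0 < s -> W0 s u -> W0 s v ->
  W0 s (fun x => a * u x + b * v x).
Proof.
move=> s0 /W0P-/(_ p1 s0)[mu_ u0 hu] /W0P-/(_ p1 s0)[mv v0 hv].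
have mlin f g : measurable_fun setT f -> measurable_fun setT g ->
    measurable_fun setT (fun x : 'rV[R]_N => a * f x + b * g x).
  by move=> mf mg; apply: measurable_funD; apply: measurable_funM.
apply/W0P => //; split; first exact: mlin.
  by apply: filterS2 u0 v0 => x ux vx xO; rewrite ux// vx// !mulr0 addr0.
move=> e e0; have [C C0 HC] := Gp_triangle.
pose A := `|a| `^ p; pose B := `|- b| `^ p.
have A0 : 0 <= A by exact: powR_ge0.
have B0 : 0 <= B by exact: powR_ge0.
have d0 : 0 < e / (C * (A + B + 1)).
  by rewrite divr_gt0// mulr_gt0// ltr_wpDl// addr_ge0.
have [phi tphi hphi] := hu _ d0; have [psi tpsi hpsi] := hv _ d0.
have mphi := test_function_measurable tphi.
have mpsi := test_function_measurable tpsi.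
exists (fun x => a * phi x + b * psi x); first exact: test_function_lincomb.
have mfu := measurable_funB mphi mu_; have mgv := measurable_funB mpsi mv.
have -> : (fun x => a * phi x + b * psi x) \- (fun x => a * u x + b * v x) =
    (fun x => a * (phi \- u) x) \- (fun x => - b * (psi \- v) x).
  by apply/funext => x /=; ring.
apply: (le_trans (HC s _ _ _ _)); [exact: measurable_funM|exact: measurable_funM|].
rewrite !GpZ// -/A -/B.
set d := e / _ in hphi hpsi d0.
apply: (@le_trans _ _ (C%:E * (A%:E * d%:E + B%:E * d%:E))%E).
  apply: lee_wpmul2l; first by rewrite lee_fin ltW.
  by apply: leeD; apply: lee_wpmul2l; rewrite ?lee_fin.
rewrite -!EFinM lee_fin -mulrDl mulrA.
rewrite /d mulrA ler_pdivrMr ?mulr_gt0//; last by rewrite ltr_wpDl// addr_ge0.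
by rewrite mulrC; apply: ler_wpM2l; [exact: ltW|apply: ler_wpM2l; [exact: ltW|rewrite lerDl]].
Qed.

Lemma W0_scale s c u : 0 < s -> W0 s u -> W0 s (fun x => c * u x).
Proof.
move=> s0 wu; have := W0_lincomb c 0 s0 wu wu.
by rewrite (_ : (fun x => _ + _) = fun x => c * u x)//; apply/funext => x; rewrite mul0r addr0.
Qed.

Lemma W0_half s u v : 0 < s -> W0 s u -> W0 s v -> W0 s (fun x => (u x + v x) / 2).
Proof.
move=> s0 wu wv; have := W0_lincomb 2^-1 2^-1 s0 wu wv.
by rewrite (_ : (fun x => _ + _) = fun x => (u x + v x) / 2)//; apply/funext => x; lra.
Qed.

Lemma pint_lty s u : 0 < s < 1 -> W0 s u -> (P u < +oo)%E.
Proof.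
move=> s01 wu; have /andP[s0 _] := s01.
have [c c0 Hc] := poincare p1 hopen hbnd N1 s0.
have h := Hc _ (W0_measurable wu) (W0_ae0 wu).
have : (c%:E * P u < +oo)%E by apply: le_lt_trans h _; exact: W0_Gp_lty.
have := pint_ge0 mu p u; case: (P u) => [r _ _|_|//]; first by rewrite ltry.
by rewrite gt0_muley// lte_fin.
Qed.

(** Approximating test functions at the order k also approximate at the order
    s: their difference with u vanishes off the domain, so the L^p term of the
    embedding is absorbed by the Poincare inequality. *)
Lemma W0_mono s k u : 0 < s < 1 -> s <= k -> W0 k u -> W0 s u.
Proof.
move=> s01 sk wu; have /andP[s0 _] := s01; have k0 := lt_le_trans s0 sk.
have /W0P-/(_ p1 k0)[mu_ u0 happ] := wu.
have [c c0 Hc] := poincare p1 hopen hbnd N1 k0.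
have [C C0 HC] := Gp_embedding (N := N) p1 s01.
apply/W0P => //; split => // e e0.
have d0 : 0 < e / (1 + C / c) by rewrite divr_gt0// ltr_wpDr// divr_ge0// ltW.
have [phi tphi hphi] := happ _ d0; exists phi => //.
have mw : measurable_fun setT (phi \- u).
  by apply: measurable_funB => //; exact: test_function_measurable tphi.
have w0 : {ae mu, forall x, ~ Omega x -> (phi \- u) x = 0}.
  by apply: filterS2 (test_function_ae0 tphi) u0 => x h1 h2 xO /=; rewrite h1// h2// subrr.
have h1 := HC _ _ sk mw; have h2 := Hc _ mw w0.
have h3 : (P (phi \- u)%R <= (c^-1)%:E * G k (phi \- u)%R)%E.
  have := lee_wpmul2l (x := (c^-1)%:E) _ h2.
  by rewrite lee_fin invr_ge0 (ltW c0) muleA -EFinM mulVf ?gt_eqF// mul1e => /(_ isT).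
apply: (le_trans h1).
apply: (@le_trans _ _ ((1 + C / c)%:E * G k (phi \- u)%R)%E).
  rewrite EFinD ge0_muleDl ?lee_fin ?divr_ge0 ?(ltW c0)// mul1e leeD2l//.
  by rewrite EFinM -muleA; apply: lee_wpmul2l; rewrite ?lee_fin.
apply: (@le_trans _ _ ((1 + C / c)%:E * (e / (1 + C / c))%:E)%E).
  by apply: lee_wpmul2l => //; rewrite lee_fin addr_ge0// divr_ge0// ltW.
by rewrite -EFinM lee_fin mulrC divfK// gt_eqF// ltr_wpDr// divr_ge0// ltW.
Qed.

Lemma Lp_normE u : measurable_fun setT u ->
  {ae mu, forall x, ~ Omega x -> u x = 0} ->
  Lp_norm p Omega u = (P u `^ p^-1)%E.
Proof.
move=> mu_ u0; rewrite /Lp_norm Lnorm.unlock; congr poweR.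
have muO : measurable_fun setT (u \_ Omega).
  by apply/(measurable_restrictT _ mOmega); exact: measurable_funTS.
have -> : P u = P (u \_ Omega).
  apply: pint_ae_eq => //; apply: filterS u0 => x ux.
  rewrite patchE; case: ifPn => // /negP xO; rewrite ux// => /mem_set; exact: xO.
by rewrite pint.unlock; apply: eq_integral => x _ /=.
Qed.

Lemma admissibleP s u : admissible s p Omega u <->
  [/\ W0 s u, P u = 1%E & {ae mu, forall x, 0 <= u x}].
Proof.
split=> -[wu h u0]; split => //; move: h; rewrite (Lp_normE (W0_measurable wu) (W0_ae0 wu)).
  move=> /(congr1 (fun e : \bar R => (e `^ p)%E)); rewrite -poweRrM mulVf// poweRe1 ?pint_ge0//.
  by rewrite poweR_EFin powR1.
by move=> ->; rewrite poweR_EFin powR1.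
Qed.

(** The last clause is the minimality of L in homogeneous form, convenient for
    competitors that are not normalized. *)
Definition eigenpair s (L : R) u := [/\ W0 s u, P u = 1%E,
  {ae mu, forall x, 0 <= u x}, G s u = L%:E &
  forall w, W0 s w -> {ae mu, forall x, 0 <= w x} -> (L%:E * P w <= G s w)%E].

(** A competitor of positive norm is normalized; for one of norm zero the
    inequality is trivial. *)
Lemma first_eigenfunctionP s u : 0 < s < 1 -> first_eigenfunction s p Omega u ->
  exists2 L, 0 <= L & eigenpair s L u.
Proof.
move=> s01 [/admissibleP[wu Pu u0] hinf]; have /andP[s0 _] := s01.
have Gfin := W0_Gp_lty s01 wu.
have GE : G s u = (fine (G s u))%:E by rewrite fineK// ge0_fin_numE// Gp_ge0.
exists (fine (G s u)); first by rewrite fine_ge0// Gp_ge0.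
split => // w ww w0; rewrite -GE.
rewrite gagliardoX// in hinf; last exact: W0_measurable wu.
have mw := W0_measurable ww.
have [Pw0|Pw0] := eqVneq (P w) 0%E; first by rewrite Pw0 mule0 Gp_ge0.
have Pwfin : P w \is a fin_num by rewrite ge0_fin_numE ?pint_ge0//; exact: pint_lty ww.
have Pwgt : (0 < P w)%E by rewrite lt_neqAle eq_sym Pw0 pint_ge0.
have m0 : 0 < fine (P w) by rewrite fine_gt0// Pwgt -ge0_fin_numE ?pint_ge0.
have PwE : P w = (fine (P w))%:E by rewrite fineK.
pose c := fine (P w) `^ (- p^-1).
have cp : `|c| `^ p = (fine (P w))^-1.
  by rewrite ger0_norm ?powR_ge0// -powRrM mulNr mulVf// powR_inv1// ltW.
have adm : admissible s p Omega (fun x => c * w x).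
  apply/admissibleP; split.
  - exact: W0_scale.
  - by rewrite pintZ// cp {2}PwE -EFinM mulVf// gt_eqF.
  - by apply: filterS w0 => x wx; rewrite mulr_ge0// powR_ge0.
have : (G s u <= G s (fun x => c * w x)%R)%E.
  rewrite hinf; apply: ereal_inf_lbound; exists (fun x => c * w x) => //.
  by rewrite gagliardoX//; exact: measurable_funM.
rewrite GpZ// cp => /(lee_wpmul2r (x := P w)) => /(_ (pint_ge0 _ _ _)) h.
apply: (le_trans h); rewrite {2}PwE -muleA muleC -muleA -EFinM mulfV ?mule1//.
by rewrite gt_eqF.
Qed.

End eigenvalue.

(** * Smoothed power means of test functions *)

Section approximation.
Context {R : realType} {N : nat}.
Implicit Types (x y : 'rV[R]_N) (k s : R).
Implicit Types (u v w f g : 'rV[R]_N -> R).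
Local Notation mu := (lebesgue_rV R N).
Variable p : R.
Hypothesis p1 : 1 < p.
Let p0 : 0 < p. Proof. exact: lt_trans ltr01 p1. Qed.
Let pN0 : p != 0. Proof. by rewrite gt_eqF. Qed.
Variable Omega : set 'rV[R]_N.
Hypothesis hopen : open Omega.
Let mOmega : measurable Omega. Proof. exact: open_measurable_rV. Qed.
Local Notation P u := (pint mu p u).

Lemma measurable_pmean u v : measurable_fun setT u -> measurable_fun setT v ->
  measurable_fun setT (fun x => pmean p (u x) (v x)).
Proof.
move=> mu_ mv; rewrite pmean.unlock.
have mpow (q : R) f : measurable_fun setT f -> measurable_fun setT (fun x : 'rV[R]_N => f x `^ q).
  move=> mf; apply: (@measurableT_comp _ _ _ _ _ _ (fun x : R => x `^ q)).
    exact: measurable_powR.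
  exact: mf.
by apply: (mpow _ _); apply: measurable_funM => //; apply: measurable_funD; exact: mpow.
Qed.

(** Hidden convexity, for the smoothed mean. *)
Lemma gint_spmean k e u v z : 0 < e ->
  gint p k (fun x => spmean p e (u x) (v x)) z <= (gint p k u z + gint p k v z) / 2.
Proof.
move=> e0; rewrite /gint -mulrDl mulrAC; apply: ler_wpM2r; first exact: rker_ge0.
exact: spmean_lip.
Qed.

(** Outside the domain both means vanish. Inside, replacing the smoothed
    moduli by the moduli costs at most e, and the power mean is Lipschitz; the
    domain has finite measure. *)
Lemma pint_spmean_close e phi psi u v : 0 < e ->
  test_function Omega phi -> test_function Omega psi ->
  measurable_fun setT u -> measurable_fun setT v ->
  {ae mu, forall x, ~ Omega x -> u x = 0} ->
  {ae mu, forall x, ~ Omega x -> v x = 0} ->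
  {ae mu, forall x, 0 <= u x} -> {ae mu, forall x, 0 <= v x} ->
  (P (fun x => spmean p e (phi x) (psi x) - pmean p (u x) (v x))%R <=
   (2 `^ p)%:E * ((e `^ p)%:E * mu Omega + 2^-1%:E * (P (phi \- u)%R + P (psi \- v)%R)))%E.
Proof.
move=> e0 tphi tpsi mu_ mv u0 v0 up vp.
have mphi := test_function_measurable tphi; have mpsi := test_function_measurable tpsi.
have msp := test_function_measurable (test_function_spmean e0 p1 tphi tpsi).
have mI : measurable_fun setT (\1_Omega : 'rV[R]_N -> R) by exact: measurable_indic.
pose D x := 2^-1 * `|phi x - u x| `^ p + 2^-1 * `|psi x - v x| `^ p.
have mfu : measurable_fun setT (fun x => phi x - u x) by exact: measurable_funB.
have mgv : measurable_fun setT (fun x => psi x - v x) by exact: measurable_funB.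
have mD : measurable_fun setT D.
  by apply: measurable_funD; apply: measurable_funM => //; exact: measurable_norm_powR.
have D0 x : 0 <= D x by rewrite addr_ge0// mulr_ge0 ?powR_ge0.
have meI : measurable_fun setT (fun x : 'rV[R]_N => e `^ p * \1_Omega x).
  exact: measurable_funM.
have eI0 x : 0 <= e `^ p * \1_Omega x by rewrite mulr_ge0 ?powR_ge0// indicE ler0n.
have -> : ((2 `^ p)%:E * ((e `^ p)%:E * mu Omega + 2^-1%:E * (P (phi \- u)%R + P (psi \- v)%R)) =
    \int[mu]_x (2 `^ p * (e `^ p * \1_Omega x + D x))%:E)%E.
  under eq_integral do rewrite EFinM.
  rewrite ge0_integralZl_EFin ?powR_ge0//; last 2 first.
  - by move=> x _; rewrite lee_fin addr_ge0.
  - by apply/measurable_EFinP; exact: measurable_funD.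
  under eq_integral do rewrite EFinD.
  rewrite ge0_integralD//; last 4 first.
  - by move=> x _; rewrite lee_fin.
  - exact/measurable_EFinP.
  - by move=> x _; rewrite lee_fin.
  - exact/measurable_EFinP.
  rewrite integral_indicZ ?powR_ge0// pint_lincomb//.
  by congr (_ * (_ + _))%E; rewrite ge0_muleDr ?pint_ge0.
rewrite pint.unlock; apply: ae_ge0_le_integral => //.
- apply/measurable_EFinP; apply: measurable_norm_powR; apply: measurable_funB => //.
  exact: measurable_pmean.
- by move=> x _; rewrite lee_fin mulr_ge0 ?powR_ge0// addr_ge0.
- by apply/measurable_EFinP; apply: measurable_funM => //; exact: measurable_funD.
near=> x => _; rewrite lee_fin.
have ux : ~ Omega x -> u x = 0 by near: x; exact: u0.
have vx : ~ Omega x -> v x = 0 by near: x; exact: v0.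
have upx : 0 <= u x by near: x; exact: up.
have vpx : 0 <= v x by near: x; exact: vp.
have [xO|xO] := pselect (Omega x); last first.
  rewrite (test_function_support tphi xO) (test_function_support tpsi xO) ux// vx// spmean0 ?(ltW e0)// pmeanxx//.
  by rewrite subrr normr0 powR0// mulr_ge0 ?powR_ge0// addr_ge0.
rewrite indicE mem_set// mulr1.
set a := spmean _ _ _ _; set b := pmean p (u x) (v x).
pose c := pmean p `|phi x| `|psi x|.
have -> : a - b = (a - c) - (b - c) by ring.
apply: (le_trans (powR_normB_le p1 _ _)); apply: ler_wpM2l; first exact: powR_ge0.
apply: lerD; first by apply: le_powRp => //; apply: spmean_approx => //; exact: ltW.
rewrite distrC; have [+ _] := pmeanB p1 (normr_ge0 (phi x)) (normr_ge0 (psi x)) upx vpx.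
move=> /le_trans; apply; rewrite /D -mulrDr mulrC; apply: ler_wpM2l; first by rewrite invr_ge0.
apply: lerD; apply: le_powRp => //.
  by rewrite -[X in `|_ - X|](ger0_norm upx); exact: ler_dist_dist.
by rewrite -[X in `|_ - X|](ger0_norm vpx); exact: ler_dist_dist.
Unshelve. all: by end_near. Qed.

End approximation.

(** * Eigenfunctions of order k as minimizers of order s *)

Section limsup.
Context {R : realType} {N : nat}.
Hypothesis N1 : (1 <= N)%N.
Implicit Types (x y : 'rV[R]_N) (k s : R).
Implicit Types (v w f g : 'rV[R]_N -> R).
Local Notation mu := (lebesgue_rV R N).
Local Notation mu2 := (mu \x mu)%E.
Variable p : R.
Hypothesis p1 : 1 < p.
Let p0 : 0 < p. Proof. exact: lt_trans ltr01 p1. Qed.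
Let pN0 : p != 0. Proof. by rewrite gt_eqF. Qed.
Variable Omega : set 'rV[R]_N.
Hypothesis hopen : open Omega.
Hypothesis hbnd : bounded_set Omega.
Let mOmega : measurable Omega. Proof. exact: open_measurable_rV. Qed.
Local Notation W0 s := (W0 s p Omega).
Local Notation P u := (pint mu p u).
Local Notation G s u := (Gp p s u).
Local Notation eigenpair := (eigenpair p Omega).

Lemma W0_approx s u d : 0 < s -> 0 < d -> W0 s u -> exists phi,
  [/\ test_function Omega phi, (G s (phi \- u)%R <= d%:E)%E & (P (phi \- u)%R <= d%:E)%E].
Proof.
move=> s0 d0 wu; have [c c0 Hc] := poincare p1 hopen hbnd N1 s0.
have cd0 : 0 < Num.min d (c * d) by rewrite lt_min d0 mulr_gt0.
have /W0P-/(_ p1 s0)[mu_ u0 /(_ _ cd0)[phi tphi hphi]] := wu.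
have mw : measurable_fun setT (phi \- u).
  by apply: measurable_funB => //; exact: test_function_measurable tphi.
have w0 : {ae mu, forall x, ~ Omega x -> (phi \- u) x = 0}.
  by apply: filterS2 (test_function_ae0 tphi) u0 => x h1 h2 xO /=; rewrite h1// h2// subrr.
exists phi; split=> //.
  by apply: (le_trans hphi); rewrite lee_fin ge_min lexx.
have : (c%:E * P (phi \- u)%R <= (c * d)%:E)%E.
  apply: (le_trans (Hc _ mw w0)); apply: (le_trans hphi).
  by rewrite lee_fin ge_min lexx orbT.
by rewrite EFinM lee_pmul2l// lte_fin.
Qed.

(** The smoothing parameter e is chosen so small that e^p times the measure of
    the domain is negligible. *)
Lemma approx_pair s u v d : 0 < s -> 0 < d -> W0 s u -> W0 s v ->
  {ae mu, forall x, 0 <= u x} -> {ae mu, forall x, 0 <= v x} ->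
  exists phi psi e, [/\ 0 < e, test_function Omega phi & test_function Omega psi] /\
    [/\ (G s (phi \- u)%R <= d%:E)%E, (G s (psi \- v)%R <= d%:E)%E,
        (P (phi \- u)%R <= d%:E)%E, (P (psi \- v)%R <= d%:E)%E &
        (P (fun x => spmean p e (phi x) (psi x) - pmean p (u x) (v x))%R <= d%:E)%E].
Proof.
move=> s0 d0 wu wv up vp.
have t0 : 0 < (2 : R) `^ p by exact: powR_gt0.
pose d' := Num.min d (d / 2 / 2 `^ p).
have d'0 : 0 < d' by rewrite lt_min d0/= !divr_gt0.
have d'd : (d'%:E <= d%:E)%E by rewrite lee_fin ge_min lexx.
have [phi [tphi gphi pphi]] := W0_approx s0 d'0 wu.
have [psi [tpsi gpsi ppsi]] := W0_approx s0 d'0 wv.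
have mfin : mu Omega \is a fin_num.
  by rewrite ge0_fin_numE//; exact: bounded_measure_lty hopen hbnd.
pose m := fine (mu Omega).
have m0 : 0 <= m by rewrite fine_ge0.
pose q := d / 2 / 2 `^ p / (m + 1).
have q0 : 0 < q by rewrite !divr_gt0// ltr_wpDl.
exists phi, psi, (q `^ p^-1); split; first by split=> //; exact: powR_gt0.
split; [exact: le_trans gphi d'd|exact: le_trans gpsi d'd|
  exact: le_trans pphi d'd|exact: le_trans ppsi d'd|].
apply: (le_trans (pint_spmean_close p1 hopen _ tphi tpsi (W0_measurable wu)
  (W0_measurable wv) (W0_ae0 wu) (W0_ae0 wv) up vp)); first exact: powR_gt0.
rewrite powRVpK// ?(ltW q0)// -(fineK mfin) -/m.
apply: (@le_trans _ _ ((2 `^ p)%:E * (q%:E * m%:E + 2^-1%:E * (d'%:E + d'%:E)))%E).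
  apply: lee_wpmul2l; first by rewrite lee_fin powR_ge0.
  by apply: leeD => //; apply: lee_wpmul2l; [rewrite lee_fin invr_ge0|exact: leeD].
rewrite -EFinD -!EFinM lee_fin.
have h1 : q * m <= d / 2 / 2 `^ p.
  rewrite /q -mulrA ger_pMr ?divr_gt0// mulrC ler_pdivrMr ?mul1r ?lerDl//.
  by rewrite ltr_wpDl.
have h2 : 2^-1 * (d' + d') <= d / 2 / 2 `^ p.
  have : d' <= d / 2 / 2 `^ p by rewrite ge_min lexx orbT.
  lra.
have -> : d = 2 `^ p * (d / 2 / 2 `^ p + d / 2 / 2 `^ p).
  by field; rewrite gt_eqF.
by apply: ler_wpM2l; [exact: ltW|exact: lerD].
Qed.

Lemma Gp_spmean k e phi psi : 0 < e -> test_function Omega phi -> test_function Omega psi ->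
  (G k (fun x => spmean p e (phi x) (psi x))%R <= 2^-1%:E * (G k phi + G k psi))%E.
Proof.
move=> e0 tphi tpsi.
have mphi := test_function_measurable tphi; have mpsi := test_function_measurable tpsi.
have msp := test_function_measurable (test_function_spmean e0 p1 tphi tpsi).
rewrite ge0_muleDr ?Gp_ge0// !GpE//.
rewrite -!ge0_integralZl_EFin//;
  try (by move=> z _; rewrite lee_fin gint_ge0);
  try (by apply/measurable_EFinP; exact: measurable_gint).
rewrite -ge0_integralD//;
  try (by move=> z _; rewrite mule_ge0 ?lee_fin ?gint_ge0);
  try (by apply: measurable_funeM; apply/measurable_EFinP; exact: measurable_gint).
apply: ge0_le_integral => //.
- by move=> z _; rewrite lee_fin gint_ge0.
- by apply/measurable_EFinP; exact: measurable_gint.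
- by apply: emeasurable_funD; apply: measurable_funeM; apply/measurable_EFinP;
    exact: measurable_gint.
move=> z _; rewrite -!EFinM -EFinD lee_fin -mulrDr mulrC; exact: gint_spmean.
Qed.

(** The smoothed power mean of two test functions near a nonnegative u is a
    nonnegative test function near pmean u u = u, and its energy is at most
    the average of theirs. *)
Lemma test_approx_eigen s L us eta : 0 < s < 1 -> 0 <= L -> eigenpair s L us -> 0 < eta ->
  exists w, [/\ test_function Omega w, forall x, 0 <= w x,
    ((1 - eta)%:E <= P w)%E & (G s w <= (L + eta)%:E)%E].
Proof.
move=> /andP[s0 s1] L0 [wu Pu up Gu _] eta0.
have mus := W0_measurable wu.
have [d1 d10 Hd1] := Gp_continuous p1 mus Gu eta0.
have [d2 d20 Hd2] := pint_continuous p1 mus Pu eta0.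
have d0 : 0 < Num.min d1 d2 by rewrite lt_min d10.
have dd1 : ((Num.min d1 d2)%:E <= d1%:E)%E by rewrite lee_fin ge_min lexx.
have dd2 : ((Num.min d1 d2)%:E <= d2%:E)%E by rewrite lee_fin ge_min lexx orbT.
have [phi [psi [e [[e0 tphi tpsi] [gphi gpsi _ _ pw]]]]] := approx_pair s0 d0 wu wu up up.
have tw := test_function_spmean e0 p1 tphi tpsi.
pose w x := spmean p e (phi x) (psi x).
have mw : measurable_fun setT w by exact: test_function_measurable tw.
exists w; split=> //.
- by move=> x; apply: spmean_ge0 => //; exact: ltW.
- suff /(Hd2 _ mw)[] : (P (fun x => w x - us x)%R <= d2%:E)%E by [].
  apply: le_trans dd2.
  rewrite (_ : pint _ _ _ = P (fun x => w x - pmean p (us x) (us x))%R)//.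
  apply: pint_ae_eq => //.
  + exact: measurable_funB.
  + by apply: measurable_funB => //; exact: measurable_pmean.
  + by apply: filterS up => x ux; rewrite pmeanxx.
- have [_ G1] := Hd1 _ (test_function_measurable tphi) (le_trans gphi dd1).
  have [_ G2] := Hd1 _ (test_function_measurable tpsi) (le_trans gpsi dd1).
  apply: (le_trans (Gp_spmean s e0 tphi tpsi)).
  apply: (@le_trans _ _ (2^-1%:E * ((L + eta)%:E + (L + eta)%:E))%E).
    by apply: lee_wpmul2l; [rewrite lee_fin invr_ge0|exact: leeD].
  by rewrite -EFinD -EFinM lee_fin; lra.
Qed.

(** The eigenvalue of order k is tested with a fixed test function w close to
    the eigenfunction of order s. By convexity the energy of order k of w is
    at most a weighted mean of those of orders s and k1 > s; the weight of the
    latter tends to 0. *)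
Lemma eigenvalue_limsup s L us e : 0 < s < 1 -> 0 <= L -> eigenpair s L us -> 0 < e ->
  \forall k \near s^'+, k < 1 /\
    forall Lk v, 0 <= Lk -> eigenpair k Lk v -> Lk <= L + e.
Proof.
move=> s01 L0 eigs e0; have /andP[s0 s1] := s01.
have B0 : 0 < 2 + L + e by lra.
pose eta := e / (2 + L + e).
have eta0 : 0 < eta by rewrite divr_gt0.
have etaB : eta * (2 + L + e) = e by rewrite /eta divfK// gt_eqF.
have eta1 : eta < 1 by rewrite ltr_pdivrMr//; lra.
have etaL : L + eta + eta <= (L + e) * (1 - eta) by lra.
have [w [tw w0 Pw Gw]] := test_approx_eigen s01 L0 eigs eta0.
(* Any order between s and 1 would do. *)
pose k1 := (1 + s) / 2.
have [sk1 k11] : s < k1 /\ k1 < 1 by rewrite /k1; split; lra.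
have k1p : 0 < k1 by exact: lt_trans sk1.
have k1s : 0 < k1 - s by rewrite subr_gt0.
clearbody eta k1.
have Gk1fin : (G k1 w < +oo)%E by apply: test_function_Gp_lty tw => //; rewrite k1p.
pose M1 := fine (G k1 w).
have M10 : 0 <= M1 by rewrite fine_ge0// Gp_ge0.
have GM1 : G k1 w = M1%:E by rewrite fineK// ge0_fin_numE// Gp_ge0.
clearbody M1.
have M1p : 0 < M1 + 1 by rewrite ltr_wpDl.
pose dl := Num.min (k1 - s) ((k1 - s) * eta / (M1 + 1)).
have dl0 : 0 < dl by rewrite lt_min k1s divr_gt0// mulr_gt0.
near=> k.
have sk : s < k by near: k; exact: nbhs_right_gt.
have : k < s + dl by near: k; apply: nbhs_right_lt; rewrite ltrDl.
rewrite -ltrBlDl lt_min ltrD2r ltr_pdivlMr// => /andP[kk1 kd].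
have k0 : 0 < k := lt_trans s0 sk.
have ks : 0 < k - s by rewrite subr_gt0.
split=> [|Lk v Lk0 [_ _ _ _ Hk]]; first exact: lt_trans k11.
have h1 := Hk _ (W0_test p1 k0 tw) (aeW _ w0).
pose t := (k - s) / (k1 - s).
have t0 : 0 < t by rewrite divr_gt0.
have t1 : t < 1 by rewrite ltr_pdivrMr// mul1r ltrD2r.
have kE : (1 - t) * s + t * k1 = k by rewrite /t; field; rewrite gt_eqF.
have t01 : 0 < t < 1 by rewrite t0.
have := Gp_convex p1 t01 s0 k1p (test_function_measurable tw).
rewrite kE GM1 => h2.
have tM1 : t * M1 <= eta.
  rewrite /t mulrAC ler_pdivrMr// [leRHS]mulrC; apply: le_trans (ltW kd).
  by apply: ler_wpM2l; [exact: ltW|rewrite lerDl].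
have : (Lk%:E * (1 - eta)%:E <= (L + eta + eta)%:E)%E.
  apply: (@le_trans _ _ (Lk%:E * P w)%E); first by apply: lee_wpmul2l; rewrite ?lee_fin.
  apply: (le_trans h1); apply: (le_trans h2); rewrite [leRHS]EFinD; apply: leeD.
    apply: le_trans Gw; apply: (@le_trans _ _ (1 * G s w)%E); last by rewrite mul1e.
    by apply: lee_wpmul2r; [exact: Gp_ge0|rewrite lee_fin gerBl ltW].
  by rewrite -EFinM lee_fin.
rewrite -EFinM lee_fin => h3.
have q0 : 0 < 1 - eta by rewrite subr_gt0.
by rewrite -(ler_pM2r q0); exact: le_trans etaL.
Unshelve. all: by end_near. Qed.

(** By convexity the energy of order s of u k is at most a weighted mean of
    its energies of orders s' < s and k. The latter is nearly at most L, and
    the former is bounded and has a weight tending to 0. *)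
Lemma eigenpair_minimizing s L us (u : R -> 'rV[R]_N -> R) : 0 < s < 1 -> 0 <= L ->
  eigenpair s L us ->
  (forall k, 0 < k < 1 -> exists2 Lk, 0 <= Lk & eigenpair k Lk (u k)) ->
  forall e, 0 < e -> \forall k \near s^'+,
    [/\ W0 s (u k), P (u k) = 1%E, {ae mu, forall x, 0 <= u k x} &
        (G s (u k) <= (L + e)%:E)%E].
Proof.
move=> s01 L0 eigs hu e e0; have /andP[s0 s1] := s01.
have e20 : 0 < e / 2 by rewrite divr_gt0.
(* Any order between 0 and s would do. *)
pose s' := s / 2.
have s'0 : 0 < s' by rewrite divr_gt0.
have s's : s' < s by rewrite ltr_pdivrMr// ltr_pMr// ltr1n.
have ss' : 0 < s - s' by rewrite subr_gt0.
clearbody s'.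
have s'01 : 0 < s' < 1 by rewrite s'0 (lt_trans s's).
have [C C0 HC] := Gp_embedding (N := N) p1 s'01.
have KB0 : 0 < L + e / 2 + C by rewrite ltr_wpDr// ltr_wpDl.
pose dl := (s - s') * (e / 2) / (L + e / 2 + C).
have dl0 : 0 < dl by rewrite divr_gt0// mulr_gt0.
near=> k.
have sk : s < k by near: k; exact: nbhs_right_gt.
have k0 : 0 < k := lt_trans s0 sk.
have kd : k - s < dl.
  by rewrite ltrBlDl; near: k; apply: nbhs_right_lt; rewrite ltrDl.
have [k1 HLk] : k < 1 /\ forall Lk v, 0 <= Lk -> eigenpair k Lk v -> Lk <= L + e / 2.
  by near: k; exact: (eigenvalue_limsup s01 L0 eigs e20).
have [|Lk Lk0 eigk] := hu k; first by rewrite k0.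
have LkL := HLk _ _ Lk0 eigk.
have [wk Pk uk0 Gk _] := eigk.
have wks : W0 s (u k) := W0_mono N1 p1 hopen hbnd s01 (ltW sk) wk.
split; [exact: wks|exact: Pk|exact: uk0|].
have s'k : s' < k := lt_trans s's sk.
have ks' : 0 < k - s' by rewrite subr_gt0.
pose t := (s - s') / (k - s').
have t0 : 0 < t by rewrite divr_gt0.
have t1 : t < 1 by rewrite ltr_pdivrMr// mul1r ltrD2r.
have t01 : 0 < t < 1 by rewrite t0.
have sE : (1 - t) * s' + t * k = s by rewrite /t; field; rewrite gt_eqF.
have muk := W0_measurable wk.
have := Gp_convex p1 t01 s'0 k0 muk; rewrite sE Gk => h1.
have h2 := HC k (u k) (ltW s'k) muk; rewrite Gk Pk mule1 -EFinD in h2.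
have t'0 : 0 <= 1 - t by rewrite subr_ge0 ltW.
apply: (le_trans h1).
apply: (@le_trans _ _ ((1 - t)%:E * (Lk + C)%:E + t%:E * Lk%:E)%E).
  by rewrite leeD2r//; apply: lee_wpmul2l.
rewrite -!EFinM -EFinD lee_fin.
have t'E : 1 - t <= (k - s) / (s - s').
  have -> : 1 - t = (k - s) / (k - s') by rewrite /t; field; rewrite gt_eqF.
  apply: ler_wpM2l; first by rewrite subr_ge0 ltW.
  by rewrite lef_pV2 ?posrE// lerD2r ltW.
have h3 : (1 - t) * (L + e / 2 + C) <= e / 2.
  apply: (le_trans (ler_wpM2r (ltW KB0) t'E)).
  rewrite mulrAC ler_pdivrMr// [leRHS]mulrC -ler_pdivlMr//; exact: ltW.
have h4 : (1 - t) * (Lk + C) <= (1 - t) * (L + e / 2 + C).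
  by apply: ler_wpM2l => //; rewrite lerD2r.
have h5 : t * Lk <= Lk by rewrite -[leRHS]mul1r; apply: ler_wpM2r => //; exact: ltW.
apply: (le_trans (lerD (le_trans h4 h3) (le_trans h5 LkL))).
by rewrite addrCA -splitr.
Unshelve. all: by end_near. Qed.

End limsup.

(** * Uniqueness of the first eigenfunction *)

Lemma fast_small (R : realType) (p d : R) : 1 < p -> 0 < d ->
  exists n0, forall n, (n0 <= n)%N -> fast p n <= d.
Proof.
move=> p1 d0.
have /cvgrPdist_le/(_ d d0)[n0 _ hn0] := @cvg_fast R 1.
exists n0 => n nn; apply: (@le_trans _ _ (1 * 2^-1 ^+ n)).
  rewrite /fast; apply: ler_wpM2r; first by rewrite exprn_ge0 ?invr_ge0.
  have e1 : (1 : R) `^ p = 1 by rewrite powR1.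
  rewrite -[leRHS]e1; apply: le_powRp => //.
  by rewrite exprn_ile1 ?invr_ge0// invf_le1// ler1n.
have := hn0 n nn; rewrite /= sub0r normrN ger0_norm// mul1r.
Qed.

Section uniqueness.
Context {R : realType} {N : nat}.
Hypothesis N1 : (1 <= N)%N.
Implicit Types (x y : 'rV[R]_N) (k s : R).
Implicit Types (u v w f g : 'rV[R]_N -> R).
Local Notation mu := (lebesgue_rV R N).
Local Notation mu2 := (mu \x mu)%E.
Variable p : R.
Hypothesis p1 : 1 < p.
Let p0 : 0 < p. Proof. exact: lt_trans ltr01 p1. Qed.
Variable Omega : set 'rV[R]_N.
Hypothesis hopen : open Omega.
Hypothesis hbnd : bounded_set Omega.
Local Notation P u := (pint mu p u).
Local Notation G s u := (Gp p s u).
Local Notation eigenpair := (eigenpair p Omega).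

Definition deficit s u v w z : R := (gint p s u z + gint p s v z) / 2 - gint p s w z.

Lemma measurable_deficit s u v w : measurable_fun setT u -> measurable_fun setT v ->
  measurable_fun setT w -> measurable_fun setT (deficit s u v w).
Proof.
move=> mu_ mv mw; apply: measurable_funB; last exact: measurable_gint.
by apply: measurable_funM => //; apply: measurable_funD; exact: measurable_gint.
Qed.

Lemma integral_deficit s u v w : measurable_fun setT u -> measurable_fun setT v ->
  measurable_fun setT w -> (forall z, 0 <= deficit s u v w z) ->
  (\int[mu2]_z (deficit s u v w z)%:E + G s w = 2^-1%:E * (G s u + G s v))%E.
Proof.
move=> mu_ mv mw d0; rewrite ge0_muleDr ?Gp_ge0// !GpE//.
have mgu := measurable_gint p1 s mu_; have mgv := measurable_gint p1 s mv.
have mgw := measurable_gint p1 s mw; have md := measurable_deficit s mu_ mv mw.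
rewrite -!ge0_integralZl_EFin//;
  try (by move=> z _; rewrite lee_fin gint_ge0); try exact/measurable_EFinP.
rewrite -!ge0_integralD//;
  try (by move=> z _; rewrite ?mule_ge0 ?lee_fin ?gint_ge0);
  try (by apply: measurable_funeM; exact/measurable_EFinP); try exact/measurable_EFinP.
apply: eq_integral => z _; rewrite -!EFinM -!EFinD; congr EFin.
by rewrite /deficit; lra.
Qed.

Lemma cvg_gint s (f : nat -> 'rV[R]_N -> R) g z :
  f n z.1 @[n --> \oo] --> g z.1 -> f n z.2 @[n --> \oo] --> g z.2 ->
  gint p s (f n) z @[n --> \oo] --> gint p s g z.
Proof.
move=> f1 f2; rewrite /gint; apply: cvgMl.
apply: (@cvg_comp _ _ _ _ (fun y : R => `|y| `^ p) _ _ _ _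
  (@continuous_norm_powR _ _ p1 (g z.1 - g z.2))).
exact: cvgB.
Qed.

Lemma pmean_abs_deficit_ge0 s u v z :
  0 <= deficit s (fun x => `|u x|) (fun x => `|v x|) (fun x => pmean p `|u x| `|v x|) z.
Proof.
rewrite subr_ge0 /gint -mulrDl mulrAC; apply: ler_wpM2r; first exact: rker_ge0.
by have [h _] := pmeanB p1 (normr_ge0 (u z.1)) (normr_ge0 (v z.1)) (normr_ge0 (u z.2)) (normr_ge0 (v z.2)).
Qed.

Lemma pmean_abs_deficit_eq0 s u v x y :
  deficit s (fun x => `|u x|) (fun x => `|v x|) (fun x => pmean p `|u x| `|v x|) (x, y) = 0 ->
  `|u x| * `|v y| = `|v x| * `|u y|.
Proof.
have [->|xy] := eqVneq x y; first by move=> _; rewrite mulrC.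
rewrite /deficit /gint/= -mulrDl mulrAC -mulrBl => /eqP; rewrite mulf_eq0.
have -> : (rker (N%:R + s * p) (x, y) == 0) = false.
  apply/negbTE; rewrite gt_eqF// rker.unlock invr_gt0 powR_gt0//=.
  by apply: (lt_le_trans _ (normr_le_enorm _)); rewrite normr_gt0 subr_eq0.
rewrite orbF subr_eq0 => /eqP h.
have [_ h2] := pmeanB p1 (normr_ge0 (u x)) (normr_ge0 (v x)) (normr_ge0 (u y)) (normr_ge0 (v y)).
by apply: h2; rewrite -h.
Qed.

Lemma pint_pmean_abs u v : measurable_fun setT u -> measurable_fun setT v ->
  P (fun x => pmean p `|u x| `|v x|) = (2^-1%:E * (P u + P v))%E.
Proof.
move=> mu_ mv; rewrite ge0_muleDr ?pint_ge0// -pint_lincomb//.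
rewrite pint.unlock; apply: eq_integral => x _; congr EFin.
by rewrite ger0_norm ?pmean_ge0// pmeanX//; lra.
Qed.

(** Almost everywhere |u(x)| |v(y)| = |v(x)| |u(y)|. For almost every fixed x,
    taking p-th powers and integrating in y, where both functions have norm 1,
    leaves |u(x)| = |v(x)|. *)
Lemma deficit_zero_proportional s u v : measurable_fun setT u -> measurable_fun setT v ->
  P u = 1%E -> P v = 1%E ->
  (\int[mu2]_z (deficit s (fun x => `|u x|) (fun x => `|v x|)
     (fun x => pmean p `|u x| `|v x|) z)%:E = 0)%E ->
  {ae mu, forall x, `|u x| = `|v x|}.
Proof.
move=> mu_ mv Pu Pv.
set h := deficit s _ _ _ => h0.
have hge z : 0 <= h z by exact: pmean_abs_deficit_ge0.
have mau : measurable_fun setT (fun x => `|u x|) by exact: measurableT_comp.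
have mav : measurable_fun setT (fun x => `|v x|) by exact: measurableT_comp.
have mh : measurable_fun setT h.
  by apply: measurable_deficit => //; exact: measurable_pmean.
have mhx x : measurable_fun setT (fun y => (h (x, y))%:E).
  by apply/measurable_EFinP; apply: (measurableT_comp mh); exact: measurable_pair1.
rewrite fubini_tonelli1// in h0; last exact/measurable_EFinP.
have mF : measurable_fun setT (fun x => (\int[mu]_y (h (x, y))%:E)%E).
  apply: (measurable_fun_fubini_tonelli_F (m2 := mu) (fun z => (h z)%:E)) => //.
  exact/measurable_EFinP.
have F0 x : (0 <= \int[mu]_y (h (x, y))%:E)%E by apply: integral_ge0 => y _; rewrite lee_fin.
have /(ae_eq_integral_abs _ measurableT mF) : (\int[mu]_x `|\int[mu]_y (h (x, y))%:E| = 0)%E.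
  by under eq_integral do rewrite gee0_abs//.
apply: filterS => x /(_ I) hx.
have /(ae_eq_integral_abs _ measurableT (mhx x)) : (\int[mu]_y `|(h (x, y))%:E| = 0)%E.
  by under eq_integral do rewrite gee0_abs ?lee_fin//.
move=> hxy.
have : P (fun y => `|u x| * `|v y|) = P (fun y => `|v x| * `|u y|).
  apply: pint_ae_eq; [exact: measurable_funM|exact: measurable_funM|].
  by apply: filterS hxy => y /(_ I)[] hy; exact: (pmean_abs_deficit_eq0 hy).
have Pabs f : P (fun y => `|f y|) = P f.
  by rewrite pint.unlock; apply: eq_integral => y _; rewrite normr_id.
rewrite !pintZ// !Pabs Pu Pv !mule1 !normr_id => -[] /powRp_inj; exact.
Qed.

(** The power mean W of u and v is a competitor for the minimum, so its
    deficit integrates to 0. Since W is not known to be in the completion,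
    this is obtained through smoothed means of approximating test functions,
    whose deficits have integrals tending to 0, and Fatou's lemma. *)
Lemma eigenfunction_unique s L u v : 0 < s < 1 -> 0 <= L ->
  eigenpair s L u -> eigenpair s L v -> {ae mu, forall x, u x = v x}.
Proof.
move=> /andP[s0 s1] L0 [wu Pu up Gu HL] [wv Pv vp Gv _].
have mu_ := W0_measurable wu; have mv := W0_measurable wv.
have /choice[F HF] : forall n, exists q : ('rV[R]_N -> R) * ('rV[R]_N -> R) * R,
    [/\ 0 < q.2, test_function Omega q.1.1 & test_function Omega q.1.2] /\
    [/\ (G s (q.1.1 \- u)%R <= (fast p n)%:E)%E, (G s (q.1.2 \- v)%R <= (fast p n)%:E)%E,
        (P (q.1.1 \- u)%R <= (fast p n)%:E)%E, (P (q.1.2 \- v)%R <= (fast p n)%:E)%E &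
        (P (fun x => spmean p q.2 (q.1.1 x) (q.1.2 x) - pmean p (u x) (v x))%R <=
         (fast p n)%:E)%E].
  move=> n; have [phi [psi [e h]]] :=
    approx_pair N1 p1 hopen hbnd s0 (fast_gt0 p n) wu wv up vp.
  by exists (phi, psi, e).
pose phi n := (F n).1.1; pose psi n := (F n).1.2.
pose w n x := spmean p (F n).2 (phi n x) (psi n x).
pose W x := pmean p (u x) (v x).
have tphi n : test_function Omega (phi n) by have [[]] := HF n.
have tpsi n : test_function Omega (psi n) by have [[]] := HF n.
have e0 n : 0 < (F n).2 by have [[]] := HF n.
have tw n : test_function Omega (w n) by exact: test_function_spmean.
have w0 n x : 0 <= w n x by apply: spmean_ge0 => //; exact: ltW.
have mphi n := test_function_measurable (tphi n).
have mpsi n := test_function_measurable (tpsi n).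
have mw n := test_function_measurable (tw n).
have mau : measurable_fun setT (fun x => `|u x|) by exact: measurableT_comp.
have mav : measurable_fun setT (fun x => `|v x|) by exact: measurableT_comp.
have mW : measurable_fun setT W by exact: measurable_pmean.
have maW : measurable_fun setT (fun x => pmean p `|u x| `|v x|) by exact: measurable_pmean.
have PW : P W = 1%E.
  rewrite (pint_ae_eq p mW maW); last first.
    by apply: filterS2 up vp => x ux vx; rewrite !ger0_norm.
  by rewrite pint_pmean_abs// Pu Pv -EFinD -EFinM; congr EFin; lra.
pose D n := deficit s (phi n) (psi n) (w n).
have D0 n z : 0 <= D n z.
  by rewrite subr_ge0; exact: gint_spmean.
have mD n : measurable_fun setT (D n) by exact: measurable_deficit.
(* By minimality the energy of w n is at least about L, and the average of
   those of phi n and psi n is about L. *)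
have Dsmall eta : 0 < eta -> exists n0, forall n, (n0 <= n)%N ->
    (\int[mu2]_z (D n z)%:E <= eta%:E)%E.
  move=> eta0; pose t := eta / (L + 1).
  have t0 : 0 < t by rewrite divr_gt0// ltr_wpDl.
  have [d1 d10 Hd1] := Gp_continuous p1 mu_ Gu t0.
  have [d2 d20 Hd2] := Gp_continuous p1 mv Gv t0.
  have [d3 d30 Hd3] := pint_continuous p1 mW PW t0.
  have [n1 Hn1] := fast_small p1 d10; have [n2 Hn2] := fast_small p1 d20.
  have [n3 Hn3] := fast_small p1 d30.
  exists (maxn n1 (maxn n2 n3)) => n; rewrite !geq_max => /and3P[/Hn1 h1 /Hn2 h2 /Hn3 h3].
  rewrite -lee_fin in h1; rewrite -lee_fin in h2; rewrite -lee_fin in h3.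
  have [_ [g1 g2 _ _ g3]] := HF n.
  have [_ b1] := Hd1 _ (mphi n) (le_trans g1 h1).
  have [_ b2] := Hd2 _ (mpsi n) (le_trans g2 h2).
  have [b3 _] := Hd3 _ (mw n) (le_trans g3 h3).
  have id := integral_deficit (mphi n) (mpsi n) (mw n) (D0 n).
  have up2 : (2^-1%:E * (G s (phi n) + G s (psi n)) <= (L + t)%:E)%E.
    apply: (@le_trans _ _ (2^-1%:E * ((L + t)%:E + (L + t)%:E))%E).
      by apply: lee_wpmul2l; [rewrite lee_fin invr_ge0|exact: leeD].
    by rewrite -EFinD -EFinM lee_fin; lra.
  have low : ((L * (1 - t))%:E <= G s (w n))%E.
    rewrite EFinM; apply: (@le_trans _ _ (L%:E * P (w n))%E).
      by apply: lee_wpmul2l.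
    by apply: HL; [exact: W0_test|exact: aeW].
  have : (\int[mu2]_z (D n z)%:E + (L * (1 - t))%:E <= (L + t)%:E)%E.
    apply: (@le_trans _ _ (\int[mu2]_z (D n z)%:E + G s (w n))%E); first by rewrite leeD2l.
    by rewrite id.
  rewrite -leeBrDr// => /le_trans; apply; rewrite -EFinB lee_fin.
  have : t * (L + 1) = eta by rewrite /t divfK// gt_eqF// ltr_wpDl.
  lra.
have cphi : {ae mu, forall x, phi n x @[n --> \oo] --> u x}.
  by apply: (pint_fast_cvg p1 mphi mu_) => n; have [_ []] := HF n.
have cpsi : {ae mu, forall x, psi n x @[n --> \oo] --> v x}.
  by apply: (pint_fast_cvg p1 mpsi mv) => n; have [_ []] := HF n.
have cw : {ae mu, forall x, w n x @[n --> \oo] --> W x}.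
  by apply: (pint_fast_cvg p1 mw mW) => n; have [_ []] := HF n.
have cvg_all : {ae mu, forall x, [/\ phi n x @[n --> \oo] --> `|u x|,
    psi n x @[n --> \oo] --> `|v x| & w n x @[n --> \oo] --> pmean p `|u x| `|v x|]}.
  near=> x.
  have ux : 0 <= u x by near: x; exact: up.
  have vx : 0 <= v x by near: x; exact: vp.
  rewrite !ger0_norm//; split; near: x => //.
pose Dl := deficit s (fun x => `|u x|) (fun x => `|v x|) (fun x => pmean p `|u x| `|v x|).
have Dl0 z : 0 <= Dl z by exact: pmean_abs_deficit_ge0.
have mDl : measurable_fun setT Dl by exact: measurable_deficit.
have cD : {ae mu2, forall z, (D n z)%:E @[n --> \oo] --> (Dl z)%:E}.
  apply: filterS2 (ae_product1 mu cvg_all) (ae_product2 mu cvg_all) => z [a1 a2 a3] [b1 b2 b3].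
  apply/fine_cvgP; split; first exact: nearW.
  apply: cvgB; last exact: cvg_gint.
  by apply: cvgMl; apply: cvgD; exact: cvg_gint.
have intDl : (\int[mu2]_z (Dl z)%:E = 0)%E.
  apply/eqP; rewrite eq_le; apply/andP; split; last first.
    by apply: integral_ge0 => z _; rewrite lee_fin.
  apply/lee_addgt0Pr => eta eta0; rewrite add0e.
  have [n0 Hn0] := Dsmall _ eta0.
  apply: (@fatou_le _ _ _ mu2 (fun n z => (D n z)%:E) _ _ n0) => //.
  - by move=> n; exact/measurable_EFinP.
  - exact/measurable_EFinP.
have := deficit_zero_proportional mu_ mv Pu Pv intDl.
move=> huv; near=> x.
have ux : 0 <= u x by near: x; exact: up.
have vx : 0 <= v x by near: x; exact: vp.
rewrite -(ger0_norm ux) -(ger0_norm vx).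
by near: x; exact: huv.
Unshelve. all: by end_near. Qed.

End uniqueness.

(** * Approximation by step functions *)

(** Limits along an ultrafilter replace the successive extraction of
    subsequences, one for each cell of the grid. *)
Lemma ultra_bounded_cvg (R : realType) (T : Type) (F : set_system T) (f : T -> R) (B : R) :
  UltraFilter F -> (\forall t \near F, `|f t| <= B) -> exists l : R, f t @[t --> F] --> l.
Proof.
move=> UF fB; have := @segment_compact R (- B) B.
move=> /(_ (f t @[t --> F]) _) [].
  by near=> t; rewrite /= in_itv/= -ler_norml; near: t.
move=> l [_ cl]; exists l => V Vl; have [//|nV] := in_ultra_setVsetC (f @^-1` V) UF.
have [x [/= nVx Vx]] := cl (~` V) V nV Vl; by case: nVx.
Unshelve. all: by end_near. Qed.

Section step_functions.
Context {R : realType} {N : nat}.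
Implicit Types (x y : 'rV[R]_N) (k s : R).
Implicit Types (v w f g : 'rV[R]_N -> R).
Local Notation mu := (lebesgue_rV R N).
Local Notation mu2 := (mu \x mu)%E.
Variable p : R.
Hypothesis p1 : 1 < p.
Let p0 : 0 < p. Proof. exact: lt_trans ltr01 p1. Qed.
Let pN0 : p != 0. Proof. by rewrite gt_eqF. Qed.
Local Notation P u := (pint mu p u).
Local Notation G s u := (Gp p s u).
Variables (I : finType) (Q : I -> set 'rV[R]_N) (vol D : R).
Hypothesis mQ : forall q, measurable (Q q).
Hypothesis disjQ : forall q q' x, Q q x -> Q q' x -> q = q'.
Hypothesis vol0 : 0 < vol.
Hypothesis muQ : forall q, mu (Q q) = vol%:E.
Hypothesis D0 : 0 < D.
Hypothesis diamQ : forall q x y, Q q x -> Q q y -> enorm (x - y) <= D.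

Definition step (c : I -> R) x : R := \sum_q c q * \1_(Q q) x.

Lemma step_on c q x : Q q x -> step c x = c q.
Proof.
move=> Qx; rewrite /step (bigD1 q)//= indicE mem_set// mulr1 big1 ?addr0// => q' qq'.
rewrite indicE memNset ?mulr0// => Q'x; move: qq'.
by rewrite (disjQ Q'x Qx) eqxx.
Qed.

Lemma step_off c x : (forall q, ~ Q q x) -> step c x = 0.
Proof.
move=> nQ; rewrite /step big1// => q _; by rewrite indicE memNset ?mulr0.
Qed.

Lemma measurable_indicQ q : measurable_fun setT (\1_(Q q) : 'rV[R]_N -> R).
Proof. exact: measurable_indic. Qed.

Lemma measurable_step c : measurable_fun setT (step c).
Proof.
rewrite (_ : step c = fun x => \sum_(q <- enum I) c q * \1_(Q q) x); last first.
  by apply/funext => x; rewrite big_enum.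
apply: (@measurable_sum _ _ _ _ _ _ (fun q (x : 'rV[R]_N) => c q * \1_(Q q) x)) => q.
by apply: measurable_funM => //; exact: measurable_indicQ.
Qed.

Lemma pint_step_le c (e : R) : 0 <= e -> (forall q, `|c q| <= e) ->
  (P (step c) <= (#|I|%:R * (e `^ p * vol))%:E)%E.
Proof.
move=> e0 ce.
apply: (@le_trans _ _ (\int[mu]_x (\sum_(q <- enum I) (e `^ p * \1_(Q q) x)%:E))%E).
  rewrite pint.unlock; apply: ge0_le_integral => //.
  - by apply: measurable_pint; exact: measurable_step.
  - apply: emeasurable_sum => q; apply/measurable_EFinP.
    by apply: measurable_funM => //; exact: measurable_indicQ.
  move=> x _; have term0 q : (0 <= (e `^ p * \1_(Q q) x)%:E)%E.
    by rewrite lee_fin mulr_ge0 ?powR_ge0// indicE ler0n.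
  have [[q Qx]|nQ] := pselect (exists q, Q q x); last first.
    rewrite step_off ?normr0 ?powR0//; first by rewrite sume_ge0.
    by move=> q Qx; apply: nQ; exists q.
  rewrite (step_on _ Qx) big_enum/= (bigD1 q)//=.
  rewrite [X in (X + _)%E](_ : _ = (e `^ p)%:E); last by rewrite indicE mem_set// mulr1.
  apply: (@le_trans _ _ (e `^ p)%:E); first by rewrite lee_fin le_powRp.
  by rewrite leeDl// sume_ge0.
rewrite ge0_integral_sum//; last 2 first.
- move=> q; apply/measurable_EFinP.
  by apply: measurable_funM => //; exact: measurable_indicQ.
- by move=> q x _; rewrite lee_fin mulr_ge0 ?powR_ge0// indicE ler0n.
rewrite (eq_bigr (fun=> (e `^ p * vol)%:E)) => [|q _]; last first.
  by rewrite integral_indicZ ?powR_ge0// -[mu (Q q)]/((mu : set _ -> \bar R) (Q q)) muQ EFinM.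
by rewrite sumEFin big_const_seq count_predT -cardE iter_addr_0 mulr_natl.
Qed.

Lemma pint_step_ge c q : ((`|c q| `^ p * vol)%:E <= P (step c))%E.
Proof.
rewrite EFinM -(muQ q) -integral_indicZ ?powR_ge0// pint.unlock.
apply: ge0_le_integral => //.
- by apply/measurable_EFinP; apply: measurable_funM => //; exact: measurable_indicQ.
- by apply: measurable_pint; exact: measurable_step.
move=> x _; rewrite lee_fin indicE; have [xQ|xQ] := pselect (Q q x).
  by rewrite mem_set// mulr1 (step_on _ xQ).
by rewrite memNset// mulr0 powR_ge0.
Qed.

(** The energy density without its kernel, on the square of the cell q. *)
Let K q f (z : 'rV[R]_N * 'rV[R]_N) : R := \1_(Q q) z.1 * (\1_(Q q) z.2 * `|f z.1 - f z.2| `^ p).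

Let K0 q f z : 0 <= K q f z.
Proof. by rewrite !mulr_ge0 ?powR_ge0// indicE ler0n. Qed.

Let mK q f : measurable_fun setT f -> measurable_fun setT (K q f).
Proof.
move=> mf; apply: measurable_funM.
  by apply: (measurableT_comp _ measurable_fst); exact: measurable_indicQ.
apply: measurable_funM.
  by apply: (measurableT_comp _ measurable_snd); exact: measurable_indicQ.
by apply: measurable_norm_powR; exact: measurable_diff.
Qed.

(** Two points of one cell are at distance at most D, where the kernel is at
    least its value at D; and the squares of distinct cells are disjoint. *)
Lemma cells_energy s f : 0 < s -> measurable_fun setT f ->
  (\sum_(q <- enum I) \int[mu2]_z (K q f z)%:E <= (D `^ (N%:R + s * p))%:E * G s f)%E.
Proof.
move=> s0 mf; have a0 := rker_expnt_gt0 (N := N) p1 s0.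
rewrite -ge0_integral_sum//; last 2 first.
- by move=> q; apply/measurable_EFinP; exact: mK.
- by move=> q z _; rewrite lee_fin.
rewrite GpE// -ge0_integralZl_EFin ?powR_ge0//; last 2 first.
- by move=> z _; rewrite lee_fin gint_ge0.
- by apply/measurable_EFinP; exact: measurable_gint.
apply: ge0_le_integral => //.
- by move=> z _; rewrite sume_ge0// => q _; rewrite lee_fin.
- by apply: emeasurable_sum => q; apply/measurable_EFinP; exact: mK.
- by apply: measurable_funeM; apply/measurable_EFinP; exact: measurable_gint.
move=> z _; rewrite -EFinM big_enum/=.
have [[q [Q1 Q2]]|nQ] := pselect (exists q, Q q z.1 /\ Q q z.2); last first.
  rewrite big1 => [|q _]; first by rewrite lee_fin mulr_ge0 ?powR_ge0 ?gint_ge0.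
  rewrite /K !indicE; have [q1|q1] := pselect (Q q z.1); last by rewrite memNset// mul0r.
  have [q2|q2] := pselect (Q q z.2); last by rewrite (memNset q2) mul0r mulr0.
  by exfalso; apply: nQ; exists q.
rewrite (bigD1 q)//= big1 ?adde0 => [|q' qq']; last first.
  rewrite /K indicE memNset ?mul0r// => Q'; move: qq'.
  by rewrite (disjQ Q' Q1) eqxx.
rewrite lee_fin /K !indicE !mem_set// !mul1r /gint mulrCA.
have [z12|z12] := eqVneq z.1 z.2.
  by rewrite z12 subrr normr0 powR0// mul0r.
rewrite ler_peMr ?powR_ge0// rker.unlock.
have e0 : 0 < enorm (z.1 - z.2).
  by apply: (lt_le_trans _ (normr_le_enorm _)); rewrite normr_gt0 subr_eq0.
rewrite ler_pdivlMr ?powR_gt0// mul1r; apply: ge0_ler_powR.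
- exact: ltW.
- by rewrite nnegrE ltW.
- by rewrite nnegrE ltW.
- exact: diamQ Q1 Q2.
Qed.

(** The constant is a value f(y) with y in the cell: if none were good,
    averaging over y would contradict the value of the double integral. The
    slack delta makes the averaging strict. *)
Lemma cell_constant q f (delta : R) : 0 < delta -> measurable_fun setT f ->
  (\int[mu2]_z (K q f z)%:E < +oo)%E -> exists c : R,
  (vol%:E * \int[mu]_x (\1_(Q q) x * `|f x - c| `^ p)%:E <=
   \int[mu2]_z (K q f z)%:E + delta%:E)%E.
Proof.
move=> delta0 mf Kfin.
have Kge : (0 <= \int[mu2]_z (K q f z)%:E)%E by apply: integral_ge0 => z _; rewrite lee_fin.
set J := (\int[mu2]_z (K q f z)%:E)%E in Kfin Kge *.
have JE : J = (fine J)%:E by rewrite fineK// ge0_fin_numE.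
pose g y := (\int[mu]_x (\1_(Q q) x * `|f x - f y| `^ p)%:E)%E.
apply: contrapT => nex.
have hg y : Q q y -> ((fine J + delta)%:E <= vol%:E * g y)%E.
  move=> Qy; rewrite leNgt; apply/negP => h; apply: nex; exists (f y).
  by apply/ltW; rewrite JE -EFinD.
have mH : measurable_fun setT (fun z : 'rV[R]_N * 'rV[R]_N => \1_(Q q) z.1 * `|f z.1 - f z.2| `^ p).
  apply: measurable_funM.
    by apply: (measurableT_comp _ measurable_fst); exact: measurable_indicQ.
  by apply: measurable_norm_powR; exact: measurable_diff.
have H0 z : 0 <= \1_(Q q) z.1 * `|f z.1 - f z.2| `^ p :> R.
  by rewrite mulr_ge0 ?powR_ge0// indicE ler0n.
have mg : measurable_fun setT g.
  apply: (measurable_fun_fubini_tonelli_G (m1 := mu)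
    (fun z => (\1_(Q q) z.1 * `|f z.1 - f z.2| `^ p)%:E)) => //.
  exact/measurable_EFinP.
have g0 y : (0 <= g y)%E by apply: integral_ge0 => x _; rewrite lee_fin (H0 (x, y)).
have Jg : J = (\int[mu]_y ((\1_(Q q) y)%:E * g y))%E.
  rewrite /J fubini_tonelli2//; last 2 first.
  - by apply/measurable_EFinP; exact: mK.
  - by move=> z; rewrite lee_fin.
  apply: eq_integral => y _; rewrite /g -ge0_integralZl_EFin//; last first.
    by apply/measurable_EFinP; exact: (measurableT_comp mH (measurable_pair2 y)).
  by apply: eq_integral => x _; rewrite /K/= mulrCA EFinM.
have j0 : 0 <= fine J by rewrite fine_ge0.
move: JE j0 hg; set j := fine J; clearbody j => JE j0 hg.
have : ((j + delta)%:E * vol%:E <= vol%:E * J)%E.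
  rewrite Jg -ge0_integralZl_EFin ?(ltW vol0)//; last 2 first.
  - by move=> y _; rewrite mule_ge0// lee_fin indicE ler0n.
  - by apply: emeasurable_funM => //; apply/measurable_EFinP; exact: measurable_indicQ.
  rewrite -{1}(muQ q) -integral_indicZ//; last by rewrite addr_ge0// ltW.
  apply: ge0_le_integral => //.
  - by move=> y _; rewrite lee_fin mulr_ge0 ?addr_ge0 ?(ltW delta0)// indicE ler0n.
  - by apply/measurable_EFinP; apply: measurable_funM => //; exact: measurable_indicQ.
  - apply: measurable_funeM; apply: emeasurable_funM => //.
    by apply/measurable_EFinP; exact: measurable_indicQ.
  move=> y _; rewrite indicE; have [Qy|Qy] := pselect (Q q y).
    by rewrite mem_set// mulr1 mul1e; exact: hg.
  by rewrite memNset// mulr0 mul0e mule0.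
rewrite JE -!EFinM lee_fin /= mulrC ler_pM2l// gerDl => h.
by move: (lt_le_trans delta0 h); rewrite ltxx.
Qed.

Lemma step_approx s f (delta : R) : 0 < s -> 0 < delta -> measurable_fun setT f ->
  (G s f < +oo)%E -> {ae mu, forall x, (forall q, ~ Q q x) -> f x = 0} ->
  exists c, (vol%:E * P (f \- step c)%R <=
    (D `^ (N%:R + s * p))%:E * G s f + (#|I|%:R * delta)%:E)%E.
Proof.
move=> s0 delta0 mf Gf f0.
have Kge q : (0 <= \int[mu2]_z (K q f z)%:E)%E by apply: integral_ge0 => z _; rewrite lee_fin.
have hsum := cells_energy s0 mf.
have Kfin q : (\int[mu2]_z (K q f z)%:E < +oo)%E.
  apply: (@le_lt_trans _ _ ((D `^ (N%:R + s * p))%:E * G s f)%E).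
    apply: le_trans hsum; rewrite big_enum/= (bigD1 q)//= leeDl// sume_ge0//.
  by rewrite lte_mul_pinfty ?lee_fin ?powR_ge0.
have /choice[c Hc] := fun q => cell_constant delta0 mf (Kfin q).
exists c.
have mB q : measurable_fun setT (fun x => \1_(Q q) x * `|f x - c q| `^ p).
  apply: measurable_funM; first exact: measurable_indicQ.
  by apply: measurable_norm_powR; exact: measurable_funB.
have B0 q x : 0 <= \1_(Q q) x * `|f x - c q| `^ p :> R.
  by rewrite mulr_ge0 ?powR_ge0// indicE ler0n.
have : (P (f \- step c)%R <=
    \sum_(q <- enum I) \int[mu]_x (\1_(Q q) x * `|f x - c q| `^ p)%:E)%E.
  rewrite -ge0_integral_sum//; last by move=> q; exact/measurable_EFinP.
  rewrite pint.unlock; apply: ae_ge0_le_integral => //.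
  - apply: measurable_pint; apply: measurable_funB => //; exact: measurable_step.
  - by move=> x _; rewrite sume_ge0// => q _; rewrite lee_fin.
  - by apply: emeasurable_sum => q; exact/measurable_EFinP.
  apply: filterS f0 => x fx _; rewrite big_enum/=.
  have [[q Qx]|nQ] := pselect (exists q, Q q x); last first.
    have nQ' q : ~ Q q x by move=> Qx; apply: nQ; exists q.
    rewrite fx// step_off// subrr normr0 powR0//.
    by rewrite sume_ge0// => q _; rewrite lee_fin.
  rewrite (step_on _ Qx) (bigD1 q)//=.
  rewrite [X in (_ <= X + _)%E](_ : _ = (`|f x - c q| `^ p)%:E); last first.
    by rewrite indicE mem_set// mul1r.
  by rewrite leeDl// sume_ge0// => q' _; rewrite lee_fin.
move=> /(lee_wpmul2l (x := vol%:E)); rewrite lee_fin (ltW vol0) => /(_ isT) h.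
apply: (le_trans h); rewrite ge0_sume_distrr; last first.
  by move=> q _; apply: integral_ge0 => x _; rewrite lee_fin.
apply: (@le_trans _ _ (\sum_(q <- enum I) (\int[mu2]_z (K q f z)%:E + delta%:E))%E).
  by apply: lee_sum => q _; exact: Hc.
rewrite big_split/= leeD//.
by rewrite sumEFin big_const_seq count_predT -cardE iter_addr_0 mulr_natl.
Qed.

End step_functions.

(** * Compactness in L^p *)

Section compactness.
Context {R : realType} {N : nat}.
Hypothesis N1 : (1 <= N)%N.
Implicit Types (x y : 'rV[R]_N) (k s : R).
Implicit Types (w f g : 'rV[R]_N -> R).
Local Notation mu := (lebesgue_rV R N).
Variable p : R.
Hypothesis p1 : 1 < p.
Let p0 : 0 < p. Proof. exact: lt_trans ltr01 p1. Qed.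
Local Notation P u := (pint mu p u).
Local Notation G s u := (Gp p s u).

Section grid.
Variables (M h : R) (m : nat).
Hypothesis h0 : 0 < h.
Hypothesis mh : m.+1%:R * h = 2 * M.

(** Half-open cubes of side h that tile the cube of radius M. *)
Definition cell (q : {ffun 'I_N -> 'I_m.+1}) : set 'rV[R]_N :=
  [set x | forall i, `[- M + (q i)%:R * h, - M + (q i).+1%:R * h[%classic (x ord0 i)].

Lemma measurable_cell q : measurable (cell q).
Proof.
by apply: (@measurable_coord_set _ _
  (fun i => `[- M + (q i)%:R * h, - M + (q i).+1%:R * h[%classic)).
Qed.

Lemma cell_disjoint q q' x : cell q x -> cell q' x -> q = q'.
Proof.
move=> qx q'x; apply/ffunP => i; apply/val_inj/eqP; rewrite eqn_leq.
have := qx i; have := q'x i; rewrite /= !in_itv/= => /andP[a1 a2] /andP[b1 b2].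
have lt1 : (q i)%:R * h < (q' i).+1%:R * h by lra.
have lt2 : (q' i)%:R * h < (q i).+1%:R * h by lra.
by move: lt1 lt2; rewrite !ltr_pM2r// !ltr_nat !ltnS => -> ->.
Qed.

Lemma mu_cell q : mu (cell q) = (h ^+ N)%:E.
Proof.
rewrite (@lebesgue_rV_box R N
  (fun i => `[- M + (q i)%:R * h, - M + (q i).+1%:R * h[%classic))//.
rewrite (eq_bigr (fun=> h%:E)) => [|i _].
  by rewrite prodEFin prodr_const card_ord.
rewrite lebesgue_measure_itv/= lte_fin ltrD2l ltr_pM2r// ltr_nat ltnSn -EFinD.
by congr EFin; rewrite -natr1; ring.
Qed.

Lemma cell_diam q x y : cell q x -> cell q y -> enorm (x - y) <= N%:R * h.
Proof.
move=> qx qy; apply: (le_trans (enorm_le _)); apply: ler_wpM2l => //.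
apply: normr_le => [|i]; first exact: ltW.
have := qx i; have := qy i; rewrite /= !in_itv/= !mxE -natr1 mulrDl mul1r.
by move=> /andP[a1 a2] /andP[b1 b2]; rewrite ler_norml; lra.
Qed.

Lemma cell_cover x : `|x| < M -> exists q, cell q x.
Proof.
move=> xM.
have ti i : 0 <= (x ord0 i + M) / h < m.+1%:R.
  have := le_lt_trans (normr_coord x i) xM; rewrite ltr_norml => /andP[a b].
  apply/andP; split; [by apply: divr_ge0; [lra|exact: ltW]|by rewrite ltr_pdivrMr// mh; lra].
pose q := [ffun i => inord (Num.truncn ((x ord0 i + M) / h)) : 'I_m.+1].
exists q => i; have /andP[t1 t2] := ti i.
have /andP[c1 c2] := truncn_itv t1.
have qi : q i = Num.truncn ((x ord0 i + M) / h) :> nat.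
  rewrite ffunE inordK//; rewrite -(ltr_nat R); exact: le_lt_trans c1 t2.
rewrite /= in_itv/= qi; apply/andP; split.
  by move: c1; rewrite ler_pdivlMr//; lra.
by move: c2; rewrite ltr_pdivrMr//; lra.
Qed.

End grid.

Variable Omega : set 'rV[R]_N.
Hypothesis hbnd : bounded_set Omega.

(** On a fine grid every member is uniformly close in L^p to a step function,
    by its energy bound. The finitely many coefficients are bounded, so they
    converge along the ultrafilter, and on a set of the ultrafilter they
    differ little from their limits. *)
Lemma rellich (T : Type) (U : set_system T) (v : T -> 'rV[R]_N -> R) s (Lam e : R) :
  UltraFilter U -> 0 < s -> 0 <= Lam ->
  (forall j, measurable_fun setT (v j)) ->
  (forall j, {ae mu, forall x, ~ Omega x -> v j x = 0}) ->
  (forall j, P (v j) = 1%E) -> (forall j, (G s (v j) <= Lam%:E)%E) ->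
  0 < e -> exists2 A, U A & forall i j, A i -> A j -> (P (v i \- v j)%R <= e%:E)%E.
Proof.
move=> UU s0 Lam0 mv v0 Pv Gv e0.
have [C C0 HC] := pint_triangle mu p1.
have [M M0 HM] := bounded_radius hbnd.
have a0 := rker_expnt_gt0 (N := N) p1 s0.
have sp0 : 0 < s * p by exact: mulr_gt0.
have NR : 0 < (N%:R : R) by rewrite ltr0n.
(* Each of two members is within rho of its step function; the constant C of
   the triangle inequality enters twice. *)
pose rho := e / (4 * C ^+ 2).
have rho0 : 0 < rho by rewrite divr_gt0// mulr_gt0// exprn_gt0.
(* The side h is such that D^(N + sp) (Lam + 1) is at most rho times the
   volume h^N of a cell, where D = N h bounds its diameter. *)
pose kap := rho / (N%:R `^ (N%:R + s * p) * (Lam + 1)).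
have kap0 : 0 < kap by rewrite divr_gt0// mulr_gt0 ?powR_gt0// ltr_wpDl.
pose hb := kap `^ (s * p)^-1.
have hb0 : 0 < hb by exact: powR_gt0.
have [m hm] : exists m : nat, 2 * M / m.+1%:R <= hb.
  have b0 : 0 <= 2 * M / hb by apply: divr_ge0; [lra|exact: ltW].
  have := archi_boundP b0; set m := Num.bound _ => mb; exists m.
  rewrite ler_pdivrMr// [leRHS]mulrC -ler_pdivrMr//; apply: (le_trans (ltW mb)).
  by rewrite ler_nat.
pose h := 2 * M / m.+1%:R.
have h0 : 0 < h by rewrite divr_gt0// mulr_gt0.
have mh : m.+1%:R * h = 2 * M by rewrite /h mulrC divfK.
pose D := N%:R * h.
have D0 : 0 < D by exact: mulr_gt0.
pose Q := cell M h (m := m).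
have mQ : forall q, measurable (Q q) by move=> q; exact: measurable_cell.
have dQ : forall q q' x, Q q x -> Q q' x -> q = q' by move=> q q' x; exact: cell_disjoint.
have vol0 : 0 < h ^+ N by rewrite exprn_gt0.
have muQ : forall q, mu (Q q) = (h ^+ N)%:E by move=> q; exact: mu_cell.
have diQ : forall q x y, Q q x -> Q q y -> enorm (x - y) <= D.
  by move=> q x y; exact: cell_diam.
pose n : R := #|{ffun 'I_N -> 'I_m.+1}|%:R.
have n0 : 0 <= n by [].
pose dl := D `^ (N%:R + s * p) / (n + 1).
have Da : 0 < D `^ (N%:R + s * p) by exact: powR_gt0.
have dl0 : 0 < dl by rewrite divr_gt0// ltr_wpDl.
have ndl : n * dl <= D `^ (N%:R + s * p).
  by rewrite /dl mulrCA ger_pMr// ler_pdivrMr ?mul1r ?lerDl// ltr_wpDl.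
have step_rho j : exists c, (P (v j \- step Q c)%R <= rho%:E)%E.
  have Gfin : (G s (v j) < +oo)%E by apply: (le_lt_trans (Gv j)); rewrite ltry.
  have vQ0 : {ae mu, forall x, (forall q, ~ Q q x) -> v j x = 0}.
    apply: filterS (v0 j) => x vx nQ; apply: vx => xO.
    by have [q qx] := cell_cover h0 mh (HM _ xO); exact: (nQ q).
  have [c hc] := step_approx p1 mQ dQ vol0 muQ D0 diQ s0 dl0 (mv j) Gfin vQ0.
  exists c.
  have hN : (h ^+ N = h `^ N%:R) by rewrite powR_mulrn// ltW.
  have : ((h ^+ N)%:E * P (v j \- step Q c)%R <= (h ^+ N)%:E * rho%:E)%E.
    apply: (le_trans hc).
    apply: (@le_trans _ _ ((D `^ (N%:R + s * p))%:E * Lam%:E + (n * dl)%:E)%E).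
      by apply: leeD => //; apply: lee_wpmul2l => //; rewrite lee_fin ltW.
    rewrite -!EFinM -EFinD lee_fin.
    apply: (@le_trans _ _ (D `^ (N%:R + s * p) * (Lam + 1))).
      by rewrite mulrDr mulr1 lerD2l.
    rewrite /D powRM ?(ltW NR) ?(ltW h0)// [h `^ _]powRD; last by rewrite (gt_eqF h0) implybT.
    rewrite -hN.
    have hsp : h `^ (s * p) <= kap.
      have -> : kap = hb `^ (s * p) by rewrite /hb -powRrM mulVf ?gt_eqF// powRr1// ltW.
      by apply: ge0_ler_powR; rewrite ?nnegrE ?(ltW sp0) ?(ltW h0) ?(ltW hb0).
    have : N%:R `^ (N%:R + s * p) * h `^ (s * p) * (Lam + 1) <= rho.
      have -> : rho = N%:R `^ (N%:R + s * p) * kap * (Lam + 1).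
        by rewrite /kap; field; rewrite !gt_eqF ?powR_gt0// ltr_wpDl.
      by apply: ler_wpM2r; [rewrite addr_ge0|apply: ler_wpM2l; rewrite ?powR_ge0].
    move=> /(ler_wpM2l (ltW vol0)); apply: le_trans.
    by rewrite le_eqVlt; apply/orP; left; apply/eqP; ring.
  by rewrite lee_pmul2l// lte_fin.
have /choice[c Hc] := step_rho.
have msc j : measurable_fun setT (step Q (c j)) by exact: measurable_step.
have mvs j : measurable_fun setT (v j \- step Q (c j)) by exact: measurable_funB.
(* B bounds the coefficients, since the step functions are bounded in L^p. *)
pose B := ((C * (1 + rho)) / h ^+ N) `^ p^-1.
have cB q j : `|c j q| <= B.
  have h1 := pint_step_ge p mQ dQ muQ (c j) q.
  have h2 : (P (step Q (c j)) <= (C * (1 + rho))%:E)%E.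
    have -> : step Q (c j) = (fun x => v j x - (v j \- step Q (c j)) x).
      by apply/funext => x /=; ring.
    apply: (le_trans (HC _ _ (mv j) (mvs j))); rewrite Pv EFinM.
    by apply: lee_wpmul2l; [rewrite lee_fin ltW|rewrite EFinD leeD2l].
  have := le_trans h1 h2; rewrite lee_fin -ler_pdivlMr// => h3.
  rewrite -[leLHS](powRpK p1)// /B; apply: ge0_ler_powR.
  - by rewrite invr_ge0 ltW.
  - by rewrite nnegrE powR_ge0.
  - by rewrite nnegrE; apply: le_trans h3; exact: powR_ge0.
  - exact: h3.
have /choice[l Hl] : forall q, exists l : R, c t q @[t --> U] --> l.
  by move=> q; apply: (@ultra_bounded_cvg _ _ _ _ B); exact: nearW.
pose tau := (e / (2 * C) / (n * h ^+ N + 1)) `^ p^-1.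
have nv0 : 0 < n * h ^+ N + 1 by rewrite ltr_wpDl// mulr_ge0// ltW.
have tau0 : 0 < tau by rewrite powR_gt0// !divr_gt0// mulr_gt0.
exists [set t | forall q, `|l q - c t q| <= tau / 2].
  apply: filter_forall => q; have /cvgrPdist_le := Hl q.
  by move=> /(_ (tau / 2)); apply; rewrite divr_gt0.
move=> i j Ai Aj.
have -> : (v i \- v j) = (fun x => ((v i \- step Q (c i)) x - (v j \- step Q (c j)) x) -
    step Q (fun q => c j q - c i q) x).
  apply/funext => x /=.
  have -> : step Q (fun q => c j q - c i q) x = step Q (c j) x - step Q (c i) x.
    by rewrite /step -sumrB; apply: eq_bigr => q _; ring.
  by ring.
have mA : measurable_fun setT (fun x => (v i \- step Q (c i)) x - (v j \- step Q (c j)) x).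
  exact: measurable_funB.
apply: (le_trans (HC _ _ mA (measurable_step mQ _))).
have hA : (P (fun x => (v i \- step Q (c i)) x - (v j \- step Q (c j)) x)%R <=
    (C * (rho + rho))%:E)%E.
  apply: (le_trans (HC _ _ (mvs i) (mvs j))); rewrite EFinM EFinD.
  by apply: lee_wpmul2l; [rewrite lee_fin ltW|exact: leeD].
have hB : (P (step Q (fun q => c j q - c i q)%R) <= (e / (2 * C))%:E)%E.
  apply: (le_trans (pint_step_le p1 mQ dQ muQ (ltW tau0) _)).
    move=> q; have := Ai q; have := Aj q; rewrite !ler_norml; lra.
  rewrite lee_fin -/n /tau powRVpK//; last first.
    by rewrite ltW// !divr_gt0// mulr_gt0.
  rewrite (_ : n * _ = e / (2 * C) * (n * h ^+ N) / (n * h ^+ N + 1)); last by ring.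
  by rewrite ler_pdivrMr// ler_wpM2l ?lerDl// ltW// divr_gt0// mulr_gt0.
apply: (@le_trans _ _ (C%:E * ((C * (rho + rho))%:E + (e / (2 * C))%:E))%E).
  by apply: lee_wpmul2l; [rewrite lee_fin ltW|exact: leeD].
rewrite -EFinD -EFinM lee_fin le_eqVlt; apply/orP; left; apply/eqP.
by rewrite /rho; field; rewrite gt_eqF.
Qed.

End compactness.

(** * Stability of the minimizer *)

Section stability.
Context {R : realType} {N : nat}.
Hypothesis N1 : (1 <= N)%N.
Implicit Types (x y : 'rV[R]_N) (k s : R).
Implicit Types (u v w f g : 'rV[R]_N -> R).
Local Notation mu := (lebesgue_rV R N).
Local Notation mu2 := (mu \x mu)%E.
Variable p : R.
Hypothesis p1 : 1 < p.
Let p0 : 0 < p. Proof. exact: lt_trans ltr01 p1. Qed.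
Variable Omega : set 'rV[R]_N.
Hypothesis hopen : open Omega.
Hypothesis hbnd : bounded_set Omega.
Local Notation W0 s := (W0 s p Omega).
Local Notation P u := (pint mu p u).
Local Notation G s u := (Gp p s u).
Local Notation eigenpair := (eigenpair p Omega).

(** The midpoint of f and g is at distance half that of f and g from f, hence
    has nearly the same norm. *)
Lemma midpoint_pint_ge (t : R) : 0 < t -> exists2 d : R, 0 < d & forall f g,
  measurable_fun setT f -> measurable_fun setT g -> P f = 1%E ->
  (P (f \- g)%R <= d%:E)%E -> ((1 - 2 * t)%:E <= P (fun x => (f x + g x) / 2)%R)%E.
Proof.
move=> t0; have [C C0 HC] := pint_close mu p1 t0.
have C1 : 0 < C + 1 by rewrite ltr_wpDl.
exists (t / (C + 1)) => [|f g mf mg Pf fg]; first exact: divr_gt0.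
pose m x := (f x + g x) / 2.
have mm : measurable_fun setT m by apply: measurable_funM => //; exact: measurable_funD.
have mfg : measurable_fun setT (f \- g) by exact: measurable_funB.
have h : (P (fun x => m x - f x)%R <= (t / (C + 1))%:E)%E.
  rewrite (_ : (fun x => _) = fun x => - 2^-1 * (f \- g) x); last first.
    by apply/funext => x; rewrite /m/=; lra.
  rewrite pintZ//; apply: le_trans fg.
  rewrite -[leRHS]mul1e; apply: lee_wpmul2r; first exact: pint_ge0.
  have e1 : (1 : R) `^ p = 1 by rewrite powR1.
  rewrite lee_fin -[leRHS]e1; apply: le_powRp => //.
  by rewrite normrN ger0_norm ?invr_ge0// invf_le1// ler1n.
have := HC _ _ mm mf; rewrite Pf -/m => h2.
(* The constant C of the closeness inequality is beaten by the factor 1 / (C +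
   1) in the assumed distance. *)
have h3 : (1 <= (1 + t)%:E * P m + t%:E)%E.
  apply: (le_trans h2); apply: leeD => //.
  apply: (le_trans (lee_wpmul2l _ h)); first by rewrite lee_fin.
  by rewrite -EFinM lee_fin mulrCA ger_pMr// ler_pdivrMr// mul1r lerDl.
have := pint_ge0 mu p m; move: h3; case: (P m) => [r| |]; rewrite ?leey//.
rewrite -EFinM -EFinD !lee_fin => h3 r0.
have := mulr_gt0 t0 t0; nra.
Qed.

(** Both energies are close to L while the midpoint, a nonnegative competitor
    of norm close to 1, has energy at least about L. Hence the gap is small,
    and uniform convexity turns this into closeness in energy. *)
Lemma energy_close s L us (e : R) : 0 < s < 1 -> 0 <= L -> eigenpair s L us -> 0 < e ->
  exists2 d : R, 0 < d & forall f g, W0 s f -> W0 s g ->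
  {ae mu, forall x, 0 <= f x} -> {ae mu, forall x, 0 <= g x} -> P f = 1%E ->
  (G s f <= (L + d)%:E)%E -> (G s g <= (L + d)%:E)%E -> (P (f \- g)%R <= d%:E)%E ->
  (G s (f \- g)%R <= e%:E)%E.
Proof.
move=> /andP[s0 s1] L0 [_ _ _ _ HL] e0.
have L1 : 0 < L + 1 by rewrite ltr_wpDl.
have L2 : 0 < 2 * L + 1 by rewrite ltr_wpDl// mulr_ge0.
pose eta := e / (4 * (L + 1)).
have eta0 : 0 < eta by rewrite divr_gt0// mulr_gt0.
have [C C0 HC] := pint_uniform_convexity mu2 p1 eta0.
have C1 : 0 < C + 1 by rewrite ltr_wpDl.
pose t := e / (2 * (C + 1) * (2 * L + 1)).
have t0 : 0 < t by rewrite divr_gt0// !mulr_gt0.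
have [d d0 Hd] := midpoint_pint_ge t0.
exists (Num.min d (Num.min t 1)) => [|f g wf wg f0 g0 Pf]; first by rewrite !lt_min d0 t0/=.
set d' := Num.min _ _.
have [d'd d't d'1] : [/\ d' <= d, d' <= t & d' <= 1] by rewrite /d' !ge_min !lexx !orbT.
move=> Gf Gg fg.
have mf := W0_measurable wf; have mg := W0_measurable wg.
have mqf := measurable_dq p s mf; have mqg := measurable_dq p s mg.
pose m x := (f x + g x) / 2.
have Pm : ((1 - 2 * t)%:E <= P m)%E.
  by apply: (Hd f g mf mg Pf); apply: (le_trans fg); rewrite lee_fin.
have Gm : ((L * (1 - 2 * t))%:E <= G s m)%E.
  rewrite EFinM; apply: (@le_trans _ _ (L%:E * P m)%E); first exact: lee_wpmul2l.
  apply: HL; first exact: W0_half.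
  by apply: filterS2 f0 g0 => x fx gx; rewrite /m divr_ge0// addr_ge0.
have gap0 : (0 <= \int[mu2]_z (pgap p (dq p s f z) (dq p s g z))%:E)%E.
  by apply: integral_ge0 => z _; rewrite lee_fin pgap_ge0.
have id := pint_midpoint mu2 p1 mqf mqg.
rewrite -dq_half in id.
have gap : (\int[mu2]_z (pgap p (dq p s f z) (dq p s g z))%:E <= (t * (2 * L + 1))%:E)%E.
  have : (\int[mu2]_z (pgap p (dq p s f z) (dq p s g z))%:E + (L * (1 - 2 * t))%:E <=
      (L + t)%:E)%E.
    apply: (@le_trans _ _ (\int[mu2]_z (pgap p (dq p s f z) (dq p s g z))%:E + G s m)%E).
      by rewrite leeD2l.
    rewrite /Gp id; apply: (@le_trans _ _ (2^-1%:E * ((L + d')%:E + (L + d')%:E))%E).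
      by apply: lee_wpmul2l; [rewrite lee_fin invr_ge0|exact: leeD].
    by rewrite -EFinD -EFinM lee_fin; lra.
  by rewrite -leeBrDr// => /le_trans; apply; rewrite -EFinB lee_fin; lra.
rewrite /Gp dqB; apply: (le_trans (HC _ _ mqf mqg)).
apply: (@le_trans _ _ (eta%:E * ((L + 1)%:E + (L + 1)%:E) + C%:E * (t * (2 * L + 1))%:E)%E).
  apply: leeD; apply: lee_wpmul2l => //; try by rewrite lee_fin ltW.
  by apply: leeD; [apply: (le_trans Gf)|apply: (le_trans Gg)]; rewrite lee_fin lerD2l.
rewrite (_ : (_ + _)%E = (eta * (L + 1 + (L + 1)) + C * (t * (2 * L + 1)))%:E)// lee_fin.
have -> : eta * (L + 1 + (L + 1)) = e / 2 by rewrite /eta; field; rewrite gt_eqF.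
have : C * (t * (2 * L + 1)) <= (C + 1) * (t * (2 * L + 1)).
  by apply: ler_wpM2r; [rewrite mulr_ge0// ltW|lra].
have -> : (C + 1) * (t * (2 * L + 1)) = e / 2 by rewrite /t; field; rewrite !gt_eqF.
lra.
Qed.

(** The sequence converges almost everywhere and, by Fatou's lemma, in L^p and
    in energy. The limit is an eigenfunction, so it is the given one by
    uniqueness. *)
Lemma fast_minimizing_limit s L us (h : nat -> 'rV[R]_N -> R) : 0 < s < 1 -> 0 <= L ->
  eigenpair s L us ->
  (forall n, W0 s (h n)) -> (forall n, P (h n) = 1%E) ->
  (forall n, {ae mu, forall x, 0 <= h n x}) ->
  (forall n, (G s (h n) <= (L + n.+1%:R^-1)%:E)%E) ->
  (forall n l, (n <= l)%N -> (P (h l \- h n)%R <= (fast p n)%:E)%E) ->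
  (forall n l, (n <= l)%N -> (G s (h l \- h n)%R <= (fast p n)%:E)%E) ->
  forall n, (G s (h n \- us)%R <= (fast p n)%:E)%E.
Proof.
move=> s01 L0 eigs wh Ph hp Gh hP hG; have /andP[s0 s1] := s01.
have mh n := W0_measurable (wh n).
have [w mw hw] := pint_fast_limit p1 mh (fun n => hP n n.+1 (leqnSn n)).
have hdq f : measurable_fun setT f ->
    {ae mu2, forall z, dq p s (h n \- f) z @[n --> \oo] --> dq p s (w \- f) z}.
  move=> mf; apply: filterS2 (ae_product1 mu hw) (ae_product2 mu hw) => z z1 z2.
  by apply: cvgMl; apply: cvgB; apply: cvgB => //; exact: cvg_cst.
have Pw n : (P (h n \- w)%R <= (fast p n)%:E)%E.
  rewrite pintBC; apply: (@pint_fatou _ _ _ mu p p1 (fun l => h l \- h n) _ _ n).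
  - by move=> l; exact: measurable_funB.
  - exact: measurable_funB.
  - by apply: filterS hw => x hx; apply: cvgB => //; exact: cvg_cst.
  - by move=> l nl; exact: hP.
have Gw n : (G s (h n \- w)%R <= (fast p n)%:E)%E.
  rewrite GpBC; apply: (@pint_fatou _ _ _ mu2 p p1 (fun l => dq p s (h l \- h n)) _ _ n).
  - by move=> l; apply: measurable_dq; exact: measurable_funB.
  - by apply: measurable_dq; exact: measurable_funB.
  - exact: hdq.
  - by move=> l nl; exact: hG.
have w0 : {ae mu, forall x, ~ Omega x -> w x = 0}.
  have : {ae mu, forall x, forall n, ~ Omega x -> h n x = 0}.
    by apply/ae_foralln => n; exact: W0_ae0 (wh n).
  apply: filterS2 hw => x hx h0 xO.
  rewrite (_ : (fun n => h n x) = fun=> 0) in hx; last by apply/funext => n; exact: h0.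
  by apply/esym; apply: (cvg_unique _ (cvg_cst 0) hx).
have wp : {ae mu, forall x, 0 <= w x}.
  have : {ae mu, forall x, forall n, 0 <= h n x} by apply/ae_foralln.
  apply: filterS2 hw => x hx h0.
  by rewrite -(cvg_lim (@Rhausdorff R) hx); apply: limr_ge; [exact: cvgP hx|exact: nearW].
have ww : W0 s w.
  apply: (W0_closed p1 s0 mw w0) => e e0; have [n0 Hn0] := fast_small p1 e0.
  by exists (h n0) => //; apply: (le_trans (Gw n0)); rewrite lee_fin Hn0.
have Pw1 : P w = 1%E.
  have Pfin : P w \is a fin_num by rewrite ge0_fin_numE ?pint_ge0//; exact: pint_lty ww.
  have PwE : P w = (fine (P w))%:E by rewrite fineK.
  have hc (eta : R) : 0 < eta -> fine (P w) - eta <= 1 /\ 1 <= fine (P w) + eta.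
    move=> eta0; have [d d0 Hd] := pint_continuous p1 mw PwE eta0.
    have [n0 Hn0] := fast_small p1 d0.
    have := Hd _ (mh n0); rewrite Ph !lee_fin; apply.
    by apply: (le_trans (Pw n0)); rewrite lee_fin Hn0.
  rewrite PwE; congr EFin; apply/eqP; rewrite eq_le; apply/andP; split.
    by apply/ler_addgt0Pr => eta /hc[]; lra.
  by apply/ler_addgt0Pr => eta /hc[].
have GwL : (G s w <= L%:E)%E.
  apply/lee_addgt0Pr => eta eta0.
  apply: (@pint_fatou _ _ _ mu2 p p1 (fun l => dq p s (h l)) _ _ (Num.bound eta^-1)).
  - by move=> l; exact: measurable_dq.
  - exact: measurable_dq.
  - apply: filterS2 (ae_product1 mu hw) (ae_product2 mu hw) => z z1 z2.
    by apply: cvgMl; exact: cvgB.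
  - move=> n nn; apply: (le_trans (Gh n)); rewrite -EFinD lee_fin lerD2l.
    rewrite -[leRHS]invrK lef_pV2 ?posrE ?invr_gt0//.
    have i0 : 0 <= eta^-1 by rewrite invr_ge0 ltW.
    apply: (le_trans (ltW (archi_boundP i0))); rewrite ler_nat; exact: leqW.
have [_ _ _ _ HL] := eigs.
have eigw : eigenpair s L w.
  split => //; apply/eqP; rewrite eq_le GwL/=.
  by have := HL _ ww wp; rewrite Pw1 mule1.
have uw := eigenfunction_unique N1 p1 hopen hbnd s01 L0 eigw eigs.
have mus : measurable_fun setT us by case: eigs => /W0_measurable.
move=> n; rewrite (_ : G s (h n \- us) = G s (h n \- w)%R)//.
apply: Gp_ae_eq => //; try exact: measurable_funB.
by apply: filterS uw => x /= ->.
Qed.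

(** Along an ultrafilter a minimizing sequence is Cauchy in L^p by
    compactness, hence in energy; a subsequence that is fast in both then
    converges to the eigenfunction. *)
Lemma minimizer_stability s L us (e : R) : 0 < s < 1 -> 0 <= L -> eigenpair s L us -> 0 < e ->
  exists2 d : R, 0 < d & forall v, W0 s v -> P v = 1%E -> {ae mu, forall x, 0 <= v x} ->
  (G s v <= (L + d)%:E)%E -> (G s (v \- us)%R <= e%:E)%E.
Proof.
move=> s01 L0 eigs e0; have /andP[s0 s1] := s01.
apply: contrapT => H.
have /choice[v Hv] : forall n : nat, exists v, [/\ W0 s v, P v = 1%E,
    {ae mu, forall x, 0 <= v x}, (G s v <= (L + n.+1%:R^-1)%:E)%E &
    ~ (G s (v \- us)%R <= e%:E)%E].
  move=> n; apply: contrapT => Hn; apply: H.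
  exists n.+1%:R^-1 => [|v wv Pv v0 Gv]; first by rewrite invr_gt0.
  by apply: contrapT => Ge; apply: Hn; exists v.
have wv n : W0 s (v n) by have [] := Hv n.
have Pv n : P (v n) = 1%E by have [] := Hv n.
have vp n : {ae mu, forall x, 0 <= v n x} by have [] := Hv n.
have Gv n : (G s (v n) <= (L + n.+1%:R^-1)%:E)%E by have [] := Hv n.
have Gbig n : ~ (G s (v n \- us)%R <= e%:E)%E by have [] := Hv n.
have mv n := W0_measurable (wv n).
have [U [UU ooU]] := @ultraFilterLemma nat \oo _.
have UT n : U [set l | (n <= l)%N] by apply: ooU; exists n.
have Gv1 n : (G s (v n) <= (L + 1)%:E)%E.
  by apply: (le_trans (Gv n)); rewrite lee_fin lerD2l invf_le1// ler1n.
have L1 : 0 <= L + 1 by rewrite addr_ge0.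
have HA (d : R) : 0 < d -> exists2 A, U A & forall i j, A i -> A j ->
    (P (v i \- v j)%R <= d%:E)%E /\ (G s (v i \- v j)%R <= d%:E)%E.
  move=> d0; have [d1 d10 Hd1] := energy_close s01 L0 eigs d0.
  have dm0 : 0 < Num.min d d1 by rewrite lt_min d0.
  have [A UA Ac] := rellich N1 p1 hbnd UU s0 L1 mv (fun n => W0_ae0 (wv n)) Pv Gv1 dm0.
  exists (A `&` [set l | (Num.bound d1^-1 <= l)%N]); first exact: filterI.
  have tail l : (Num.bound d1^-1 <= l)%N -> (G s (v l) <= (L + d1)%:E)%E.
    move=> ll; apply: (le_trans (Gv l)); rewrite lee_fin lerD2l.
    rewrite -[leRHS]invrK lef_pV2 ?posrE ?invr_gt0//.
    have i0 : 0 <= d1^-1 by rewrite invr_ge0 ltW.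
    apply: (le_trans (ltW (archi_boundP i0))); rewrite ler_nat; exact: leqW.
  move=> i j [Ai Ti] [Aj Tj]; have hij := Ac i j Ai Aj.
  have hd : (P (v i \- v j)%R <= d%:E)%E.
    by apply: (le_trans hij); rewrite lee_fin ge_min lexx.
  split=> //; apply: Hd1 => //; try exact: tail.
  by apply: (le_trans hij); rewrite lee_fin ge_min lexx orbT.
have /choice[A HAn] : forall n, exists A, U A /\ forall i j, A i -> A j ->
    (P (v i \- v j)%R <= (fast p n)%:E)%E /\ (G s (v i \- v j)%R <= (fast p n)%:E)%E.
  by move=> n; have [A UA HA'] := HA _ (fast_gt0 p n); exists A.
(* Indices at least n at which the first n + 1 requirements hold, so that
   later choices remain comparable with earlier ones. *)
pose B n := [set l | (n <= l)%N] `&` [set l | forall m : 'I_n.+1, A m l].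
have UB n : U (B n).
  apply: filterI; first exact: UT.
  by apply: (@filter_forall _ _ (fun (m : 'I_n.+1) l => A m l)) => m; have [] := HAn m.
have /choice[j Hj] : forall n, exists l, B n l by move=> n; exact: filter_ex (UB n).
have Aj n l : (n <= l)%N -> A n (j l).
  by move=> nl; have [_ /(_ (Ordinal (nl : (n < l.+1)%N)))] := Hj l.
have [n0 Hn0] := fast_small p1 e0.
have hG n : (G s (v (j n)) <= (L + n.+1%:R^-1)%:E)%E.
  apply: (le_trans (Gv _)); rewrite lee_fin lerD2l.
  by rewrite lef_pV2 ?posrE// ler_nat ltnS; have [] := Hj n.
have hP n l : (n <= l)%N -> (P (v (j l) \- v (j n))%R <= (fast p n)%:E)%E.
  by move=> nl; have [_ h] := HAn n; have [] := h _ _ (Aj n l nl) (Aj n n (leqnn n)).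
have hD n l : (n <= l)%N -> (G s (v (j l) \- v (j n))%R <= (fast p n)%:E)%E.
  by move=> nl; have [_ h] := HAn n; have [] := h _ _ (Aj n l nl) (Aj n n (leqnn n)).
apply: (Gbig (j n0)).
have := @fast_minimizing_limit s L us (fun n => v (j n)) s01 L0 eigs
  (fun n => wv (j n)) (fun n => Pv (j n)) (fun n => vp (j n)) hG hP hD n0.
by move=> /le_trans; apply; rewrite lee_fin Hn0.
Qed.

End stability.

Unset Implicit Arguments.
Set Strict Implicit.
Set Printing Implicit Defensive.

Theorem theorem4p2 (R : realType) (N : nat) (hN : (1 <= N)%N)
    (p : R) (hp : 1 < p) (s : R) (hs : 0 < s < 1)
    (Omega : set 'rV[R]_N) (hopen : open Omega) (hbnd : bounded_set Omega)
    (u : R -> 'rV[R]_N -> R)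
    (hu : forall k, 0 < k < 1 -> first_eigenfunction k p Omega (u k)) :
  gagliardo s p (u k \- u s) @[k --> s^'+] --> 0%E.
Proof.
have eig k : 0 < k < 1 -> exists2 L, 0 <= L & eigenpair p Omega k L (u k).
  by move=> k01; exact: first_eigenfunctionP (hu k k01).
have [L L0 eigs] := eig _ hs.
have p0 : 0 < p := lt_trans ltr01 hp.
apply/cvge0P => [k|e e0]; first exact: poweR_ge0.
have ep0 : 0 < e `^ p by exact: powR_gt0.
have [d d0 Hd] := minimizer_stability hN hp hopen hbnd hs L0 eigs ep0.
have mus : measurable_fun setT (u s) by case: eigs => /W0_measurable.
apply: filterS (eigenpair_minimizing hN hp hopen hbnd hs L0 eigs eig d0) => k [wk Pk uk Gk].
have mk := W0_measurable wk.
rewrite gagliardoE//; last exact: measurable_funB.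
rewrite -(powRpK hp (ltW e0)) -poweR_EFin.
apply: gt0_ler_poweR.
- by rewrite invr_ge0 ltW.
- by rewrite in_itv/= leey andbT Gp_ge0.
- by rewrite in_itv/= leey andbT lee_fin ltW.
- by apply: Hd.
Qed.
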